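(* (i) Let $ds^2=\lambda(z,\bar z)\,dz\,d\bar z$, $z=\varphi+iy$, be a metric such that there exists a function $f:\mathbb{R}^2\to\mathbb{R}$ of $(\varphi,y)$ satisfying $$\lambda=\frac14\left(\frac{\partial^2f}{\partial\varphi^2}+\frac{\partial^2f}{\partial y^2}\right)$$ and $$\frac{\partial}{\partial\varphi}\left(\left(\frac{\partial^2f}{\partial\varphi^2}-\frac{\partial^2f}{\partial y^2}\right)\left(\frac{\partial^2f}{\partial\varphi^2}+\frac{\partial^2f}{\partial y^2}\right)\right)=2\frac{\partial}{\partial y}\left(\frac{\partial^2f}{\partial\varphi\,\partial y}\left(\frac{\partial^2f}{\partial\varphi^2}+\frac{\partial^2f}{\partial y^2}\right)\right).\qquad( * )$$ Then the geodesic flow of $ds^2$ possesses an integral cubic in momenta. (ii) Conversely, if the geodesic flow of a two-dimensional Riemannian metric $ds^2$ possesses an integral which is cubic in momenta and which does not depend on (is not a function of) the Hamiltonian and an integral of smaller degree, then there exist (local) conformal coordinates $\varphi,y$ and a real-valued function $f$ of $(\varphi,y)$ such that $ds^2=\lambda(z,\bar z)\,dz\,d\bar z$ with $z=\varphi+iy$, $\lambda=\frac14\left(\frac{\partial^2f}{\partial\varphi^2}+\frac{\partial^2f}{\partial y^2}\right)$, and $( * )$ holds.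
   Context: All objects are smooth. For a metric $ds^2=\lambda\,dz\,d\bar z=\lambda(d\varphi^2+dy^2)$, $\lambda>0$, in conformal coordinates $z=\varphi+iy$, the geodesic flow is the Hamiltonian system on the cotangent bundle with Hamiltonian $H=\frac{p_zp_{\bar z}}{4\lambda}$ (up to an irrelevant constant factor $H=\frac{1}{2\lambda}(p_\varphi^2+p_y^2)$), where $p_z=\frac12(p_\varphi-ip_y)$, $p_{\bar z}=\overline{p_z}$. An integral of degree $m$ in momenta is a real smooth function $F$ on the cotangent bundle with $\{F,H\}=0$, independent of $H$, which in local coordinates is a polynomial of degree $m$ in the momenta with coefficients smooth functions of position. ''Cubic'' means degree $3$. *)

(* Defs.v *)
From HB Require Import structures.
From mathcomp Require Import all_boot all_order all_algebra.
From mathcomp Require Import all_classical all_reals all_analysis.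
Set Implicit Arguments.
Unset Strict Implicit.
Unset Printing Implicit Defensive.
Import Order.TTheory GRing.Theory Num.Theory.
Import numFieldNormedType.Exports.
Local Open Scope classical_set_scope.
Local Open Scope ring_scope.

(* Points of the plane, tangent vectors and momenta are row vectors
   'rV[R]_2; coordinate 0 is phi and coordinate 1 is y.  A function on the
   cotangent bundle of an open U `<=` 'rV[R]_2 is F : 'rV[R]_2 -> 'rV[R]_2 -> R,
   F x p being its value at position x and momentum p. *)

Section plane.
Context {R : realType}.
Implicit Types (U : set 'rV[R]_2) (f : 'rV[R]_2 -> R).
Implicit Types (g : 'rV[R]_2 -> 'M[R]_2) (F H : 'rV[R]_2 -> 'rV[R]_2 -> R).

Definition pd (i : 'I_2) f : 'rV[R]_2 -> R :=
  fun x => 'D_(delta_mx 0 i : 'rV[R]_2) f x.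

(* Meant for open U: all iterated partial derivatives of order <= k exist and
   are continuous at the points of U. *)
Fixpoint Ck_on (k : nat) U f : Prop :=
  (forall x, U x -> {for x, continuous f}) /\
  (if k is k'.+1 then
     forall i : 'I_2,
       (forall x, U x -> derivable f x (delta_mx 0 i : 'rV[R]_2)) /\
       Ck_on k' U (pd i f)
   else True).

Definition smooth_on U f := forall k, Ck_on k U f.

Definition smooth_map_on U (psi : 'rV[R]_2 -> 'rV[R]_2) :=
  forall i : 'I_2, smooth_on U (fun x => psi x 0 i).

(* g x is the Gram matrix of the metric at x. *)
Definition riemannian_on U g :=
  (forall i j : 'I_2, smooth_on U (fun x => g x i j)) /\
  (forall x, U x -> (g x)^T = g x /\
     forall v : 'rV[R]_2, v != 0 -> 0 < (v *m g x *m v^T) 0 0).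

(* For g x = (lambda x)%:M this is (p_phi ^+ 2 + p_y ^+ 2) / (2 * lambda x). *)
Definition hamiltonian g : 'rV[R]_2 -> 'rV[R]_2 -> R :=
  fun x p => 2^-1 * (p *m invmx (g x) *m p^T) 0 0.

Definition pd_pos (i : 'I_2) F x p : R := pd i (fun u => F u p) x.
Definition pd_mom (i : 'I_2) F x p : R := pd i (F x) p.

Definition poisson F H x p : R :=
  \sum_(i < 2) (pd_pos i F x p * pd_mom i H x p
                - pd_mom i F x p * pd_pos i H x p).

(* Total degree exactly m, not necessarily homogeneous, with smooth
   coefficients.  The closure condition says that the degree is m on every
   coordinate patch: the part of degree m does not vanish identically over any
   nonempty open subset of U. *)
Definition polynomial_in_momenta U (m : nat) F :=
  exists a : nat -> nat -> 'rV[R]_2 -> R,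
  [/\ forall i j, smooth_on U (a i j),
      forall x p, U x ->
        F x p = \sum_(i < m.+1) \sum_(j < m.+1 | (i + j <= m)%N)
                  a i j x * p 0 0 ^+ i * p 0 1 ^+ j
    & U `<=` closure [set x | exists2 i, (i <= m)%N & a i (m - i)%N x != 0]].

Definition phase_differential F x p : 'rV[R]_(2 + 2) :=
  row_mx (\row_i pd_pos i F x p) (\row_i pd_mom i F x p).

(* Functional independence: the differentials of F and H are linearly
   independent on a dense set of points of the cotangent bundle of U. *)
Definition independent_on U F H :=
  U `*` setT `<=`
  closure [set z : 'rV[R]_2 * 'rV[R]_2 |
    row_free (col_mx (phase_differential F z.1 z.2)
                     (phase_differential H z.1 z.2))].

(* F is an integral, of degree m in momenta, of the geodesic flow of g.
   Smoothness of F follows from that of its coefficients. *)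
Definition integral_on U g (m : nat) F :=
  [/\ polynomial_in_momenta U m F,
      forall x p, U x -> poisson F (hamiltonian g) x p = 0
    & independent_on U F (hamiltonian g)].

Definition laplacian f : 'rV[R]_2 -> R :=
  fun x => pd 0 (pd 0 f) x + pd 1 (pd 1 f) x.

Definition pde_star f (x : 'rV[R]_2) :=
  pd 0 (fun u => (pd 0 (pd 0 f) u - pd 1 (pd 1 f) u) * laplacian f u) x =
  2 * pd 1 (fun u => pd 0 (pd 1 f) u * laplacian f u) x.

End plane.

Section surface.
Context {R : realType} {M : topologicalType}.

(* The values of cmap outside cdom, and of cinv outside cmap @` cdom, are
   irrelevant. *)
Record chart := Chart {
  cdom : set M;
  cmap : M -> 'rV[R]_2;
  cinv : 'rV[R]_2 -> M }.

Definition cimg (c : chart) : set 'rV[R]_2 := cmap c @` cdom c.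

Definition is_chart (c : chart) :=
  [/\ open (cdom c), open (cimg c),
      forall x, cdom c x -> cinv c (cmap c x) = x,
      {within cdom c, continuous (cmap c)}
    & {within cimg c, continuous (cinv c)}].

Definition overlap (c d : chart) : set 'rV[R]_2 :=
  cmap c @` (cdom c `&` cdom d).

Definition transition (c d : chart) : 'rV[R]_2 -> 'rV[R]_2 :=
  cmap d \o cinv c.

Definition compatible (c d : chart) :=
  smooth_map_on (overlap c d) (transition c d) /\
  smooth_map_on (overlap d c) (transition d c).

(* A maximal smooth atlas consists of all the local coordinate systems of the
   surface. *)
Definition maximal_atlas (A : set chart) :=
  [/\ forall c, A c -> is_chart c,
      forall x, exists c, A c /\ cdom c x,
      forall c d, A c -> A d -> compatible c d
    & forall c, is_chart c -> (forall d, A d -> compatible c d) -> A c].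

Definition smooth_surface (A : set chart) :=
  [/\ hausdorff_space M, @second_countable M & maximal_atlas A].

Implicit Types (A : set chart) (g : chart -> 'rV[R]_2 -> 'M[R]_2).
Implicit Types (F : chart -> 'rV[R]_2 -> 'rV[R]_2 -> R).

(* A tensor or a function on the cotangent bundle is given by its expressions
   in all the charts.  With the library convention 'J, tangent vectors
   transform by v |-> v *m 'J and momenta by p |-> p *m 'J^T, the latter from
   the chart d back to the chart c. *)
Definition riemannian_metric A g :=
  (forall c, A c -> riemannian_on (cimg c) (g c)) /\
  (forall c d, A c -> A d -> forall x, overlap c d x ->
     g c x = 'J (transition c d) x *m g d (transition c d x)
             *m ('J (transition c d) x)^T).

Definition cotangent_function A F :=
  forall c d, A c -> A d -> forall x p, overlap c d x ->
    F c x (p *m ('J (transition c d) x)^T) = F d (transition c d x) p.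

Definition geodesic_integral A g (m : nat) F :=
  cotangent_function A F /\
  (forall c, A c -> integral_on (cimg c) (g c) m (F c)).

(* F = Phi (H, G) with H the Hamiltonian, G an integral of degree < m. *)
Definition reducible_integral A g (m : nat) F :=
  exists (k : nat) G (Phi : 'rV[R]_2 -> R),
  [/\ (k < m)%N, geodesic_integral A g k G, smooth_on setT Phi
    & forall c, A c -> forall x p, cimg c x ->
        F c x p =
        Phi (\row_i (if i == 0 then hamiltonian (g c) x p else G c x p))].

End surface.
Arguments chart : clear implicits.

(* Main.v *)
Require Import Defs.
From mathcomp Require Import all_boot all_order all_algebra.
From mathcomp.real_closed Require Import complex.
From mathcomp Require Import all_classical all_reals all_analysis.
From mathcomp Require Import ring lra.
Import Order.TTheory GRing.Theory Num.Theory.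
Import numFieldNormedType.Exports.
Set Implicit Arguments.
Unset Strict Implicit.
Unset Printing Implicit Defensive.
Local Open Scope classical_set_scope.
Local Open Scope ring_scope.

(* In conformal coordinates a cubic form with trace-free part [Re p_z^3], up to a
   constant, Poisson commutes with [|p|^2 / (2 lambda)] exactly when three linear
   combinations of first derivatives vanish.  Two combinations of these equations
   say that [lambda] and the linear form multiplying [|p|^2] are assembled from
   the second derivatives of one function [f] with [4 lambda = laplacian f]; a
   third one is the equation (star).  This gives the integral from [f], and [f]
   from the integral by applying the Poincare lemma twice.

   It remains to normalise an arbitrary metric and cubic integral.  The part of
   degree 3 is again an integral; write it as a trace-free part plus the energy
   times a linear form.  Where the trace-free part is nonzero it is [Re w^3] for
   a complex linear form [w] obtained by a smooth cube root; where it vanishes on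
   an open set, the linear form is a Killing field.  The vanishing of the bracket
   modulo the energy forces the two real vector fields of this conformal frame
   (respectively the Killing field and its rotation by a right angle) to commute.
   The dual coframe is then closed, and by the Poincare lemma and the inverse
   function theorem it is the differential of coordinates, which are conformal
   and in which the trace-free part is [Re p_z^3] up to a constant (respectively
   [lambda] depends on [y] only, and [f] is a second primitive of [4 lambda]). *)

(** * Calculus in the plane *)

(** In complex notation let [b = b0 + i b1] be the linear form that multiplies [|p|^2 / lambda]
    beside [Re (p0 + i p1)^3]. The three equations are then [b_zbar = - 3 lambda_z] and
    [div (lambda b) = 0]. Locally the first says that [lambda = f_{z zbar}] and [b = - 3 f_zz] for
    some real [f]; all numerical coefficients below come from this substitution, which turns the
    second into (star).

    No prior isothermal coordinates are used. Completing the square in the energy gives a conformal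
    frame, multiplication by the complex cube root keeps it conformal, and once this frame commutes
    its coordinates are conformal automatically. It commutes because, modulo [|w|^2], the bracket
    equals [{Re w, Im w}] times [Im w^3] up to a nonzero factor, and [Im w^3] has no common factor
    with [|w|^2].

    The trace-free part may vanish at a point without vanishing around it. Neither normal form is
    available there, so a chart is found in every nonempty open set instead of around every point.

    Each use of the Poincare lemma shrinks the ball, whence the pairs of radii [r < r']. *)

Section ck_calculus.
Context {R : realType}.
Implicit Types (U V : set 'rV[R]_2) (f g : 'rV[R]_2 -> R) (x : 'rV[R]_2).

Lemma near_open {T : topologicalType} (U : set T) (P : T -> Prop) (x : T) :
  open U -> U x -> (forall y, U y -> P y) -> \near x, P x.
Proof. by move=> oU Ux UP; apply: filterS (open_nbhs_nbhs (conj oU Ux)). Qed.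

Lemma derivable_eq_on U f g x v : open U -> U x -> (forall y, U y -> f y = g y) ->
  derivable f x v -> derivable g x v.
Proof. by move=> oU Ux fg; apply: (near_eq_derivable (near_open oU Ux fg)). Qed.

Lemma pd_eq_on U f g i x : open U -> U x -> (forall y, U y -> f y = g y) ->
  pd i f x = pd i g x.
Proof. by move=> oU Ux fg; apply: (near_eq_derive _ (near_open oU Ux fg)). Qed.

Lemma continuous_eq_on U f g x : open U -> U x -> (forall y, U y -> f y = g y) ->
  {for x, continuous f} -> {for x, continuous g}.
Proof.
move=> oU Ux fg cf; rewrite /prop_for /continuous_at -(fg _ Ux).
exact: cvg_trans (near_eq_cvg (near_open oU Ux fg)) cf.
Qed.

Lemma Ck_on_eq k U f g : open U -> (forall x, U x -> f x = g x) ->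
  Ck_on k U f -> Ck_on k U g.
Proof.
move=> oU; elim: k f g => [|k IH] f g fg /= [cf df]; split => //.
- by move=> x Ux; exact: continuous_eq_on fg (cf _ Ux).
- by move=> x Ux; exact: continuous_eq_on fg (cf _ Ux).
- move=> i; have [dfi ci] := df i; split.
    by move=> x Ux; apply: derivable_eq_on fg (dfi _ Ux).
  by apply: IH ci => x Ux; exact: pd_eq_on fg.
Qed.

Lemma Ck_on_subset k U V f : V `<=` U -> Ck_on k U f -> Ck_on k V f.
Proof.
move=> VU; elim: k f => [|k IH] f /= [cf df]; split => //; try by move=> x /VU/cf.
by move=> i; have [dfi ci] := df i; split; [move=> x /VU/dfi|exact: IH].
Qed.

Lemma Ck_on_pred k U f : Ck_on k.+1 U f -> Ck_on k U f.
Proof.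
elim: k f => [|k IH] f [cf df]; split => // i.
by have [dfi ci] := df i; split => //; exact: IH.
Qed.

Lemma Ck_on_continuous k U f x : Ck_on k U f -> U x -> {for x, continuous f}.
Proof. by case: k => [|k] [+ _]; exact. Qed.

Lemma Ck_on_cst k U (c : R) : Ck_on k U (fun=> c).
Proof.
elim: k c => [|k IH] c; split => //; try by move=> x _; exact: cst_continuous.
move=> i; split; first by move=> x _; exact: derivable_cst.
have -> : pd i (fun=> c) = (fun=> 0).
  by apply/funext => x; rewrite /pd derive_cst.
exact: IH.
Qed.

Lemma pdD i f g x : derivable f x (delta_mx 0 i) -> derivable g x (delta_mx 0 i) ->
  pd i (fun u => f u + g u) x = pd i f x + pd i g x.
Proof. by move=> df dg; rewrite /pd (deriveD df dg). Qed.

Lemma pdN i f x : derivable f x (delta_mx 0 i) ->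
  pd i (fun u => - f u) x = - pd i f x.
Proof. by move=> df; rewrite /pd (deriveN df). Qed.

Lemma pdM i f g x : derivable f x (delta_mx 0 i) -> derivable g x (delta_mx 0 i) ->
  pd i (fun u => f u * g u) x = pd i f x * g x + f x * pd i g x.
Proof.
move=> df dg; rewrite /pd (deriveM df dg).
by rewrite -![_ *: _]/(_ * _) addrC mulrC.
Qed.

Lemma pdV i f x : f x != 0 -> derivable f x (delta_mx 0 i) ->
  pd i (fun u => (f u)^-1) x = - (f x ^- 2 * pd i f x).
Proof. by move=> f0 df; rewrite /pd (deriveV f0 df) -mulNr. Qed.

Lemma Ck_onD k U f g : open U -> Ck_on k U f -> Ck_on k U g ->
  Ck_on k U (fun x => f x + g x).
Proof.
move=> oU; elim: k f g => [|k IH] f g [cf df] [cg dg].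
  by split => // x Ux; apply: continuousD; [exact: cf|exact: cg].
split; first by move=> x Ux; apply: continuousD; [exact: cf|exact: cg].
move=> i; have [dfi ci] := df i; have [dgi di] := dg i; split.
  by move=> x Ux; apply: derivableD; [exact: dfi|exact: dgi].
apply: Ck_on_eq (IH _ _ ci di) => // x Ux.
by rewrite pdD; [|exact: dfi|exact: dgi].
Qed.

Lemma Ck_onN k U f : open U -> Ck_on k U f -> Ck_on k U (fun x => - f x).
Proof.
move=> oU; elim: k f => [|k IH] f [cf df].
  by split => // x Ux; apply: continuousN; exact: cf.
split; first by move=> x Ux; apply: continuousN; exact: cf.
move=> i; have [dfi ci] := df i; split.
  by move=> x Ux; apply: derivableN; exact: dfi.
by apply: Ck_on_eq (IH _ ci) => // x Ux; rewrite pdN//; exact: dfi.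
Qed.

Lemma Ck_onM k U f g : open U -> Ck_on k U f -> Ck_on k U g ->
  Ck_on k U (fun x => f x * g x).
Proof.
move=> oU; elim: k f g => [|k IH] f g Cf Cg.
  have [cf _] := Cf; have [cg _] := Cg.
  by split => // x Ux; apply: continuousM; [exact: cf|exact: cg].
have [cf df] := Cf; have [cg dg] := Cg.
split; first by move=> x Ux; apply: continuousM; [exact: cf|exact: cg].
move=> i; have [dfi ci] := df i; have [dgi di] := dg i; split.
  by move=> x Ux; apply: derivableM; [exact: dfi|exact: dgi].
have := Ck_onD oU (IH _ _ ci (Ck_on_pred Cg)) (IH _ _ (Ck_on_pred Cf) di).
apply: Ck_on_eq => // x Ux.
by rewrite pdM; [|exact: dfi|exact: dgi].
Qed.

(** In the derivative [- f' / f^2] the inverse of [f] is needed to one order less, so an induction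
    on [k] with [f] fixed suffices. The square root below is treated in the same way. *)
Lemma Ck_onV k U f : open U -> (forall x, U x -> f x != 0) -> Ck_on k U f ->
  Ck_on k U (fun x => (f x)^-1).
Proof.
move=> oU f0; elim: k => [|k IH] Cf.
  by have [cf _] := Cf; split => // x Ux; apply: continuousV; [exact: f0|exact: cf].
have [cf df] := Cf.
split; first by move=> x Ux; apply: continuousV; [exact: f0|exact: cf].
move=> i; have [dfi ci] := df i; split.
  by move=> x Ux; apply: derivableV; [exact: f0|exact: dfi].
have IH' := IH (Ck_on_pred Cf).
have := Ck_onN oU (Ck_onM oU (Ck_onM oU IH' IH') ci).
apply: Ck_on_eq => // x Ux; rewrite pdV; [|exact: f0|exact: dfi].
by rewrite expr2 invfM.
Qed.

(** Only a directional derivative of [f] is assumed, so the one-variable chain rule is applied to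
    the restriction of [f] to the line through [x] along [v]. *)
Lemma derive_comp1 (h : R -> R) f x v : derivable f x v -> derivable h (f x) 1 ->
  derivable (h \o f) x v /\ 'D_v (h \o f) x = 'D_1 h (f x) * 'D_v f x.
Proof.
move=> df dh.
pose k (t : R) := f (t *: v + x).
have k0 : k 0 = f x by rewrite /k scale0r add0r.
have dk : derivable k 0 1 by exact: (derivable1P f x v).1.
have dhk : derivable h (k 0) 1 by rewrite k0.
have E (F : 'rV[R]_2 -> R) : 'D_v F x = 'D_1 (fun t : R => F (t *: v + x)) 0.
  rewrite /derive; set g1 := fun t => _; set g2 := (X in _ = lim (X @ _)).
  suff -> : g1 = g2 by []; rewrite funeqE /g1 /g2 => t /=.
  by rewrite addr0 scale0r add0r [t *: 1]mulr1.
split.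
  apply/derivable1P/derivable1_diffP/(@differentiable_comp _ _ _ _ k h);
  exact/derivable1_diffP.
rewrite !E.
have := derive1_comp dk dhk; rewrite !derive1E k0 => <-.
by [].
Qed.

Lemma Ck_on_sqrt k U f : open U -> (forall x, U x -> 0 < f x) -> Ck_on k U f ->
  Ck_on k U (fun x => Num.sqrt (f x)).
Proof.
move=> oU f0; elim: k => [|k IH] Cf.
  have [cf _] := Cf; split => // x Ux.
  by apply: (@continuous_comp _ _ _ f) => //; [exact: cf|exact: sqrt_continuous].
have [cf df] := Cf.
split.
  move=> x Ux.
  by apply: (@continuous_comp _ _ _ f) => //; [exact: cf|exact: sqrt_continuous].
have ds x : U x -> is_derive (f x) 1 Num.sqrt (2 * Num.sqrt (f x))^-1.
  by move=> Ux; apply: is_derive1_sqrt; exact: f0.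
move=> i; have [dfi ci] := df i; split.
  move=> x Ux; apply: (derive_comp1 (dfi x Ux) _).1.
  by have [] := ds x Ux.
have IH' := IH (Ck_on_pred Cf).
have s0 x : U x -> 2 * Num.sqrt (f x) != 0.
  by move=> Ux; rewrite mulf_neq0// gt_eqF// sqrtr_gt0 f0.
have := Ck_onM oU (Ck_onV oU s0 (Ck_onM oU (Ck_on_cst k U 2) IH')) ci.
apply: Ck_on_eq => // x Ux.
have [d1 d2] := ds x Ux.
by rewrite /pd (derive_comp1 (dfi x Ux) d1).2 d2.
Qed.

Lemma smooth_on_eq U f g : open U -> (forall x, U x -> f x = g x) ->
  smooth_on U f -> smooth_on U g.
Proof. by move=> oU fg sf k; exact: Ck_on_eq fg (sf k). Qed.

Lemma smooth_on_subset U V f : V `<=` U -> smooth_on U f -> smooth_on V f.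
Proof. by move=> VU sf k; exact: Ck_on_subset (sf k). Qed.

Lemma smooth_on_pd U f i : smooth_on U f -> smooth_on U (pd i f).
Proof. by move=> sf k; have [_ /(_ i)[]] := sf k.+1. Qed.

Lemma smooth_on_derivable U f i x : smooth_on U f -> U x ->
  derivable f x (delta_mx 0 i).
Proof. by move=> sf Ux; have [_ /(_ i)[+ _]] := sf 1; exact. Qed.

Lemma smooth_on_continuous U f x : smooth_on U f -> U x -> {for x, continuous f}.
Proof. by move=> sf Ux; exact: Ck_on_continuous (sf 0) Ux. Qed.

Lemma smooth_on_intro U f : (forall x, U x -> {for x, continuous f}) ->
  (forall i x, U x -> derivable f x (delta_mx 0 i)) ->
  (forall i, smooth_on U (pd i f)) -> smooth_on U f.
Proof.
move=> cf df sf [|k]; first by split.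
by split => // i; split; [exact: df|exact: sf].
Qed.

Lemma smooth_on_cst U (c : R) : smooth_on U (fun=> c).
Proof. by move=> k; exact: Ck_on_cst. Qed.

Lemma smooth_onD U f g : open U -> smooth_on U f -> smooth_on U g ->
  smooth_on U (fun x => f x + g x).
Proof. by move=> oU sf sg k; exact: Ck_onD. Qed.

Lemma smooth_onN U f : open U -> smooth_on U f -> smooth_on U (fun x => - f x).
Proof. by move=> oU sf k; exact: Ck_onN. Qed.

Lemma smooth_onB U f g : open U -> smooth_on U f -> smooth_on U g ->
  smooth_on U (fun x => f x - g x).
Proof. by move=> oU sf sg; apply: smooth_onD => //; exact: smooth_onN. Qed.

Lemma smooth_onM U f g : open U -> smooth_on U f -> smooth_on U g ->
  smooth_on U (fun x => f x * g x).
Proof. by move=> oU sf sg k; exact: Ck_onM. Qed.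

Lemma smooth_onV U f : open U -> (forall x, U x -> f x != 0) -> smooth_on U f ->
  smooth_on U (fun x => (f x)^-1).
Proof. by move=> oU f0 sf k; exact: Ck_onV. Qed.

Lemma smooth_onX U f n : open U -> smooth_on U f -> smooth_on U (fun x => f x ^+ n).
Proof.
move=> oU sf; elim: n => [|n IH].
  by apply: smooth_on_eq (smooth_on_cst U 1) => // x _; rewrite expr0.
by apply: smooth_on_eq (smooth_onM oU sf IH) => // x _; rewrite exprS.
Qed.

Lemma smooth_on_sqrt U f : open U -> (forall x, U x -> 0 < f x) -> smooth_on U f ->
  smooth_on U (fun x => Num.sqrt (f x)).
Proof. by move=> oU f0 sf k; exact: Ck_on_sqrt. Qed.

End ck_calculus.

Section is_derive_pointwise.
Context {R : realType} {V : normedModType R}.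
Implicit Types (x v : V) (f g : V -> R) (a b : R).

(** These rules are stated for functions under a binder and not for sums and products of functions,
    the shape on which [isD] works. *)
Lemma is_derive_addE x v f g a b : is_derive x v f a -> is_derive x v g b ->
  is_derive x v (fun u => f u + g u) (a + b).
Proof. exact: is_deriveD. Qed.

Lemma is_derive_oppE x v f a : is_derive x v f a ->
  is_derive x v (fun u => - f u) (- a).
Proof. exact: is_deriveN. Qed.

Lemma is_derive_mulE x v f g a b : is_derive x v f a -> is_derive x v g b ->
  is_derive x v (fun u => f u * g u) (a * g x + f x * b).
Proof.
move=> Df Dg; have := is_deriveM Df Dg.
by rewrite addrC -![_ *: _]/(_ * _) [g x * a]mulrC.
Qed.

Lemma is_derive_cstE x v (c : R) : is_derive x v (fun=> c) (0 : R).
Proof. exact: is_derive_cst. Qed.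

End is_derive_pointwise.

(** * The mean value theorem along paths with a corner *)

Section plane_differential.
Context {R : realType}.
Implicit Types (U V : set 'rV[R]_2) (f g : 'rV[R]_2 -> R) (x y : 'rV[R]_2).

Lemma coord_le_norm n (x : 'rV[R]_n) i : `|x 0 i| <= `|x|.
Proof.
rewrite [leRHS]/Num.norm /= mx_normrE.
exact: (le_bigmax _ (fun ij : 'I_1 * 'I_n => `|x ij.1 ij.2|) (0, i)).
Qed.

Lemma norm_le_coord n (x : 'rV[R]_n) e : 0 <= e -> (forall i, `|x 0 i| <= e) ->
  `|x| <= e.
Proof.
move=> e0 xe; rewrite [leLHS]/Num.norm /= mx_normrE.
by apply: bigmax_le => // -[i j] _ /=; rewrite ord1.
Qed.

Lemma ball_rVE n (x y : 'rV[R]_n) r : 0 < r ->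
  ball x r y <-> forall i, `|x 0 i - y 0 i| < r.
Proof.
move=> r0; split=> [[_ xy] i|xy]; first exact: xy.
by split => // i j; rewrite ord1; exact: xy.
Qed.

Lemma delta_row n (i j : 'I_n) : (delta_mx 0 i : 'rV[R]_n) 0 j = (i == j)%:R.
Proof. by rewrite mxE eqxx /= eq_sym. Qed.

Lemma ord2P (P : 'I_2 -> Prop) : P 0 -> P 1 -> forall i, P i.
Proof.
move=> P0 P1 [[|[|//]] i].
  by rewrite (_ : Ordinal i = 0)//; exact/val_inj.
by rewrite (_ : Ordinal i = 1)//; exact/val_inj.
Qed.

Lemma big_ord2 (F : 'I_2 -> R) : \sum_(i < 2) F i = F 0 + F 1.
Proof.
by rewrite !big_ord_recl big_ord0 addr0; congr (_ + F _); exact/val_inj.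
Qed.

Lemma cvg_rV n {T : Type} {F : set_system T} {FF : Filter F} (u : T -> 'rV[R]_n)
  (l : 'rV[R]_n) :
  (forall i, (fun t => u t 0 i) @ F --> l 0 i) -> u @ F --> l.
Proof.
move=> ul; apply/cvgrPdist_le => e e0.
have : \forall t \near F, forall i, `|l 0 i - u t 0 i| <= e.
  by apply: filter_forall => i; move/cvgrPdist_le : (ul i); exact.
apply: filterS => t ht; apply: norm_le_coord; first exact: ltW.
by move=> i; have := ht i; rewrite !mxE.
Qed.

Lemma is_derive_line f x v t (h : R) : derivable f (x + (t * h) *: v) v ->
  is_derive t 1 (fun s : R => f (x + (s * h) *: v)) (h * 'D_v f (x + (t * h) *: v)).
Proof.
set y := x + _ => df.
pose g (s : R) := f (s *: v + y).
have dg : derivable g 0 1 by exact: (derivable1P f y v).1.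
have E : 'D_v f y = 'D_1 g 0.
  rewrite /derive; set g1 := fun t => _; set g2 := (X in _ = lim (X @ _)).
  suff -> : g1 = g2 by []; rewrite funeqE /g1 /g2 /g => s /=.
  by rewrite addr0 scale0r add0r [s *: 1]mulr1.
pose k (s : R) := (s - t) * h.
have -> : (fun s : R => f (x + (s * h) *: v)) = g \o k.
  apply/funext => s; rewrite /g /k /y /=; congr f.
  by rewrite addrCA -scalerDl; congr (_ + _ *: _); ring.
rewrite E mulrC; apply: is_derive1_comp.
  by rewrite /k subrr mul0r; apply: DeriveDef.
have -> : k = (h *: (id - cst t) : R -> R) by apply/funext => s; rewrite /k mulrC.
apply: is_derive_eq; rewrite subr0; exact: mulr1.
Qed.

Lemma mvt_line f x v (h : R) :
  (forall c, 0 <= c <= 1 -> derivable f (x + (c * h) *: v) v) ->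
  exists2 c, 0 <= c <= 1 &
    f (x + h *: v) - f x = h * 'D_v f (x + (c * h) *: v).
Proof.
move=> df.
have := @MVT_segment R (fun s => f (x + (s * h) *: v))
  (fun s => h * 'D_v f (x + (s * h) *: v)) 0 1 ler01.
case.
- move=> s; rewrite in_itv /= => /andP[s0 s1]; apply: is_derive_line.
  by apply: df; rewrite !ltW.
- apply: derivable_within_continuous => s; rewrite in_itv /= => s01.
  by have [] := is_derive_line (df s s01).
- move=> c; rewrite in_itv /= => c01; rewrite mul1r mul0r scale0r addr0.
  by rewrite subr0 mulr1 => ->; exists c.
Qed.

(** [interp x y c 0] runs through the horizontal leg and [interp x y 1 d] through the vertical leg
    of the path from [x] to [y]. Balls of the sup norm are squares, so the path stays in every ball
    that contains its ends. *)
Definition interp x y (c d : R) : 'rV[R]_2 :=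
  \row_i (x 0 i + (if i == 0 then c else d) * (y 0 i - x 0 i)).

Lemma interp_ball x y z r c d : 0 < r -> 0 <= c <= 1 -> 0 <= d <= 1 ->
  ball z r x -> ball z r y -> ball z r (interp x y c d).
Proof.
move=> r0 /andP[c0 c1] /andP[d0 d1] /(ball_rVE _ _ r0) zx /(ball_rVE _ _ r0) zy.
apply/(ball_rVE _ _ r0) => i; move: (zx i) (zy i); rewrite mxE !ltr_norml.
set e := if _ then _ else _.
have /andP[e0 e1] : 0 <= e <= 1 by rewrite /e; case: ifP => _; apply/andP.
have [->|ene0] := eqVneq e 0; first by rewrite mul0r addr0.
have {ene0} : 0 < e by rewrite lt_neqAle eq_sym ene0.
by move=> ? /andP[? ?] /andP[? ?]; apply/andP; split; nra.
Qed.

Lemma mvt_plane f x y :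
  (forall i c d, 0 <= c <= 1 -> 0 <= d <= 1 ->
     derivable f (interp x y c d) (delta_mx 0 i)) ->
  exists c d, [/\ 0 <= c <= 1, 0 <= d <= 1 &
    f y - f x = (y 0 0 - x 0 0) * pd 0 f (interp x y c 0)
              + (y 0 1 - x 0 1) * pd 1 f (interp x y 1 d)].
Proof.
move=> df.
have I01 : (0 <= (0 : R) <= 1) && (0 <= (1 : R) <= 1) by rewrite !lexx ler01.
have [I0 I1] := andP I01.
have E0 c : x + (c * (y 0 0 - x 0 0)) *: delta_mx 0 0 = interp x y c 0.
  by apply/rowP; apply: ord2P; rewrite !mxE /=; ring.
have E1 d : interp x y 1 0 + (d * (y 0 1 - x 0 1)) *: delta_mx 0 1 = interp x y 1 d.
  by apply/rowP; apply: ord2P; rewrite !mxE /=; ring.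
have E2 : x + (y 0 0 - x 0 0) *: delta_mx 0 0 = interp x y 1 0.
  by rewrite -E0 mul1r.
have E3 : interp x y 1 0 + (y 0 1 - x 0 1) *: delta_mx 0 1 = y.
  by apply/rowP; apply: ord2P; rewrite !mxE /=; ring.
have [c c01] := @mvt_line f x (delta_mx 0 0) (y 0 0 - x 0 0)
  (fun c hc => eq_ind_r (fun z => derivable f z _) (df 0 c 0 hc I0) (E0 c)).
rewrite E0 E2 => Hc.
have [d d01] := @mvt_line f (interp x y 1 0) (delta_mx 0 1) (y 0 1 - x 0 1)
  (fun d hd => eq_ind_r (fun z => derivable f z _) (df 1 1 d I1 hd) (E1 d)).
rewrite E1 E3 => Hd.
by exists c, d; split => //; rewrite /pd -Hc -Hd; ring.
Qed.

End plane_differential.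

(** * Differentials and the chain rule for maps with continuous partial derivatives *)

Section plane_chain_rule.
Context {R : realType}.
Implicit Types (U V : set 'rV[R]_2) (f g : 'rV[R]_2 -> R) (x y : 'rV[R]_2).

(** The increment is a sum of two legs, and on each the partial derivative differs from its value at
    [x] by at most [e / 2]. *)
Lemma increment_C1 U f x e : open U -> Ck_on 1 U f -> U x -> 0 < e ->
  \forall h \near (0 : 'rV[R]_2),
    `|f (h + x) - f x - (h 0 0 * pd 0 f x + h 0 1 * pd 1 f x)| <= e * `|h|.
Proof.
move=> oU [cf df] Ux e0.
have e20 : 0 < e / 2 by rewrite divr_gt0.
have cd i : \forall y \near x, `|pd i f x - pd i f y| <= e / 2.
  have [_ [ci _]] := df i.
  by have /cvgrPdist_le/(_ _ e20) := ci _ Ux.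
have : \forall y \near x, [/\ U y, `|pd 0 f x - pd 0 f y| <= e / 2
    & `|pd 1 f x - pd 1 f y| <= e / 2].
  by apply: filterS3 (open_nbhs_nbhs (conj oU Ux)) (cd 0) (cd 1) => y; split.
move=> /nbhs_ballP[r /= r0 Br].
apply/nbhs_ballP; exists r => //= h h_r.
have hr i : `|h 0 i| < r.
  by move/(ball_rVE _ _ r0) : h_r => /(_ i); rewrite !mxE sub0r normrN.
have Bx : ball x r x by exact: ballxx.
have Bh : ball x r (h + x).
  apply/(ball_rVE _ _ r0) => i; rewrite mxE opprD addrCA subrr addr0 normrN.
  exact: hr.
have [i c d I1 I2|c [d [I1 I2 ->]]] := @mvt_plane _ f x (h + x).
  have [dfi _] := df i; apply: dfi.
  by have [] := Br _ (interp_ball r0 I1 I2 Bx Bh).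
have I01 : (0 <= (0 : R) <= 1) && (0 <= (1 : R) <= 1) by rewrite !lexx ler01.
have [J0 J1] := andP I01.
have [_ P0 _] := Br _ (interp_ball r0 I1 J0 Bx Bh).
have [_ _ P1] := Br _ (interp_ball r0 J1 I2 Bx Bh).
set a := pd 0 f (interp _ _ _ _) in P0 *; set b := pd 1 f (interp _ _ _ _) in P1 *.
rewrite !mxE !addrK.
rewrite (_ : _ - _ = - (h 0 0 * (pd 0 f x - a) + h 0 1 * (pd 1 f x - b))); last by ring.
rewrite normrN; apply: le_trans (ler_normD _ _) _; rewrite !normrM.
rewrite (_ : e * `|h| = `|h| * (e / 2) + `|h| * (e / 2)); last by field.
by apply: lerD; apply: ler_pM => //; exact: coord_le_norm.
Qed.

Lemma differentiable_C1_map n U (psi : 'rV[R]_2 -> 'rV[R]_n) x : open U ->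
  (forall j, Ck_on 1 U (fun u => psi u 0 j)) -> U x ->
  differentiable psi x /\
  'd psi x = (fun v => v *m \matrix_(i, j) pd i (fun u => psi u 0 j) x) :>
    (_ -> _).
Proof.
move=> oU C1 Ux; set A := \matrix_(i, j) _.
pose df : {linear 'rV[R]_2 -> 'rV[R]_n} := mulmxr A.
have cdf : continuous df.
  move=> v; apply: (cvg_rV (FF := nbhs_filter v)) => j.
  have -> : (fun t => df t 0 j) = (fun t : 'rV[R]_2 => t 0 0 * A 0 j + t 0 1 * A 1 j).
    by apply/funext => t; rewrite mxE big_ord2.
  have -> : df v 0 j = v 0 0 * A 0 j + v 0 1 * A 1 j by rewrite mxE big_ord2.
  by apply: cvgD; apply: cvgMl; exact: coord_continuous.
have lo : psi \o shift x = cst (psi x) + df +o_ (0 : 'rV[R]_2) id.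
  apply/eqaddoP => e e0.
  have H : \forall h \near (0 : 'rV[R]_2), forall j,
      `|psi (h + x) 0 j - psi x 0 j - (h 0 0 * A 0 j + h 0 1 * A 1 j)| <= e * `|h|.
    apply: (@filter_forall _ _ _ _ (nbhs_filter (0 : 'rV[R]_2))) => j; rewrite /A !mxE.
    exact: (increment_C1 oU (C1 j) Ux e0).
  apply: filterS H => h Hh; apply: norm_le_coord.
    by rewrite mulr_ge0// ltW.
  move=> j; apply: (le_trans _ (Hh j)); rewrite -[(_ - _) h]/(psi (h + x) - (psi x + h *m A)).
  by rewrite !mxE big_ord2 opprD addrA /A !mxE.
have E := diff_unique cdf lo.
by split; [apply/diff_locallyP; rewrite E|rewrite E].
Qed.

Lemma differentiable_C1 U f x : open U -> Ck_on 1 U f -> U x ->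
  differentiable f x.
Proof.
move=> oU C1 Ux.
pose psi : 'rV[R]_2 -> 'rV[R]_1 := fun u => \row_j f u.
have E j : (fun u => psi u 0 j) = f by apply/funext => u; rewrite mxE.
have [|dpsi _] := @differentiable_C1_map 1 U psi x oU _ Ux.
  by move=> j; rewrite E.
rewrite (_ : f = (fun M : 'rV[R]_1 => M 0 0) \o psi); last first.
  by apply/funext => u /=; rewrite mxE.
by apply: differentiable_comp => //; exact: differentiable_coord.
Qed.

Lemma derive_C1 U f x v : open U -> Ck_on 1 U f -> U x ->
  'D_v f x = v 0 0 * pd 0 f x + v 0 1 * pd 1 f x.
Proof.
move=> oU C1 Ux; have df := differentiable_C1 oU C1 Ux.
have -> : v = v 0 0 *: delta_mx 0 0 + v 0 1 *: delta_mx 0 1.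
  by apply/rowP; apply: ord2P; rewrite !mxE /=; ring.
by rewrite deriveE// linearD !linearZ /= -!deriveE// !mxE /= /pd; congr (_ + _);
  rewrite -[LHS]/(_ * _); ring.
Qed.

Lemma jacobian_C1 n U (psi : 'rV[R]_2 -> 'rV[R]_n) x : open U ->
  (forall j, Ck_on 1 U (fun u => psi u 0 j)) -> U x ->
  'J psi x = \matrix_(i, j) pd i (fun u => psi u 0 j) x.
Proof.
move=> oU C1 Ux; have [_ E] := differentiable_C1_map oU C1 Ux.
by apply/row_matrixP => i; rewrite !rowE mul_rV_lin1 /= E.
Qed.

Lemma pd_comp U V f (psi : 'rV[R]_2 -> 'rV[R]_2) i x : open U -> open V ->
  Ck_on 1 V f -> (forall j, Ck_on 1 U (fun u => psi u 0 j)) -> U x -> V (psi x) ->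
  derivable (f \o psi) x (delta_mx 0 i) /\
  pd i (f \o psi) x =
    pd i (fun u => psi u 0 0) x * pd 0 f (psi x) +
    pd i (fun u => psi u 0 1) x * pd 1 f (psi x).
Proof.
move=> oU oV Cf Cpsi Ux Vx.
have df := differentiable_C1 oV Cf Vx.
have [dpsi E] := differentiable_C1_map oU Cpsi Ux.
have dc : differentiable (f \o psi) x by exact: differentiable_comp.
split; first exact: diff_derivable.
rewrite /pd deriveE// diff_comp//= -deriveE// (derive_C1 _ oV Cf Vx) E.
by rewrite -rowE !mxE.
Qed.

Lemma continuous_map U (psi : 'rV[R]_2 -> 'rV[R]_2) x :
  (forall j, {for x, continuous (fun u => psi u 0 j)}) -> {for x, continuous psi}.
Proof. by move=> c; exact: (cvg_rV (FF := nbhs_filter x)). Qed.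

(** Induction on [k] with [f] general and [psi] fixed: the partial derivatives of the composite
    involve those of [f] composed with the same [psi]. *)
Lemma Ck_on_comp k U V f (psi : 'rV[R]_2 -> 'rV[R]_2) : open U -> open V ->
  (forall x, U x -> V (psi x)) ->
  Ck_on k V f -> (forall j, Ck_on k U (fun u => psi u 0 j)) ->
  Ck_on k U (f \o psi).
Proof.
move=> oU oV UV; elim: k f => [|k IH] f Cf Cpsi.
  split => // x Ux; apply: continuous_comp.
    by apply: (@continuous_map U) => j; exact: Ck_on_continuous (Cpsi j) Ux.
  exact: Ck_on_continuous Cf (UV x Ux).
have C1 (h : 'rV[R]_2 -> R) W : Ck_on k.+1 W h -> Ck_on 1 W h.
  elim: (k) => [//|n IHn] Ch; apply: IHn; exact: Ck_on_pred.
have Cf1 := C1 _ _ Cf; have Cpsi1 j := C1 _ _ (Cpsi j).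
split.
  move=> x Ux; apply: continuous_comp.
    by apply: (@continuous_map U) => j; exact: Ck_on_continuous (Cpsi j) Ux.
  exact: Ck_on_continuous Cf (UV x Ux).
move=> i; split.
  by move=> x Ux; have [] := pd_comp i oU oV Cf1 Cpsi1 Ux (UV _ Ux).
have [_ Df] := Cf.
have Cp j := IH _ (Df j).2 (fun j => Ck_on_pred (Cpsi j)).
have Dp j : Ck_on k U (pd i (fun u => psi u 0 j)) by have [_ /(_ i)[]] := Cpsi j.
have := Ck_onD oU (Ck_onM oU (Dp 0) (Cp 0)) (Ck_onM oU (Dp 1) (Cp 1)).
apply: Ck_on_eq => // x Ux.
by have [_ ->] := pd_comp i oU oV Cf1 Cpsi1 Ux (UV _ Ux).
Qed.

Lemma smooth_on_comp U V f (psi : 'rV[R]_2 -> 'rV[R]_2) : open U -> open V ->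
  (forall x, U x -> V (psi x)) -> smooth_on V f -> smooth_map_on U psi ->
  smooth_on U (f \o psi).
Proof.
by move=> oU oV UV sf sp k; apply: (Ck_on_comp oU oV UV) => // j; exact: sp.
Qed.

End plane_chain_rule.

(** * The inverse function theorem *)

Section inverse_function.
Context {R : realType}.
Implicit Types (U V : set 'rV[R]_2) (f g : 'rV[R]_2 -> R) (x y : 'rV[R]_2).

Lemma det_mx2 (A : 'M[R]_2) : \det A = A 0 0 * A 1 1 - A 0 1 * A 1 0.
Proof.
rewrite (expand_det_row A 0) big_ord2 /cofactor !det_mx11 !mxE /=.
rewrite (_ : lift 0 0 = 1); last exact/val_inj.
rewrite (_ : lift 1 0 = 0); last exact/val_inj.
by rewrite /= addn0 addn1 expr0 expr1; ring.
Qed.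

(** In ['I_2] the index [1 - i] is the one other than [i]. *)
Definition adj2 (A : 'M[R]_2) : 'M[R]_2 :=
  \matrix_(i, j) (if i == j then A (1 - i) (1 - j) else - A i j).

Lemma invmx2 (A : 'M[R]_2) : \det A != 0 -> invmx A = (\det A)^-1 *: adj2 A.
Proof.
move=> d0.
have uA : A \in unitmx by rewrite unitmxE unitfE.
apply: (can_inj (mulKmx uA)); rewrite mulmxV// -scalemxAr.
apply/matrixP; apply: ord2P; apply: ord2P; rewrite !mxE big_ord2 !mxE /=;
  rewrite ?subr0 ?subrr; rewrite det_mx2 in d0 *; field.
all: exact: d0.
Qed.

Lemma mulmx_row2 (v : 'rV[R]_2) (B : 'M[R]_2) j :
  (v *m B) 0 j = v 0 0 * B 0 j + v 0 1 * B 1 j.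
Proof. by rewrite mxE big_ord2. Qed.

Lemma mulmx_bound (B : 'M[R]_2) : exists2 C, 0 < C &
  forall v : 'rV[R]_2, `|v *m B| <= C * `|v|.
Proof.
exists (1 + \sum_i \sum_j `|B i j|).
  by rewrite ltr_pwDl// sumr_ge0// => i _; exact: sumr_ge0.
move=> v; apply: norm_le_coord => [|j].
  by rewrite mulr_ge0// addr_ge0// sumr_ge0// => i _; exact: sumr_ge0.
rewrite mulmx_row2; apply: (le_trans (ler_normD _ _)); rewrite !normrM.
have [v0 v1] := (coord_le_norm v 0, coord_le_norm v 1).
have Bj i : `|B i j| <= \sum_j `|B i j|.
  by rewrite (bigD1 j)//= lerDl sumr_ge0.
have := Bj 0; have := Bj 1; rewrite (big_ord2 (fun i => \sum_j `|B i j|)).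
have := normr_ge0 (B 0 j); have := normr_ge0 (B 1 j); have := normr_ge0 v.
have := normr_ge0 (v 0 0); have := normr_ge0 (v 0 1).
nra.
Qed.

Definition jac (psi : 'rV[R]_2 -> 'rV[R]_2) x : 'M[R]_2 :=
  \matrix_(i, j) pd i (fun u => psi u 0 j) x.

Lemma jacobian_smooth U psi x : open U -> smooth_map_on U psi -> U x ->
  'J psi x = jac psi x.
Proof. by move=> oU sp Ux; apply: (jacobian_C1 oU _ Ux) => j; exact: sp. Qed.

Lemma smooth_jac U psi i j : smooth_map_on U psi ->
  smooth_on U (fun x => jac psi x i j).
Proof.
move=> sp; rewrite (_ : (fun _ => _) = pd i (fun u => psi u 0 j)); last first.
  by apply/funext => x; rewrite mxE.
exact: smooth_on_pd.
Qed.

Lemma smooth_det U (A : 'rV[R]_2 -> 'M[R]_2) : open U ->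
  (forall i j, smooth_on U (fun x => A x i j)) -> smooth_on U (fun x => \det (A x)).
Proof.
move=> oU sA.
have := smooth_onB oU (smooth_onM oU (sA 0 0) (sA 1 1))
                      (smooth_onM oU (sA 0 1) (sA 1 0)).
by apply: smooth_on_eq => // x _; rewrite det_mx2.
Qed.

Lemma smooth_invmx U (A : 'rV[R]_2 -> 'M[R]_2) : open U ->
  (forall i j, smooth_on U (fun x => A x i j)) ->
  (forall x, U x -> \det (A x) != 0) ->
  forall i j, smooth_on U (fun x => invmx (A x) i j).
Proof.
move=> oU sA dA i j.
have sad : smooth_on U (fun x => adj2 (A x) i j).
  rewrite (_ : (fun _ => _) =
    fun x => if i == j then A x (1 - i) (1 - j) else - A x i j).
    by case: (i == j) => //; exact: smooth_onN.
  by apply/funext => x; rewrite mxE.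
have := smooth_onM oU (smooth_onV oU dA (smooth_det oU sA)) sad.
by apply: smooth_on_eq => // x Ux; rewrite invmx2 ?dA// [RHS]mxE.
Qed.

Lemma smooth_unit_nbhs U (A : 'rV[R]_2 -> R) x : open U ->
  smooth_on U A -> U x -> A x != 0 -> \forall y \near x, U y /\ A y != 0.
Proof.
move=> oU sA Ux Ax.
apply: filterI; first exact: open_nbhs_nbhs.
have cA := smooth_on_continuous sA Ux.
apply: (cA [set r | r != 0]); apply: open_nbhs_nbhs; split => //.
Qed.

End inverse_function.

(** * Contraction near a point with invertible Jacobian *)

Section local_inverse.
Context {R : realType}.
Implicit Types (U V N : set 'rV[R]_2) (f g : 'rV[R]_2 -> R) (x y : 'rV[R]_2).

Lemma is_derive_coord n (k i : 'I_n) (x : 'rV[R]_n) :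
  is_derive x (delta_mx 0 i : 'rV[R]_n) (fun u : 'rV[R]_n => u 0 k) (i == k)%:R.
Proof.
have D : derivable (id : 'rV[R]_n -> 'rV[R]_n) x (delta_mx 0 i) by exact: derivable_id.
apply: DeriveDef; first by have /derivable_mxP/(_ 0 k) := D.
have := derive_mx D; rewrite derive_id => /matrixP/(_ 0 k).
by rewrite [LHS]delta_row mxE => ->.
Qed.

Lemma continuous_nbhs_le f x e : 0 < e -> {for x, continuous f} ->
  \forall y \near x, `|f x - f y| <= e.
Proof. by move=> e0 /cvgrPdist_le/(_ e e0). Qed.

(* The quasi-Newton map [x |-> x - psi x *m B], with [B] the inverse of the
   Jacobian at the centre, is a 1/2-contraction near the centre. *)
Lemma newton_contraction U psi x0 : open U -> smooth_map_on U psi -> U x0 ->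
  \det (jac psi x0) != 0 ->
  exists B : 'M[R]_2, exists2 r, 0 < r & [/\ ball x0 r `<=` U, B \in unitmx,
    forall x, ball x0 r x -> \det (jac psi x) != 0 &
    forall x y, ball x0 r x -> ball x0 r y ->
      `|(y - psi y *m B) - (x - psi x *m B)| <= 2^-1 * `|y - x|].
Proof.
move=> oU sp Ux0 d0; set A := jac psi x0 in d0 *.
have uA : A \in unitmx by rewrite unitmxE unitfE.
exists (invmx A); set B := invmx A.
pose h k x : R := x 0 k - (psi x 0 0 * B 0 k + psi x 0 1 * B 1 k).
have hE x k : (x - psi x *m B) 0 k = h k x by rewrite /h !mxE big_ord2.
pose dh i k x : R := (i == k)%:R - (jac psi x i 0 * B 0 k + jac psi x i 1 * B 1 k).
have Dh i k x : U x -> is_derive x (delta_mx 0 i) (h k) (dh i k x).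
  move=> Ux.
  have D j : is_derive x (delta_mx 0 i) (fun u => psi u 0 j) (jac psi x i j).
    by rewrite mxE; apply: derivableP; exact: smooth_on_derivable (sp j) Ux.
  have Dk := is_derive_coord k i x.
  have M j : is_derive x (delta_mx 0 i) (fun u => psi u 0 j * B j k)
      (jac psi x i j * B j k).
    have := is_deriveM (D j) (is_derive_cst (B j k) x (delta_mx 0 i)).
    by rewrite scaler0 add0r [_ *: _]mulrC.
  exact: is_deriveB Dk (is_deriveD (M 0) (M 1)).
have cdh i k : {for x0, continuous (dh i k)}.
  apply: (@smooth_on_continuous _ U) => //.
  apply: smooth_onB (smooth_on_cst _ _) _ => //.
  by apply: smooth_onD => //; apply: smooth_onM => //;
    [exact: smooth_jac|exact: smooth_on_cst|exact: smooth_jac|exact: smooth_on_cst].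
have dh0 i k : dh i k x0 = 0.
  rewrite /dh -[X in _ - X](_ : (A *m B) i k = _); last by rewrite mxE big_ord2.
  by rewrite mulmxV// mxE subrr.
(* Two partial derivatives of size at most 1/4 add up to the factor 1/2 in the sup norm. *)
have e0 : 0 < (4^-1 : R) by rewrite invr_gt0.
have sd := smooth_det oU (fun i j => smooth_jac i j sp).
have H1 : \forall x \near x0, forall i k, `|dh i k x| <= 4^-1.
  apply: (@filter_forall _ _ _ _ (nbhs_filter x0)) => i.
  apply: (@filter_forall _ _ _ _ (nbhs_filter x0)) => k.
  have := continuous_nbhs_le e0 (cdh i k); apply: filterS => x.
  by rewrite dh0 sub0r normrN.
have : \forall x \near x0, (forall i k, `|dh i k x| <= 4^-1) /\
    U x /\ \det (jac psi x) != 0.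
  exact: filterI H1 (smooth_unit_nbhs oU sd Ux0 d0).
move=> /nbhs_ballP[r /= r0 Br]; exists r => //; split.
- by move=> x /Br[_ []].
- by rewrite unitmx_inv.
- by move=> x /Br[_ []].
move=> x y Bx By; apply: norm_le_coord => [|k]; first by rewrite mulr_ge0.
have -> : ((y - psi y *m B) - (x - psi x *m B)) 0 k = h k y - h k x.
  by rewrite -!hE !mxE.
have [i c d I1 I2|c [d [I1 I2 ->]]] := @mvt_plane _ (h k) x y.
  by have [_ [Ux _]] := Br _ (interp_ball r0 I1 I2 Bx By); have [] := Dh i k _ Ux.
have I01 : (0 <= (0 : R) <= 1) && (0 <= (1 : R) <= 1) by rewrite !lexx ler01.
have [J0 J1] := andP I01.
have P i u : ball x0 r u -> `|pd i (h k) u| <= 4^-1.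
  move=> /Br[Hu [Uu _]]; rewrite /pd; have [_ ->] := Dh i k u Uu; exact: Hu.
have P0 := P 0 _ (interp_ball r0 I1 J0 Bx By).
have P1 := P 1 _ (interp_ball r0 J1 I2 Bx By).
apply: le_trans (ler_normD _ _) _; rewrite !normrM.
have Q i : `|y 0 i - x 0 i| <= `|y - x|.
  by have := coord_le_norm (y - x) i; rewrite !mxE.
have := Q 0; have := Q 1; move: P0 P1.
set a := `|pd 0 _ _|; set b := `|pd 1 _ _|.
have a0 : 0 <= a by exact: normr_ge0.
have b0 : 0 <= b by exact: normr_ge0.
move: (normr_ge0 (y 0 0 - x 0 0)) (normr_ge0 (y 0 1 - x 0 1)) (normr_ge0 (y - x)).
set p := `|_ - _|; set q := `|_ - _|; set n := `|_ - _|.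
move=> p0 q0 n0 a4 b4 pn qn; nra.
Qed.

End local_inverse.

Section inverse_function_theorem.
Context {R : realType}.
Implicit Types (U V N : set 'rV[R]_2) (f g : 'rV[R]_2 -> R) (x y : 'rV[R]_2).

Lemma increment_C1_map U (psi : 'rV[R]_2 -> 'rV[R]_2) x e : open U ->
  smooth_map_on U psi -> U x -> 0 < e ->
  \forall h \near (0 : 'rV[R]_2),
    `|psi (h + x) - psi x - h *m jac psi x| <= e * `|h|.
Proof.
move=> oU sp Ux e0.
have H : \forall h \near (0 : 'rV[R]_2), forall j,
    `|psi (h + x) 0 j - psi x 0 j -
      (h 0 0 * jac psi x 0 j + h 0 1 * jac psi x 1 j)| <= e * `|h|.
  apply: (@filter_forall _ _ _ _ (nbhs_filter (0 : 'rV[R]_2))) => j.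
  by rewrite !mxE; exact: (increment_C1 oU (sp j 1%N) Ux e0).
apply: filterS H => h Hh; apply: norm_le_coord.
  by rewrite mulr_ge0// ltW.
by move=> j; apply: le_trans (Hh j); rewrite -mulmx_row2 !mxE.
Qed.

(** [y - x] is the difference of the Newton images plus [(psi y - psi x) *m B]; the first term is at
    most half of the left-hand side and is absorbed. *)
Lemma inverse_lipschitz (B : 'M[R]_2) (psi : 'rV[R]_2 -> 'rV[R]_2) x y :
  `|(y - psi y *m B) - (x - psi x *m B)| <= 2^-1 * `|y - x| ->
  `|y - x| <= 2 * `|(psi y - psi x) *m B|.
Proof.
move=> H.
have : y - x = (y - psi y *m B) - (x - psi x *m B) + (psi y - psi x) *m B.
  by rewrite mulmxBl; apply/rowP => j; rewrite !mxE; ring.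
move=> E; have := ler_normD ((y - psi y *m B) - (x - psi x *m B))
  ((psi y - psi x) *m B); rewrite -E; lra.
Qed.

Lemma closed_ball_rV_compact n (x : 'rV[R]_n) s : compact (closed_ball_ Num.norm x s).
Proof.
apply: bounded_closed_compact; last exact: closed_closed_ball_.
exists (`|x| + s); split => [|M xM u Ku]; first exact: num_real.
apply: (le_trans _ (ltW xM)); rewrite -(subrK x u) addrC.
apply: (le_trans (ler_normD _ _)); rewrite lerD2l.
by rewrite distrC.
Qed.

(** Compactness replaces the fixed-point iteration. A minimiser [u] of the residual
    [(y - psi u) *m B] lies within 4 times the initial residual of [x], so one more Newton step
    costs 5 times it and stays in the ball. That step halves the residual, which is therefore
    zero. *)
Lemma local_surjectivity (B : 'M[R]_2) (psi : 'rV[R]_2 -> 'rV[R]_2) x s :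
  0 < s -> B \in unitmx ->
  (forall u, closed_ball_ Num.norm x s u -> {for u, continuous psi}) ->
  (forall u v, closed_ball_ Num.norm x s u -> closed_ball_ Num.norm x s v ->
    `|(v - psi v *m B) - (u - psi u *m B)| <= 2^-1 * `|v - u|) ->
  forall y, 5 * `|(y - psi x) *m B| <= s ->
    exists2 u, closed_ball_ Num.norm x s u & psi u = y.
Proof.
move=> s0 uB cpsi H y ys; set K := closed_ball_ _ _ _ in cpsi H *.
have Kx : K x by rewrite /K /closed_ball_ /= subrr normr0 ltW.
have cK : compact K by exact: closed_ball_rV_compact.
have cf : {within K, continuous (fun u => `|(y - psi u) *m B|)}.
  apply: continuous_in_subspaceT => u /set_mem Ku.
  apply: (@continuous_comp _ _ _ (fun u => (y - psi u) *m B)); last first.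
    exact: norm_continuous.
  have cp := cpsi _ Ku.
  apply: (cvg_rV (FF := nbhs_filter u)) => j.
  have cj k : (fun t => (y - psi t) 0 k) @ u --> (y - psi u) 0 k.
    apply: (@cvg_comp _ _ _ (fun t => y - psi t) (fun M : 'rV[R]_2 => M 0 k) (nbhs u)
      (nbhs (y - psi u))); last exact: coord_continuous.
    by apply: cvgB => //; exact: cvg_cst.
  rewrite mulmx_row2; under eq_fun do rewrite mulmx_row2.
  by apply: cvgD; apply: cvgMr_tmp; exact: cj.
have [u Ku um] := EVT_min_rV (ex_intro _ x Kx) cK cf.
move/set_mem in Ku; exists u => //.
set rho := (y - psi u) *m B.
have rx : `|rho| <= `|(y - psi x) *m B| by apply: um; rewrite inE.
have xu : `|u - x| <= 4 * `|(y - psi x) *m B|.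
  have := inverse_lipschitz (H x u Kx Ku).
  have -> : (psi u - psi x) *m B = (y - psi x) *m B - rho.
    rewrite /rho -mulmxBl; congr (_ *m B).
    by apply/rowP => j; rewrite !mxE; ring.
  have := ler_normB ((y - psi x) *m B) rho.
  lra.
have Kv : K (rho + u).
  rewrite /K /closed_ball_ /= distrC -addrA.
  apply: (le_trans (ler_normD _ _)); lra.
have : `|rho| <= 2^-1 * `|rho|.
  have := um (rho + u); rewrite inE => /(_ Kv) => /le_trans; apply.
  rewrite -[X in _ <= _ * `|X|](addrK u rho).
  apply: (le_trans _ (H _ _ Ku Kv)).
  rewrite le_eqVlt; apply/orP; left; apply/eqP; congr Num.norm.
  rewrite /rho !mulmxBl; apply/rowP => j; rewrite !mxE; ring.
move=> hr; have : `|rho| <= 0 by lra.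
rewrite normr_le0 => /eqP r0.
have : (y - psi u) *m B *m invmx B = 0 by rewrite -/rho r0 mul0mx.
by rewrite mulmxK// => /subr0_eq.
Qed.

Lemma inverse_function_theorem U psi x0 : open U -> smooth_map_on U psi -> U x0 ->
  \det (jac psi x0) != 0 ->
  exists (N : set 'rV[R]_2) (phi : 'rV[R]_2 -> 'rV[R]_2),
  [/\ open N /\ open (psi @` N), N x0, N `<=` U, forall x, N x -> phi (psi x) = x
    & smooth_map_on (psi @` N) phi].
Proof.
move=> oU sp Ux0 d0.
have [B [r r0 [BU uB dJ H]]] := newton_contraction oU sp Ux0 d0.
set N := ball x0 r in BU dJ H.
have oN : open N by exact: ball_open.
have cpsi x : N x -> {for x, continuous psi}.
  move=> Nx; apply: (@continuous_map _ U) => j.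
  by apply: (smooth_on_continuous (sp j)); exact: BU.
have inj x y : N x -> N y -> psi x = psi y -> x = y.
  move=> Nx Ny E; have := inverse_lipschitz (H x y Nx Ny).
  by rewrite E subrr mul0mx normr0 mulr0 normr_le0 subr_eq0 => /eqP.
have [C C0 HC] := mulmx_bound B.
have oW : open (psi @` N).
  rewrite openE => _ [x Nx <-].
  have /nbhs_closedballP [s' sN] := open_nbhs_nbhs (conj oN Nx).
  have s0 : 0 < s'%:num by [].
  move: (s'%:num) s0 sN => s s0; rewrite closed_ballE// => sN.
  apply/nbhs_ballP; exists (s / (5 * C)) => /=; first by apply: divr_gt0 => //; apply: mulr_gt0.
  move=> y; rewrite -ball_normE /= => xy.
  have ys : 5 * `|(y - psi x) *m B| <= s.
    move: xy; rewrite ltr_pdivlMr ?mulr_gt0// => xy.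
    have := HC (y - psi x); rewrite distrC in xy; lra.
  have [u Ku <-] := @local_surjectivity B psi x s s0 uB
    (fun u Ku => cpsi _ (sN _ Ku)) (fun u v Ku Kv => H _ _ (sN _ Ku) (sN _ Kv)) y ys.
  by exists u => //; exact: sN.
set W := psi @` N in oW.
(* [x0] is only the default value outside the image, where nothing is claimed about [phi]. *)
pose phi y := xget x0 [set x | N x /\ psi x = y].
have phiP y : W y -> N (phi y) /\ psi (phi y) = y.
  by move=> [x Nx xy]; rewrite /phi; case: xgetP => [u -> //|/(_ x)]; case.
have phiK x : N x -> phi (psi x) = x.
  move=> Nx; have [] := phiP (psi x); first by exists x.
  by move=> Np E; exact: inj.
have lip y z : W y -> W z -> `|phi z - phi y| <= 2 * C * `|z - y|.
  move=> /phiP[Ny yE] /phiP[Nz zE].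
  apply: (le_trans (inverse_lipschitz (H _ _ Ny Nz))).
  by rewrite yE zE -mulrA ler_pM2l.
exists N, phi; split => //; first exact: ballxx.
pose L := 2 * C; have L0 : 0 < L by rewrite mulr_gt0.
have cphi y : W y -> {for y, continuous phi}.
  move=> Wy; apply/(@cvgrPdist_le _ _ _ _ (nbhs_filter y)) => e e0.
  have eL : 0 < e / L by rewrite divr_gt0.
  have : \forall z \near y, W z /\ `|y - z| < e / L.
    apply: filterI; first exact: open_nbhs_nbhs.
    by apply/nbhs_ballP; exists (e / L) => //= z; rewrite -ball_normE.
  apply: filterS => z [Wz]; rewrite ltr_pdivlMr// mulrC => yz.
  by apply: (le_trans (lip z y Wz Wy)); exact: ltW.
(* The increment of [phi] is put into the first-order expansion of [psi]. It is [O(t)] by the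
   Lipschitz bound [L], so the remainder is [o(t)], and applying the inverse Jacobian, bounded by
   [D], gives the derivative. *)
have dphi i y : W y -> (fun t => t^-1 *: ((phi \o shift y) (t *: delta_mx 0 i) - phi y))
     @ 0^' --> (delta_mx 0 i *m invmx (jac psi (phi y)) : 'rV[R]_2).
  move=> Wy; have [Nx xE] := phiP _ Wy; set x := phi y in Nx xE *.
  set J := jac psi x.
  have uJ : J \in unitmx by rewrite unitmxE unitfE dJ.
  have [D D0 HD] := mulmx_bound (invmx J).
  apply/cvgrPdist_le => e e0.
  have e1 : 0 < e / (D * L) by rewrite divr_gt0// mulr_gt0.
  have /nbhs_ballP[s /= s0 Hs] := increment_C1_map oU sp (BU _ Nx) e1.
  have /nbhs_ballP[w /= w0 Hw] := open_nbhs_nbhs (conj oW Wy).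
  have m0 : 0 < Num.min w (s / L) by rewrite lt_min w0 divr_gt0.
  have : \forall t \near (0:R)^', t != 0 /\ `|t| < Num.min w (s / L).
    have Hn : \forall t \near (0:R)^', t != 0 by exact: nbhs_dnbhs_neq.
    have Hl : \forall t \near (0:R)^', `|t| < Num.min w (s / L) by exact: dnbhs0_lt.
    exact: filterI Hn Hl.
  apply: filterS => t [t0]; rewrite lt_min => /andP[tw].
  rewrite ltr_pdivlMr// => ts.
  have nd : `|delta_mx 0 i : 'rV[R]_2| <= 1.
    apply: norm_le_coord => // k; rewrite delta_row.
    by case: (i == k); rewrite ?normr1 ?normr0.
  have Wt : W (t *: delta_mx 0 i + y).
    apply: Hw; rewrite -ball_normE /= opprD addrCA subrr addr0 normrN normrZ.
    by apply: le_lt_trans tw; rewrite ler_piMr.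
  have [Nz zE] := phiP _ Wt.
  set z := phi (t *: delta_mx 0 i + y) in Nz zE.
  pose d := z - x.
  have dL : `|d| <= L * `|t|.
    apply: (le_trans (lip _ _ Wy Wt)); rewrite addrK normrZ.
    by rewrite ler_pM2l// ler_piMr.
  have ds : `|d| < s by apply: (le_lt_trans dL); rewrite mulrC.
  have : ball 0 s d by rewrite -ball_normE /= sub0r normrN.
  move/Hs; rewrite /d subrK zE xE addrK => Hd.
  have -> : delta_mx 0 i *m invmx J - t^-1 *: ((phi \o shift y) (t *: delta_mx 0 i) - x)
     = t^-1 *: ((t *: delta_mx 0 i - (z - x) *m J) *m invmx J).
    rewrite mulmxBl mulmxK// [RHS]scalerBr; congr (_ - _).
    by rewrite -scalemxAl scalerA mulVf// scale1r.
  rewrite normrZ normfV ler_pdivrMl ?normr_gt0//.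
  apply: (le_trans (HD _)).
  apply: (@le_trans _ _ (D * (e / (D * L) * (L * `|t|)))).
    rewrite ler_pM2l//; apply: (le_trans Hd).
    by rewrite ler_pM2l.
  rewrite le_eqVlt; apply/orP; left; apply/eqP; field.
  by rewrite !gt_eqF.
have Dphi i j y : W y -> is_derive y (delta_mx 0 i) (fun u => phi u 0 j)
    (invmx (jac psi (phi y)) i j).
  move=> Wy.
  have D : derivable phi y (delta_mx 0 i) by apply/cvg_ex; eexists; exact: dphi.
  have E : 'D_(delta_mx 0 i) phi y = delta_mx 0 i *m invmx (jac psi (phi y)).
    by apply: cvg_lim => //; exact: dphi.
  apply: DeriveDef; first by have /derivable_mxP/(_ 0 j) := D.
  by move: E; rewrite derive_mx// => /matrixP/(_ 0 j); rewrite mxE -rowE mxE => <-.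
have sJ i j : smooth_on N (fun x => invmx (jac psi x) i j).
  apply: smooth_invmx => // i' j'; apply: smooth_on_subset BU _.
  exact: smooth_jac.
have cj j y : W y -> {for y, continuous (fun u => phi u 0 j)}.
  move=> Wy; apply: (@cvg_comp _ _ _ phi (fun M : 'rV[R]_2 => M 0 j) (nbhs y)
    (nbhs (phi y))); [exact: cphi|exact: coord_continuous].
(* Bootstrap: the derivatives of [phi] are entries of the inverse Jacobian of [psi] composed with
   [phi], so each order of smoothness of [phi] yields the next. *)
move=> j k; elim: k j => [|k IH] j.
  split => // y Wy.
  exact: cj.
split.
  move=> y Wy.
  exact: cj.
move=> i; split; first by move=> y Wy; have [] := Dphi i j y Wy.
have := @Ck_on_comp _ k W N _ phi oW oN (fun y Wy => (phiP y Wy).1) (sJ i j k) IH.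
by apply: Ck_on_eq => // y Wy; have [_ E] := Dphi i j y Wy; rewrite /pd E.
Qed.

End inverse_function_theorem.

(** * The Poincare lemma and the symmetry of second derivatives *)

Section poincare.
Context {R : realType}.
Implicit Types (U V : set 'rV[R]_2) (f g : 'rV[R]_2 -> R) (x y z : 'rV[R]_2).

Definition pt (a b : R) : 'rV[R]_2 := \row_i (if i == 0 then a else b).

Lemma pt0 a b : pt a b 0 0 = a. Proof. by rewrite mxE. Qed.
Lemma pt1 a b : pt a b 0 1 = b. Proof. by rewrite mxE. Qed.

Lemma ptE x : x = pt (x 0 0) (x 0 1).
Proof. by apply/rowP; apply: ord2P; rewrite mxE. Qed.

Lemma slice0 f a b :
  (is_derive (pt a b) (delta_mx 0 0) f =
   is_derive a 1 (fun s : R => f (pt s b)) :> (R -> Prop)).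
Proof.
have E : (fun h => h^-1 *: ((f \o shift (pt a b)) (h *: delta_mx 0 0) - f (pt a b)))
   = (fun h : R => h^-1 *: (((fun s : R => f (pt s b)) \o shift a) (h *: 1) - f (pt a b))).
  rewrite funeqE => h /=; congr (_ *: (f _ - _)).
  by rewrite [h *: 1]mulr1; apply/rowP; apply: ord2P; rewrite !mxE /=; ring.
apply/funext => l; apply/propext; split=> -[D1 D2]; split.
- by rewrite /derivable -E.
- by rewrite -D2 /derive -E.
- by rewrite /derivable E.
- by rewrite -D2 /derive E.
Qed.

Lemma slice1 f a b :
  (is_derive (pt a b) (delta_mx 0 1) f =
   is_derive b 1 (fun s : R => f (pt a s)) :> (R -> Prop)).
Proof.
have E : (fun h => h^-1 *: ((f \o shift (pt a b)) (h *: delta_mx 0 1) - f (pt a b)))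
   = (fun h : R => h^-1 *: (((fun s : R => f (pt a s)) \o shift b) (h *: 1) - f (pt a b))).
  rewrite funeqE => h /=; congr (_ *: (f _ - _)).
  by rewrite [h *: 1]mulr1; apply/rowP; apply: ord2P; rewrite !mxE /=; ring.
apply/funext => l; apply/propext; split=> -[D1 D2]; split.
- by rewrite /derivable -E.
- by rewrite -D2 /derive -E.
- by rewrite /derivable E.
- by rewrite -D2 /derive E.
Qed.

Lemma ball_ptE z r a b : 0 < r ->
  ball z r (pt a b) <-> `|z 0 0 - a| < r /\ `|z 0 1 - b| < r.
Proof.
move=> r0; split=> [/(ball_rVE _ _ r0) H|[H0 H1]].
  by have := H 0; have := H 1; rewrite pt0 pt1.
by apply/(ball_rVE _ _ r0); apply: ord2P; rewrite ?pt0 ?pt1.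
Qed.

Lemma mvt_1d (g dg : R -> R) (a b : R) :
  (forall c : R, 0 <= c <= 1 -> is_derive (a + c * (b - a)) 1 g (dg (a + c * (b - a)))) ->
  exists2 c, 0 <= c <= 1 & g b - g a = dg (a + c * (b - a)) * (b - a).
Proof.
move=> D; pose k (s : R) := a + s * (b - a).
have Dk (s : R) : is_derive s 1 k (b - a).
  have := is_derive_addE (is_derive_cstE s 1 a)
    (is_derive_mulE (is_derive_id s 1) (is_derive_cstE s 1 (b - a))).
  by rewrite mul1r mulr0 addr0 add0r.
have Dg (s : R) : 0 <= s <= 1 -> is_derive s 1 (g \o k) (dg (k s) * (b - a)).
  by move=> s01; apply: is_derive1_comp; exact: D.
have := @MVT_segment R (g \o k) (fun s => dg (k s) * (b - a)) 0 1 ler01.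
case.
- by move=> s; rewrite in_itv /= => /andP[s0 s1]; apply: Dg; rewrite !ltW.
- apply: derivable_within_continuous => s; rewrite in_itv /= => s01.
  by have [] := Dg s s01.
- move=> c; rewrite in_itv /= => c01; rewrite subr0 mulr1 /k /= mul1r mul0r addr0.
  by rewrite [a + (b - a)]addrCA subrr addr0 => ->; exists c.
Qed.

Lemma is_derive_quadratic (phi : R -> R) (a l C : R) :
  (\forall t \near (0:R), `|phi (t + a) - phi a - t * l| <= C * t ^+ 2) ->
  is_derive a 1 phi l.
Proof.
move=> H.
have L : (fun h : R => h^-1 *: ((phi \o shift a) (h *: 1) - phi a)) @ 0^' --> l.
  apply/cvgrPdist_le => e e0.
  have C1 : 0 < `|C| + 1 by rewrite ltr_wpDl.
  have Hn : \forall t \near (0:R)^', t != 0 by exact: nbhs_dnbhs_neq.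
  have Hl : \forall t \near (0:R)^', `|t| < e / (`|C| + 1).
    by apply: dnbhs0_lt; rewrite divr_gt0.
  have Hd := nbhs_dnbhs H.
  apply: filterS3 Hn Hl Hd => t t0; rewrite ltr_pdivlMr// => tl Ht.
  rewrite /= [t *: 1]mulr1.
  have -> : l - t^-1 *: (phi (t + a) - phi a) =
            - t^-1 * (phi (t + a) - phi a - t * l).
    by rewrite -[_ *: _]/(_ * _); field.
  rewrite normrM normrN normfV ler_pdivrMl ?normr_gt0//.
  apply: (le_trans Ht); rewrite -(real_normK (num_real t)).
  apply: (@le_trans _ _ (`|t| * (`|t| * (`|C| + 1)))).
    rewrite mulrA -expr2 mulrC ler_wpM2l ?sqr_ge0//.
    by rewrite (le_trans (ler_norm C))// lerDl.
  by rewrite ler_wpM2l// ltW.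
apply: DeriveDef; first by apply/cvg_ex; exists l.
exact: cvg_lim L.
Qed.

(** Continuity is required on the closed interval, while the derivative is obtained on the open one;
    this is one source of the loss of radius in the Poincare lemma. *)
Lemma primitive (q : R -> R) (a b c : R) : a < c < b ->
  (forall t, a <= t <= b -> {for t, continuous q}) ->
  exists F : R -> R, F c = 0 /\ forall t, a < t < b -> is_derive t 1 F (q t).
Proof.
move=> /andP[ac cb] cq; have ab := lt_trans ac cb.
pose F0 (x : R) : R := (\int[lebesgue_measure]_(t in [set` `[a, x]]) (q t))%R.
have iq : lebesgue_measure.-integrable `[a, b] (EFin \o q).
  apply: continuous_compact_integrable; first exact: segment_compact.
  apply: continuous_in_subspaceT => t; rewrite inE /= in_itv /=; exact: cq.
exists (fun t => F0 t - F0 c); split; first by rewrite subrr.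
move=> t /andP[at_ tb].
have [] := @continuous_FTC1_closed R q a t b tb iq at_ (cq t _).
  by rewrite !ltW.
move=> D1 D2; rewrite -[q t]subr0; apply: is_deriveB.
by apply: DeriveDef; [exact: D1|rewrite -derive1E].
Qed.

(** Partial derivatives continuous at [x] are bounded near [x], so the increments of [f] are bounded
    by a multiple of the distance. This supplies the continuity that [Ck_on] demands of a function
    known through its partial derivatives. *)
Lemma continuous_of_pd U f x : open U -> U x ->
  (forall i y, U y -> derivable f y (delta_mx 0 i)) ->
  (forall i, {for x, continuous (pd i f)}) -> {for x, continuous f}.
Proof.
move=> oU Ux df cf.
have H1 i : \forall y \near x, `|pd i f y| <= `|pd i f x| + 1.
  have := continuous_nbhs_le ltr01 (cf i); apply: filterS => y Hy.
  have -> : pd i f y = pd i f x - (pd i f x - pd i f y) by ring.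
  by apply: (le_trans (ler_normB _ _)); rewrite lerD2l.
have : \forall y \near x, U y /\ `|pd 0 f y| <= `|pd 0 f x| + 1 /\
    `|pd 1 f y| <= `|pd 1 f x| + 1.
  exact: filterI (open_nbhs_nbhs (conj oU Ux)) (filterI (H1 0) (H1 1)).
move=> /nbhs_ballP[r /= r0 Br].
set M0 := _ + 1 in Br; set M1 := `|pd 1 f x| + 1 in Br.
have M00 : 0 < M0 by rewrite ltr_wpDl.
have M10 : 0 < M1 by rewrite ltr_wpDl.
clearbody M0 M1.
apply/(@cvgrPdist_le _ _ _ _ (nbhs_filter x)) => e e0.
pose s := Num.min r (e / (M0 + M1)).
have s0 : 0 < s by rewrite lt_min r0 divr_gt0// addr_gt0.
apply/nbhs_ballP; exists s => //= y Bs.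
have Bx : ball x r x by exact: ballxx.
have By : ball x r y by apply: le_ball Bs; rewrite ge_min lexx.
have [i c d I1 I2|c [d [I1 I2 E]]] := @mvt_plane _ f x y.
  by have [Uz _] := Br _ (interp_ball r0 I1 I2 Bx By); exact: df.
have I01 : (0 <= (0 : R) <= 1) && (0 <= (1 : R) <= 1) by rewrite !lexx ler01.
have [J0 J1] := andP I01.
have [_ [P0 _]] := Br _ (interp_ball r0 I1 J0 Bx By).
have [_ [_ P1]] := Br _ (interp_ball r0 J1 I2 Bx By).
rewrite distrC E; apply: (le_trans (ler_normD _ _)); rewrite !normrM.
have Hs i : `|y 0 i - x 0 i| <= e / (M0 + M1).
  move/(ball_rVE _ _ s0) : Bs => /(_ i); rewrite distrC => /ltW/le_trans; apply.
  by rewrite ge_min lexx orbT.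
have -> : e = e / (M0 + M1) * M0 + e / (M0 + M1) * M1.
  by rewrite -mulrDr divfK// gt_eqF// addr_gt0.
by apply: lerD; apply: ler_pM.
Qed.

End poincare.

Section poincare_lemma.
Context {R : realType}.
Implicit Types (U V : set 'rV[R]_2) (f g : 'rV[R]_2 -> R) (x y z : 'rV[R]_2).

Lemma is_derive1_continuous (g : R -> R) (t l : R) :
  is_derive t 1 g l -> {for t, continuous g}.
Proof. by move=> [/derivable1_diffP D _]; exact: differentiable_continuous. Qed.

Lemma convex_dist (z a t r c : R) : `|z - a| < r -> `|t| < r - `|z - a| ->
  0 <= c <= 1 -> `|z - (a + c * t)| < r.
Proof.
move=> za ta /andP[c0 c1]; rewrite opprD addrA.
apply: (le_lt_trans (ler_normB _ _)); rewrite normrM (ger0_norm c0).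
have := normr_ge0 t; nra.
Qed.

Lemma convex_dist_centre (z b r c : R) : `|z - b| < r -> 0 <= c <= 1 ->
  `|z - (z + c * (b - z))| < r.
Proof.
move=> zb /andP[c0 c1]; rewrite opprD addNKr normrN normrM (ger0_norm c0) distrC.
have := normr_ge0 (z - b); nra.
Qed.

(** The potential integrates [P] along the horizontal line through the centre, then [Q] along
    verticals. Its vertical derivative is immediate. For the horizontal one, differentiation under
    the integral sign is replaced by a remainder estimate: closedness makes the remainder quadratic
    in the increment. *)
Lemma poincare z r r' P Q : 0 < r < r' ->
  smooth_on (ball z r') P -> smooth_on (ball z r') Q ->
  (forall x, ball z r' x -> pd 1 P x = pd 0 Q x) ->
  exists f, smooth_on (ball z r) f /\
    forall x, ball z r x -> pd 0 f x = P x /\ pd 1 f x = Q x.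
Proof.
move=> /andP[r0 rr'] sP sQ PQ; have r'0 := lt_trans r0 rr'.
pose z0 := z 0 0; pose z1 := z 0 1.
have inB a b : `|z0 - a| <= r -> `|z1 - b| <= r -> ball z r' (pt a b).
  by move=> Ha Hb; apply/ball_ptE => //; split; exact: le_lt_trans rr'.
have D0 f a b : smooth_on (ball z r') f -> `|z0 - a| <= r -> `|z1 - b| <= r ->
    is_derive a 1 (fun s => f (pt s b)) (pd 0 f (pt a b)).
  move=> sf Ha Hb; rewrite -slice0; apply: derivableP.
  exact: (smooth_on_derivable sf (inB _ _ Ha Hb)).
have D1 f a b : smooth_on (ball z r') f -> `|z0 - a| <= r -> `|z1 - b| <= r ->
    is_derive b 1 (fun s => f (pt a s)) (pd 1 f (pt a b)).
  move=> sf Ha Hb; rewrite -slice1; apply: derivableP.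
  exact: (smooth_on_derivable sf (inB _ _ Ha Hb)).
have zz0 : `|z0 - z0| <= r by rewrite subrr normr0 ltW.
have zz1 : `|z1 - z1| <= r by rewrite subrr normr0 ltW.
have itv (c : R) : c - r < c < c + r by rewrite ltrDl gtrBl r0.
have itvE (c t : R) : (c - r <= t <= c + r) = (`|c - t| <= r).
  by rewrite distrC ler_distl.
have itvE' (c t : R) : (c - r < t < c + r) = (`|c - t| < r).
  by rewrite distrC ltr_distl.
have [G [_ HG]] : exists G : R -> R, G z0 = 0 /\ forall t, z0 - r < t < z0 + r ->
    is_derive t 1 G (P (pt t z1)).
  apply: (primitive (itv z0)) => t; rewrite itvE => Ht.
  exact: is_derive1_continuous (D0 P t z1 sP Ht zz1).
(* Choice needs a function for every abscissa [s]; zero serves outside the range of interest. *)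
have : forall s, exists F : R -> R, `|z0 - s| <= r -> F z1 = 0 /\
    forall t, z1 - r < t < z1 + r -> is_derive t 1 F (Q (pt s t)).
  move=> s; have [Hs|_] := boolP (`|z0 - s| <= r); last by exists (fun=> 0).
  have [F HF] := @primitive _ (fun t => Q (pt s t)) _ _ _ (itv z1) (fun t Ht =>
    is_derive1_continuous (D1 Q s t sQ Hs (eq_ind _ is_true Ht _ (itvE _ _)))).
  by exists F.
move=> /choice[F HF].
pose f x := G (x 0 0) + F (x 0 0) (x 0 1).
have f1 a b : `|z0 - a| < r -> `|z1 - b| < r ->
    is_derive (pt a b) (delta_mx 0 1) f (Q (pt a b)).
  move=> Ha Hb; rewrite slice1.
  have -> : (fun s => f (pt a s)) = (fun s => cst (G a) s + F a s).
    by apply/funext => s; rewrite /f pt0 pt1.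
  have [_ /(_ b)] := HF a (ltW Ha); rewrite itvE' => /(_ Hb) DF.
  by rewrite -[Q _]add0r; apply: is_deriveD.
have f0 a b : `|z0 - a| < r -> `|z1 - b| < r ->
    is_derive (pt a b) (delta_mx 0 0) f (P (pt a b)).
  move=> Ha Hb; rewrite slice0.
  have -> : (fun s => f (pt s b)) = (fun s => G s + F s b).
    by apply/funext => s; rewrite /f pt0 pt1.
  have := HG a; rewrite itvE' => /(_ Ha) DG.
  rewrite (_ : P (pt a b) = P (pt a z1) + (P (pt a b) - P (pt a z1))); last by ring.
  apply: is_deriveD.
  have KB u : closed_ball_ Num.norm z r u -> ball z r' u.
    by move=> Ku; rewrite -ball_normE /=; exact: le_lt_trans rr'.
  (* The second derivative of [Q] is bounded on the closed ball of radius [r], which is compact and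
     contained in the open ball of radius [r']. *)
  have [M HM] : exists M, forall u, closed_ball_ Num.norm z r u ->
      `|pd 0 (pd 0 Q) u| <= M.
    have sQ2 := smooth_on_pd 0 (smooth_on_pd 0 sQ).
    have [||c _ Hc] := @EVT_max_rV R 2 (fun u => `|pd 0 (pd 0 Q) u|) _ _
        (@closed_ball_rV_compact R 2 z r).
    - by exists z; rewrite /closed_ball_ /= subrr normr0 ltW.
    - apply: continuous_in_subspaceT => u /set_mem Ku.
      apply: (@continuous_comp _ _ _ (pd 0 (pd 0 Q))); last exact: norm_continuous.
      exact: smooth_on_continuous sQ2 (KB _ Ku).
    by exists `|pd 0 (pd 0 Q) c| => u Ku; apply: Hc; rewrite inE.
  apply: (@is_derive_quadratic _ _ _ _ (M * `|b - z1|)).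
  have e0 : 0 < r - `|z0 - a| by rewrite subr_gt0.
  have := @nbhs0_lt _ R _ e0; apply: filterS => t Ht.
  have Hta (c : R) : 0 <= c <= 1 -> `|z0 - (a + c * t)| < r.
    exact: convex_dist.
  (* [D b] is the remainder to be estimated and [D z1 = 0]. By closedness [dD] is the first-order
     Taylor remainder of [Q] in the horizontal direction, hence at most [M * t ^+ 2]. *)
  pose D (y : R) : R := F (t + a) y - F a y - t * (P (pt a y) - P (pt a z1)).
  pose dD (y : R) : R := Q (pt (t + a) y) - Q (pt a y) - t * pd 1 P (pt a y).
  have Ha1 : `|z0 - (t + a)| < r.
    by rewrite [t + a]addrC -[t]mul1r; apply: Hta; rewrite ler01 lexx.
  have DD (y : R) : `|z1 - y| < r -> is_derive y 1 D (dD y).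
    move=> Hy.
    have [_ /(_ y)] := HF a (ltW Ha); rewrite itvE' => /(_ Hy) DFa.
    have [_ /(_ y)] := HF (t + a) (ltW Ha1); rewrite itvE' => /(_ Hy) DFt.
    have DP := D1 P a y sP (ltW Ha) (ltW Hy).
    have DZ := is_deriveZ t (is_deriveB DP (is_derive_cst (P (pt a z1)) y 1)).
    rewrite subr0 in DZ.
    exact: (is_deriveB (is_deriveB DFt DFa) DZ).
  have BD (y : R) : `|z1 - y| < r -> `|dD y| <= M * t ^+ 2.
    move=> Hy; rewrite /dD PQ; last exact: inB (ltW Ha) (ltW Hy).
    have [c c01 Ec] := @mvt_1d _ (fun s => Q (pt s y)) (fun s => pd 0 Q (pt s y))
      a (t + a) (fun c hc => D0 Q _ y sQ (ltW (eq_ind_r (fun u => `|z0 - (a + c * u)| < r)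
        (Hta c hc) (addrK a t))) (ltW Hy)).
    rewrite Ec addrK.
    have Hc' (c' : R) : 0 <= c' <= 1 -> `|z0 - (a + c' * (a + c * t - a))| < r.
      move=> /andP[d0 d1]; move/andP : c01 => [c0 c1].
      rewrite [a + c * t]addrC addrK mulrA; apply: Hta; apply/andP; split; nra.
    have [c' c01' Ec'] := @mvt_1d _ (fun s => pd 0 Q (pt s y))
      (fun s => pd 0 (pd 0 Q) (pt s y)) a (a + c * t)
      (fun c' hc => D0 _ _ y (smooth_on_pd 0 sQ) (ltW (Hc' c' hc)) (ltW Hy)).
    rewrite [pd 0 Q _ * t]mulrC -mulrBr Ec'.
    have := HM (pt (a + c' * (a + c * t - a)) y).
    set m := pd 0 (pd 0 Q) _ => Hm.
    have {}Hm : `|m| <= M.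
      apply: Hm; rewrite /closed_ball_ /=; apply: norm_le_coord; first exact: ltW.
      apply: ord2P; rewrite !mxE /= ltW//; exact: Hc'.
    rewrite [a + c * t]addrC addrK !normrM -(real_normK (num_real t)).
    move/andP : c01 => [c0 c1]; rewrite (ger0_norm c0).
    have := normr_ge0 m; have := normr_ge0 t; set tt := `|t| => tt0 m0.
    have -> : tt * (`|m| * (c * tt)) = c * (`|m| * tt ^+ 2) by ring.
    have : `|m| * tt ^+ 2 <= M * tt ^+ 2 by rewrite ler_wpM2r ?sqr_ge0.
    have : 0 <= `|m| * tt ^+ 2 by rewrite mulr_ge0 ?sqr_ge0.
    nra.
  have [c c01 Ec] := @mvt_1d _ D dD z1 b
    (fun c hc => DD _ (convex_dist_centre Hb hc)).
  have Dz1 : D z1 = 0.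
    have [E1 _] := HF a (ltW Ha); have [E2 _] := HF (t + a) (ltW Ha1).
    by rewrite /D E1 E2 !subrr mulr0 subrr.
  rewrite -[X in `|X|]/(D b) -[D b]subr0 -Dz1 Ec normrM mulrAC ler_wpM2r//.
  exact: BD (convex_dist_centre Hb c01).
have fB0 x : ball z r x -> is_derive x (delta_mx 0 0) f (P x).
  by move=> Bx; move: (Bx); rewrite (ptE x) => /(ball_ptE _ _ _ r0)[]; exact: f0.
have fB1 x : ball z r x -> is_derive x (delta_mx 0 1) f (Q x).
  by move=> Bx; move: (Bx); rewrite (ptE x) => /(ball_ptE _ _ _ r0)[]; exact: f1.
have oB : open (ball z r) by exact: ball_open.
have E0 x : ball z r x -> P x = pd 0 f x by move=> /fB0[_ <-].
have E1 x : ball z r x -> Q x = pd 1 f x by move=> /fB1[_ <-].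
have BB : ball z r `<=` ball z r' by apply: le_ball; exact: ltW.
have spd : forall i, smooth_on (ball z r) (pd i f).
  apply: ord2P.
  - exact: smooth_on_eq E0 (smooth_on_subset BB sP).
  - exact: smooth_on_eq E1 (smooth_on_subset BB sQ).
have df : forall i x, ball z r x -> derivable f x (delta_mx 0 i).
  by apply: ord2P => x Bx; [have [] := fB0 x Bx|have [] := fB1 x Bx].
exists f; split; last by move=> x Bx; rewrite -E0// -E1.
apply: smooth_on_intro => // x Bx; apply: (continuous_of_pd oB Bx df) => i.
exact: smooth_on_continuous (spd i) Bx.
Qed.

(** [(P, Q)] is the gradient of some [u], [(Q, S)] that of some [v], and [(u, v)] is closed because
    both relevant derivatives equal [Q]. Two successive applications shrink the ball twice, hence
    the intermediate radius. *)
Lemma hessian_potential z r r' P Q S : 0 < r < r' ->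
  smooth_on (ball z r') P -> smooth_on (ball z r') Q -> smooth_on (ball z r') S ->
  (forall x, ball z r' x -> pd 1 P x = pd 0 Q x) ->
  (forall x, ball z r' x -> pd 1 Q x = pd 0 S x) ->
  exists f, smooth_on (ball z r) f /\ forall x, ball z r x ->
    [/\ pd 0 (pd 0 f) x = P x, pd 0 (pd 1 f) x = Q x & pd 1 (pd 1 f) x = S x].
Proof.
move=> /andP[r0 rr'] sP sQ sS PQ QS.
pose r1 := (r + r') / 2.
have r1B : 0 < r1 < r' by apply/andP; rewrite /r1; split; lra.
have [u [su Du]] := poincare r1B sP sQ PQ.
have [v [sv Dv]] := poincare r1B sQ sS QS.
have rB : 0 < r < r1 by apply/andP; rewrite /r1; split; lra.
have [|f [sf Df]] := poincare rB su sv.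
  by move=> x Bx; have [_ ->] := Du x Bx; have [-> _] := Dv x Bx.
exists f; split => // x Bx.
have oB : open (ball z r) by exact: ball_open.
have Bx1 : ball z r1 x by apply: le_ball Bx; rewrite /r1; lra.
have [u0 _] := Du _ Bx1; have [v0 v1] := Dv _ Bx1.
rewrite -u0 -v0 -v1; split; apply: (pd_eq_on _ oB Bx) => y By; by have [] := Df y By.
Qed.

End poincare_lemma.

(** * Symmetry of second derivatives *)

Section schwarz_symmetry.
Context {R : realType}.
Implicit Types (U V : set 'rV[R]_2) (f g : 'rV[R]_2 -> R) (x y z : 'rV[R]_2).

(** The left-hand side does not change when the two variables are exchanged, so the lemma applied in
    both orders equates values of the two mixed derivatives at nearby points. *)
Lemma second_difference (h h1 h12 : R -> R -> R) (a b s t : R) :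
  (forall c d : R, 0 <= c <= 1 -> 0 <= d <= 1 ->
     is_derive (a + c * s) 1 (h ^~ (b + d * t)) (h1 (a + c * s) (b + d * t)) /\
     is_derive (b + d * t) 1 (h1 (a + c * s)) (h12 (a + c * s) (b + d * t))) ->
  exists c d, [/\ 0 <= c <= 1, 0 <= d <= 1 &
    h (a + s) (b + t) - h (a + s) b - h a (b + t) + h a b =
    s * t * h12 (a + c * s) (b + d * t)].
Proof.
move=> dh.
have I1 : 0 <= (1 : R) <= 1 by rewrite ler01 lexx.
have I0 : 0 <= (0 : R) <= 1 by rewrite ler01 lexx.
have as_ : a + s - a = s by rewrite addrC addKr.
have bt_ : b + t - b = t by rewrite addrC addKr.
have [c c01 E] := @mvt_1d _ (fun v => h v (b + 1 * t) - h v (b + 0 * t))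
  (fun v => h1 v (b + 1 * t) - h1 v (b + 0 * t)) a (a + s)
  (fun c hc => eq_ind_r (fun w => is_derive (a + c * w) 1 _
     (h1 (a + c * w) (b + 1 * t) - h1 (a + c * w) (b + 0 * t)))
     (is_deriveB (dh c 1 hc I1).1 (dh c 0 hc I0).1) as_).
rewrite as_ in E.
have [d d01 E'] := @mvt_1d _ (h1 (a + c * s)) (h12 (a + c * s)) b (b + t)
  (fun d hd => eq_ind_r (fun w => is_derive (b + d * w) 1 _ (h12 (a + c * s) (b + d * w)))
     (dh c d c01 hd).2 bt_).
rewrite bt_ in E'.
exists c, d; split => //.
move: E; rewrite !mul1r !mul0r !addr0 E' => E.
transitivity (h (a + s) (b + t) - h (a + s) b - (h a (b + t) - h a b)).
  by ring.
by rewrite E; ring.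
Qed.

Lemma schwarz U f x : open U -> Ck_on 2 U f -> U x ->
  pd 0 (pd 1 f) x = pd 1 (pd 0 f) x.
Proof.
move=> oU [_ C2] Ux.
have [d0 [_ C0]] := C2 0; have [d1 [_ C1]] := C2 1.
have [d01 [c01 _]] := C1 0; have [d10 [c10 _]] := C0 1.
apply/eqP; rewrite -subr_eq0 -normr_le0; apply/ler_addgt0Pl => e e0.
rewrite addr0.
have e2 : 0 < e / 2 by rewrite divr_gt0.
have : \forall y \near x, U y /\ `|pd 0 (pd 1 f) x - pd 0 (pd 1 f) y| <= e / 2 /\
    `|pd 1 (pd 0 f) x - pd 1 (pd 0 f) y| <= e / 2.
  exact: filterI (open_nbhs_nbhs (conj oU Ux)) (filterI
    (continuous_nbhs_le e2 (c01 _ Ux)) (continuous_nbhs_le e2 (c10 _ Ux))).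
move=> /nbhs_ballP[r /= r0 Br].
pose a := x 0 0; pose b := x 0 1; pose s := r / 2.
have s0 : 0 < s by rewrite divr_gt0.
have Bs c d : 0 <= c <= 1 -> 0 <= d <= 1 -> ball x r (pt (a + c * s) (b + d * s)).
  move=> /andP[c0 c1] /andP[d0' d1']; apply/(ball_ptE _ _ _ r0).
  have cs : 0 <= c * s by rewrite mulr_ge0// ltW.
  have ds : 0 <= d * s by rewrite mulr_ge0// ltW.
  rewrite !opprD !addrA !subrr !sub0r !normrN (ger0_norm cs) (ger0_norm ds).
  have sr : s + s = r by rewrite -splitr.
  by split; nra.
have H01 : forall u v : R, 0 <= u <= 1 -> 0 <= v <= 1 ->
    is_derive (a + u * s) 1 (fun w => f (pt w (b + v * s)))
      (pd 0 f (pt (a + u * s) (b + v * s))) /\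
    is_derive (b + v * s) 1 (fun w => pd 0 f (pt (a + u * s) w))
      (pd 1 (pd 0 f) (pt (a + u * s) (b + v * s))).
  move=> u v Hu Hv; have [Uy _] := Br _ (Bs u v Hu Hv).
  by rewrite -slice0 -slice1; split; apply: derivableP; [exact: d0|exact: d10].
have H10 : forall u v : R, 0 <= u <= 1 -> 0 <= v <= 1 ->
    is_derive (b + u * s) 1 (fun w => f (pt (a + v * s) w))
      (pd 1 f (pt (a + v * s) (b + u * s))) /\
    is_derive (a + v * s) 1 (fun w => pd 1 f (pt w (b + u * s)))
      (pd 0 (pd 1 f) (pt (a + v * s) (b + u * s))).
  move=> u v Hu Hv; have [Uy _] := Br _ (Bs v u Hv Hu).
  by rewrite -slice0 -slice1; split; apply: derivableP; [exact: d1|exact: d01].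
have [c [d [Hc Hd E]]] := @second_difference (fun u v => f (pt u v))
    (fun u v => pd 0 f (pt u v)) (fun u v => pd 1 (pd 0 f) (pt u v)) a b s s H01.
have [c' [d' [Hc' Hd' E']]] := @second_difference (fun u v => f (pt v u))
    (fun u v => pd 1 f (pt v u)) (fun u v => pd 0 (pd 1 f) (pt v u)) b a s s H10.
have [_ [_ P]] := Br _ (Bs c d Hc Hd).
have [_ [P' _]] := Br _ (Bs d' c' Hd' Hc').
have ss : s * s != 0 by rewrite mulf_neq0 ?gt_eqF.
have EE : pd 0 (pd 1 f) (pt (a + d' * s) (b + c' * s)) =
    pd 1 (pd 0 f) (pt (a + c * s) (b + d * s)).
  move: E E' => /=.
  set X := pd 1 (pd 0 f) _; set Y := pd 0 (pd 1 f) _.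
  move: (f (pt (a + s) (b + s))) (f (pt (a + s) b)) (f (pt a (b + s))) (f (pt a b)).
  clearbody X Y => f11 f10 f01 f00 E E'; apply: (mulfI ss).
  by refine (etrans (esym E') (etrans _ E)); clear; ring.
rewrite EE in P'.
move: P P'; set p := pd 1 (pd 0 f) x; set q := pd 0 (pd 1 f) x.
set w := pd 1 (pd 0 f) _ => P P'.
have -> : q - p = (q - w) - (p - w) by ring.
apply: (le_trans (ler_normB _ _)); rewrite (splitr e); exact: lerD P' P.
Qed.

End schwarz_symmetry.

(** * Brackets of forms in the momenta *)

Section poisson_calculus.
Context {R : realType}.
Implicit Types (U V : set 'rV[R]_2) (f g : 'rV[R]_2 -> R) (x y z p : 'rV[R]_2).
Implicit Types (F H : 'rV[R]_2 -> 'rV[R]_2 -> R).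

Lemma smooth_is_derive U f i x : smooth_on U f -> U x ->
  is_derive x (delta_mx 0 i) f (pd i f x).
Proof. by move=> sf Ux; apply: derivableP; exact: smooth_on_derivable sf Ux. Qed.

Lemma poisson_is_derive F H x p (F0 F1 Fp Fq H0 H1 Hp Hq : R) :
  is_derive x (delta_mx 0 0) (F ^~ p) F0 -> is_derive x (delta_mx 0 1) (F ^~ p) F1 ->
  is_derive p (delta_mx 0 0) (F x) Fp -> is_derive p (delta_mx 0 1) (F x) Fq ->
  is_derive x (delta_mx 0 0) (H ^~ p) H0 -> is_derive x (delta_mx 0 1) (H ^~ p) H1 ->
  is_derive p (delta_mx 0 0) (H x) Hp -> is_derive p (delta_mx 0 1) (H x) Hq ->
  poisson F H x p = F0 * Hp - Fp * H0 + (F1 * Hq - Fq * H1).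
Proof.
move=> [_ <-] [_ <-] [_ <-] [_ <-] [_ <-] [_ <-] [_ <-] [_ <-].
by rewrite /poisson big_ord2.
Qed.

Lemma poisson_eq_on U F F' H H' x p : open U -> U x ->
  (forall y q, U y -> F y q = F' y q) -> (forall y q, U y -> H y q = H' y q) ->
  poisson F H x p = poisson F' H' x p.
Proof.
move=> oU Ux FF HH; rewrite /poisson; apply: eq_bigr => i _.
have -> : pd_mom i F x p = pd_mom i F' x p.
  by rewrite /pd_mom; congr pd; apply/funext => q; exact: FF.
have -> : pd_mom i H x p = pd_mom i H' x p.
  by rewrite /pd_mom; congr pd; apply/funext => q; exact: HH.
have -> : pd_pos i F x p = pd_pos i F' x p.
  by apply: (pd_eq_on _ oU Ux) => y Uy; exact: FF.
have -> // : pd_pos i H x p = pd_pos i H' x p.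
by apply: (pd_eq_on _ oU Ux) => y Uy; exact: HH.
Qed.

End poisson_calculus.

Ltac isD :=
  lazymatch goal with
  | |- is_derive ?x ?v (fun u => GRing.add (@?f u) (@?g u)) _ =>
      notypeclasses refine (@is_derive_addE _ _ x v f g _ _ _ _); [isD | isD]
  | |- is_derive ?x ?v (fun u => GRing.opp (@?f u)) _ =>
      notypeclasses refine (@is_derive_oppE _ _ x v f _ _); isD
  | |- is_derive ?x ?v (fun u => GRing.mul (@?f u) (@?g u)) _ =>
      notypeclasses refine (@is_derive_mulE _ _ x v f g _ _ _ _); [isD | isD]
  | |- is_derive ?x (delta_mx 0 ?i) (fun u => fun_of_matrix u 0 ?k) _ =>
      exact (@is_derive_coord _ 2 k i x)
  | |- is_derive ?x ?v (fun _ => ?c) _ => exact (@is_derive_cstE _ _ x v c)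
  | |- _ => first [eassumption | match goal with D : _ |- _ => first [exact (D _ _ _) | exact (D _ _) | exact (D _)] end]
  end.

Ltac isD_eq := notypeclasses refine (@is_derive_eq _ _ _ _ _ _ _ _ _ _); [isD | cbv beta].

Ltac poissonD :=
  notypeclasses refine
    (@poisson_is_derive _ _ _ _ _ _ _ _ _ _ _ _ _ _ _ _ _ _ _ _ _);
  cbv beta; isD.

(** * Homogeneous components of the bracket *)

Section poisson_top.
Context {R : realType}.
Implicit Types (U V : set 'rV[R]_2) (f g : 'rV[R]_2 -> R) (x y z p : 'rV[R]_2).
Implicit Types (F H : 'rV[R]_2 -> 'rV[R]_2 -> R).

(** Products are used in place of powers so that [isD] applies. The index of a coefficient counts
    the factors [p 0 1]. *)
Definition cub (k : 'I_4 -> R) (p : 'rV[R]_2) : R :=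
  k 0 * p 0 0 * p 0 0 * p 0 0 + k 1 * p 0 0 * p 0 0 * p 0 1
  + k 2 * p 0 0 * p 0 1 * p 0 1 + k 3 * p 0 1 * p 0 1 * p 0 1.

Definition quad (h : 'I_3 -> R) (p : 'rV[R]_2) : R :=
  h 0 * p 0 0 * p 0 0 + h 1 * p 0 0 * p 0 1 + h 2 * p 0 1 * p 0 1.

Definition lin (l : 'I_2 -> R) (p : 'rV[R]_2) : R := l 0 * p 0 0 + l 1 * p 0 1.

Definition dcub (i : 'I_2) (k : 'I_4 -> R) (p : 'rV[R]_2) : R :=
  if i == 0 then 3 * k 0 * p 0 0 ^+ 2 + 2 * k 1 * p 0 0 * p 0 1 + k 2 * p 0 1 ^+ 2
  else k 1 * p 0 0 ^+ 2 + 2 * k 2 * p 0 0 * p 0 1 + 3 * k 3 * p 0 1 ^+ 2.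

Definition dquad (i : 'I_2) (h : 'I_3 -> R) (p : 'rV[R]_2) : R :=
  if i == 0 then 2 * h 0 * p 0 0 + h 1 * p 0 1 else h 1 * p 0 0 + 2 * h 2 * p 0 1.

Lemma is_derive_cub_pos U (k : 'I_4 -> 'rV[R]_2 -> R) i x p : U x ->
  (forall j, smooth_on U (k j)) ->
  is_derive x (delta_mx 0 i) (fun u => cub (k ^~ u) p) (cub (fun j => pd i (k j) x) p).
Proof.
move=> Ux sk; have dk j := smooth_is_derive i (sk j) Ux.
rewrite /cub; isD_eq.
by rewrite !mulr0 !addr0.
Qed.

Lemma is_derive_quad_pos U (h : 'I_3 -> 'rV[R]_2 -> R) i x p : U x ->
  (forall j, smooth_on U (h j)) ->
  is_derive x (delta_mx 0 i) (fun u => quad (h ^~ u) p) (quad (fun j => pd i (h j) x) p).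
Proof.
move=> Ux sh; have dh j := smooth_is_derive i (sh j) Ux.
rewrite /quad; isD_eq.
by rewrite !mulr0 !addr0.
Qed.

Lemma is_derive_lin_pos U (l : 'I_2 -> 'rV[R]_2 -> R) i x p : U x ->
  (forall j, smooth_on U (l j)) ->
  is_derive x (delta_mx 0 i) (fun u => lin (l ^~ u) p) (lin (fun j => pd i (l j) x) p).
Proof.
move=> Ux sl; have dl j := smooth_is_derive i (sl j) Ux.
rewrite /lin; isD_eq.
by rewrite !mulr0 !addr0.
Qed.

Lemma is_derive_cub_mom (k : 'I_4 -> R) i p :
  is_derive p (delta_mx 0 i) (cub k) (dcub i k p).
Proof.
move: i; apply: ord2P; rewrite /cub; isD_eq.
- by rewrite /dcub /=; ring.
- by rewrite /dcub /=; ring.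
Qed.

Lemma is_derive_quad_mom (h : 'I_3 -> R) i p :
  is_derive p (delta_mx 0 i) (quad h) (dquad i h p).
Proof.
move: i; apply: ord2P; rewrite /quad; isD_eq.
- by rewrite /dquad /=; ring.
- by rewrite /dquad /=; ring.
Qed.

Lemma is_derive_lin_mom (l : 'I_2 -> R) i p :
  is_derive p (delta_mx 0 i) (lin l) (l i).
Proof.
move: i; apply: ord2P; rewrite /lin; isD_eq.
- by rewrite /=; ring.
- by rewrite /=; ring.
Qed.

Lemma poisson_cub_quad U (k : 'I_4 -> 'rV[R]_2 -> R) (h : 'I_3 -> 'rV[R]_2 -> R) x p :
  U x -> (forall i, smooth_on U (k i)) -> (forall i, smooth_on U (h i)) ->
  poisson (fun u => cub (k ^~ u)) (fun u => quad (h ^~ u)) x p =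
  \sum_(i < 2) (cub (fun j => pd i (k j) x) p * dquad i (h ^~ x) p
               - dcub i (k ^~ x) p * quad (fun j => pd i (h j) x) p).
Proof.
move=> Ux sk sh.
have k0 i := is_derive_cub_pos i p Ux sk; have k1 i := is_derive_cub_mom (k ^~ x) i p.
have h0 i := is_derive_quad_pos i p Ux sh; have h1 i := is_derive_quad_mom (h ^~ x) i p.
by rewrite (poisson_is_derive (k0 0) (k0 1) (k1 0) (k1 1) (h0 0) (h0 1) (h1 0) (h1 1))
  big_ord2.
Qed.

Lemma poisson_cub_quadE U (k : 'I_4 -> 'rV[R]_2 -> R) (h : 'I_3 -> 'rV[R]_2 -> R) x p
    (dk : 'I_2 -> 'I_4 -> R) (dh : 'I_2 -> 'I_3 -> R) :
  U x -> (forall i, smooth_on U (k i)) -> (forall i, smooth_on U (h i)) ->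
  (forall i j, pd i (k j) x = dk i j) -> (forall i j, pd i (h j) x = dh i j) ->
  poisson (fun u => cub (k ^~ u)) (fun u => quad (h ^~ u)) x p =
  cub (dk 0) p * dquad 0 (h ^~ x) p - dcub 0 (k ^~ x) p * quad (dh 0) p +
  (cub (dk 1) p * dquad 1 (h ^~ x) p - dcub 1 (k ^~ x) p * quad (dh 1) p).
Proof.
move=> Ux sk sh Dk Dh; rewrite (poisson_cub_quad p Ux sk sh) big_ord2.
have E i : (fun j => pd i (k j) x) = dk i by apply/funext => j.
have E' i : (fun j => pd i (h j) x) = dh i by apply/funext => j.
by rewrite !E !E'.
Qed.

(** A quartic without constant term that vanishes at the four points 1, -1, 2, -2 is zero. *)
Lemma homogeneous_top (q : R -> R) (q1 q2 q3 q4 : R) : (forall t, q t = 0) ->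
  (forall t, q t = t ^+ 4 * q4 + t ^+ 3 * q3 + t ^+ 2 * q2 + t * q1) -> q4 = 0.
Proof.
move=> q0 qE.
have := qE 1; have := qE (-1); have := qE 2; have := qE (-2); rewrite !q0; lra.
Qed.

Lemma homogeneous_split (t a0 a1 A0 A1 b0 b1 B0 B1 c0 c1 C0 C1 e0 e1 h0 h1 G0 G1 : R) :
  (t ^+ 3 * a0 + t ^+ 2 * b0 + t * c0 + e0) * (t * G0)
  - (t ^+ 2 * A0 + t * B0 + C0 + 0) * (t ^+ 2 * h0)
  + ((t ^+ 3 * a1 + t ^+ 2 * b1 + t * c1 + e1) * (t * G1)
  - (t ^+ 2 * A1 + t * B1 + C1 + 0) * (t ^+ 2 * h1)) =
  t ^+ 4 * (a0 * G0 - A0 * h0 + (a1 * G1 - A1 * h1))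
  + t ^+ 3 * (b0 * G0 - B0 * h0 + (b1 * G1 - B1 * h1))
  + t ^+ 2 * (c0 * G0 - C0 * h0 + (c1 * G1 - C1 * h1))
  + t * (e0 * G0 + e1 * G1).
Proof. by ring. Qed.

Lemma cubZ k t p : cub k (t *: p) = t ^+ 3 * cub k p.
Proof. by rewrite /cub !mxE; ring. Qed.

Lemma quadZ h t p : quad h (t *: p) = t ^+ 2 * quad h p.
Proof. by rewrite /quad !mxE; ring. Qed.

Lemma linZ l t p : lin l (t *: p) = t * lin l p.
Proof. by rewrite /lin !mxE; ring. Qed.

Lemma dcubZ i k t p : dcub i k (t *: p) = t ^+ 2 * dcub i k p.
Proof. by rewrite /dcub !mxE; case: ifP => _; ring. Qed.

Lemma dquadZ i h t p : dquad i h (t *: p) = t * dquad i h p.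
Proof. by rewrite /dquad !mxE; case: ifP => _; ring. Qed.

(** The bracket with a quadratic form raises the degree in the momenta by one, so its part of degree
    4 is the bracket of the cubic part alone. Scaling the momenta by [t] separates the degrees. *)
Lemma poisson_top U (k : 'I_4 -> 'rV[R]_2 -> R) (h l2 : 'I_3 -> 'rV[R]_2 -> R)
    (l1 : 'I_2 -> 'rV[R]_2 -> R) (l0 : 'rV[R]_2 -> R) x p : U x ->
  (forall i, smooth_on U (k i)) -> (forall i, smooth_on U (h i)) ->
  (forall i, smooth_on U (l2 i)) -> (forall i, smooth_on U (l1 i)) ->
  smooth_on U l0 ->
  (forall q, poisson
     (fun u q => cub (k ^~ u) q + quad (l2 ^~ u) q + lin (l1 ^~ u) q + l0 u)
     (fun u => quad (h ^~ u)) x q = 0) ->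
  poisson (fun u => cub (k ^~ u)) (fun u => quad (h ^~ u)) x p = 0.
Proof.
move=> Ux sk sh sl2 sl1 sl0 H0.
pose q3 := \sum_(i < 2) (quad (fun j => pd i (l2 j) x) p * dquad i (h ^~ x) p
               - dquad i (l2 ^~ x) p * quad (fun j => pd i (h j) x) p).
pose q2 := \sum_(i < 2) (lin (fun j => pd i (l1 j) x) p * dquad i (h ^~ x) p
               - l1 i x * quad (fun j => pd i (h j) x) p).
pose q1 := \sum_(i < 2) (pd i l0 x * dquad i (h ^~ x) p).
rewrite (poisson_cub_quad p Ux sk sh); set q4 := \sum_(i < 2) _.
apply: (@homogeneous_top (fun t => poisson
     (fun u q => cub (k ^~ u) q + quad (l2 ^~ u) q + lin (l1 ^~ u) q + l0 u)
     (fun u => quad (h ^~ u)) x (t *: p)) q1 q2 q3) => [t|t]; first exact: H0.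
have Dk0 i : is_derive x (delta_mx 0 i) (fun u => cub (k ^~ u) (t *: p))
    (t ^+ 3 * cub (fun j => pd i (k j) x) p).
  by rewrite -cubZ; exact: is_derive_cub_pos Ux sk.
have Dk1 i : is_derive (t *: p) (delta_mx 0 i) (cub (k ^~ x)) (t ^+ 2 * dcub i (k ^~ x) p).
  by rewrite -dcubZ; exact: is_derive_cub_mom.
have Dh0 i : is_derive x (delta_mx 0 i) (fun u => quad (h ^~ u) (t *: p))
    (t ^+ 2 * quad (fun j => pd i (h j) x) p).
  by rewrite -quadZ; exact: is_derive_quad_pos Ux sh.
have Dh1 i : is_derive (t *: p) (delta_mx 0 i) (quad (h ^~ x)) (t * dquad i (h ^~ x) p).
  by rewrite -dquadZ; exact: is_derive_quad_mom.
have Dl0 i : is_derive x (delta_mx 0 i) (fun u => quad (l2 ^~ u) (t *: p))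
    (t ^+ 2 * quad (fun j => pd i (l2 j) x) p).
  by rewrite -quadZ; exact: is_derive_quad_pos Ux sl2.
have Dl1 i : is_derive (t *: p) (delta_mx 0 i) (quad (l2 ^~ x)) (t * dquad i (l2 ^~ x) p).
  by rewrite -dquadZ; exact: is_derive_quad_mom.
have Dm0 i : is_derive x (delta_mx 0 i) (fun u => lin (l1 ^~ u) (t *: p))
    (t * lin (fun j => pd i (l1 j) x) p).
  by rewrite -linZ; exact: is_derive_lin_pos Ux sl1.
have Dm1 i := is_derive_lin_mom (l1 ^~ x) i (t *: p).
have dl0 j := smooth_is_derive j sl0 Ux.
eapply eq_trans; first by poissonD.
rewrite /q1 /q2 /q3 /q4 !big_ord2; exact: homogeneous_split.
Qed.

End poisson_top.

(** * The cubic part of an integral *)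

Section integral_cubic_part.
Context {R : realType}.
Implicit Types (U V : set 'rV[R]_2) (f : 'rV[R]_2 -> R) (x y z p : 'rV[R]_2).
Implicit Types (g : 'rV[R]_2 -> 'M[R]_2).

Lemma ord3P (P : 'I_3 -> Prop) : P 0 -> P 1 -> P 2 -> forall i, P i.
Proof.
move=> P0 P1 P2 [[|[|[|//]]] i].
- by rewrite (_ : Ordinal i = 0)//; exact/val_inj.
- by rewrite (_ : Ordinal i = 1)//; exact/val_inj.
- by rewrite (_ : Ordinal i = 2)//; exact/val_inj.
Qed.

Lemma ord4P (P : 'I_4 -> Prop) : P 0 -> P 1 -> P 2 -> P 3 -> forall i, P i.
Proof.
move=> P0 P1 P2 P3 [[|[|[|[|//]]]] i].
- by rewrite (_ : Ordinal i = 0)//; exact/val_inj.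
- by rewrite (_ : Ordinal i = 1)//; exact/val_inj.
- by rewrite (_ : Ordinal i = 2)//; exact/val_inj.
- by rewrite (_ : Ordinal i = 3)//; exact/val_inj.
Qed.

Lemma polynomial3 U F : polynomial_in_momenta U 3 F ->
  exists (k : 'I_4 -> 'rV[R]_2 -> R) (l2 : 'I_3 -> 'rV[R]_2 -> R)
    (l1 : 'I_2 -> 'rV[R]_2 -> R) (l0 : 'rV[R]_2 -> R),
  [/\ forall i, smooth_on U (k i),
      (forall i, smooth_on U (l2 i)) /\ (forall i, smooth_on U (l1 i)) /\ smooth_on U l0,
      forall u q, U u ->
        F u q = cub (k ^~ u) q + quad (l2 ^~ u) q + lin (l1 ^~ u) q + l0 u
    & U `<=` closure [set x | exists i, k i x != 0]].
Proof.
move=> [a [sa Fa Ua]].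
exists (fun i => a (3 - i)%N i), (fun i => a (2 - i)%N i), (fun i => a (1 - i)%N i), (a 0%N 0%N).
split => //.
- move=> u q Uu; rewrite Fa//.
  under eq_bigr do rewrite big_mkcond !big_ord_recr big_ord0 /=.
  rewrite !big_ord_recr big_ord0 /=.
  transitivity (a 3%N 0%N u * q 0 0 * q 0 0 * q 0 0 + a 2%N 1%N u * q 0 0 * q 0 0 * q 0 1
    + a 1%N 2%N u * q 0 0 * q 0 1 * q 0 1 + a 0%N 3%N u * q 0 1 * q 0 1 * q 0 1
    + (a 2%N 0%N u * q 0 0 * q 0 0 + a 1%N 1%N u * q 0 0 * q 0 1
    + a 0%N 2%N u * q 0 1 * q 0 1) + (a 1%N 0%N u * q 0 0 + a 0%N 1%N u * q 0 1)
    + a 0%N 0%N u); last by [].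
  by ring.
- move=> x /Ua; apply: closure_subset => y /= [i i3 ai].
  have i4 : (3 - i < 4)%N by rewrite ltnS leq_subr.
  by exists (Ordinal i4); rewrite /= subKn.
Qed.

Definition hcoef g (j : 'I_3) x : R :=
  let G := invmx (g x) in
  if j == 0 then 2^-1 * G 0 0
  else if j == 1 then 2^-1 * (G 0 1 + G 1 0) else 2^-1 * G 1 1.

Lemma hamiltonianE g x p : hamiltonian g x p = quad (hcoef g ^~ x) p.
Proof.
rewrite /hamiltonian /quad /hcoef /= [X in 2^-1 * X]mxE big_ord2 !mulmx_row2 !mxE.
by ring.
Qed.

Lemma quadform_row (G : 'M[R]_2) (v : 'rV[R]_2) : (v *m G *m v^T) 0 0 =
  G 0 0 * v 0 0 ^+ 2 + (G 0 1 + G 1 0) * v 0 0 * v 0 1 + G 1 1 * v 0 1 ^+ 2.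
Proof. by rewrite [LHS]mxE big_ord2 !mulmx_row2 !mxE; ring. Qed.

Lemma pt_neq0 (a b : R) : (a != 0) || (b != 0) -> pt a b != 0.
Proof.
apply: contraL => /eqP/rowP E; have := E 0; have := E 1.
by rewrite pt0 pt1 !mxE => -> ->; rewrite eqxx.
Qed.

Lemma riemannian_inverse U g x : riemannian_on U g -> U x ->
  let G := invmx (g x) in
  [/\ \det (g x) != 0, G 0 1 = G 1 0, 0 < G 0 0 & 0 < G 0 0 * G 1 1 - G 0 1 ^+ 2].
Proof.
move=> [_ rg] Ux G; have [gT gpos] := rg _ Ux.
have ug : g x \in unitmx.
  rewrite -row_free_unit -kermx_eq0; apply/negPn/negP => /rowV0Pn[v vk v0].
  have := gpos v v0; have /sub_kermxP -> := vk.
  by rewrite mul0mx mxE ltxx.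
have GT : G^T = G by rewrite /G trmx_inv gT.
(* The form of [G] at [v] is the form of [g x] at [v *m G]. *)
have Gpos (v : 'rV[R]_2) : v != 0 -> 0 < (v *m G *m v^T) 0 0.
  move=> v0; have := gpos (v *m G).
  rewrite trmx_mul GT !mulmxA (mulmxKV ug); apply.
  apply: contra_neq v0 => vG; rewrite -(mulmxK ug v) -/G.
  by rewrite -[v]mulmx1 -(mulVmx ug) mulmxA vG !mul0mx.
have G01 : G 0 1 = G 1 0 by rewrite -{1}GT mxE.
have G0 : 0 < G 0 0.
  have := Gpos (pt 1 0); rewrite quadform_row pt0 pt1 pt_neq0 ?oner_neq0//.
  by move=> /(_ isT); lra.
split => //; first by rewrite -unitfE -unitmxE.
(* At this vector the form of [G] equals [G 0 0] times its determinant. *)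
have := Gpos (pt (- G 0 1) (G 0 0)); rewrite quadform_row pt0 pt1 pt_neq0; last first.
  by rewrite (gt_eqF G0) orbT.
move=> /(_ isT); rewrite -G01.
have -> : G 0 0 * (- G 0 1) ^+ 2 + (G 0 1 + G 0 1) * - G 0 1 * G 0 0 +
  G 1 1 * G 0 0 ^+ 2 = G 0 0 * (G 0 0 * G 1 1 - G 0 1 ^+ 2) by ring.
by rewrite pmulr_rgt0.
Qed.

Lemma smooth_hcoef U g j : open U -> riemannian_on U g -> smooth_on U (hcoef g j).
Proof.
move=> oU rg; have [sg _] := rg.
have sG : forall i j, smooth_on U (fun x => invmx (g x) i j).
  by apply: smooth_invmx => // x Ux; have [] := riemannian_inverse rg Ux.
have sc : smooth_on U (fun=> 2^-1 : R) by exact: smooth_on_cst.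
rewrite /hcoef /=; case: (j == 0); first exact: smooth_onM.
by case: (j == 1); apply: smooth_onM => //; exact: smooth_onD.
Qed.

Lemma integral_cubic_part U g F : open U -> riemannian_on U g -> integral_on U g 3 F ->
  exists (k : 'I_4 -> 'rV[R]_2 -> R) (l2 : 'I_3 -> 'rV[R]_2 -> R)
    (l1 : 'I_2 -> 'rV[R]_2 -> R) (l0 : 'rV[R]_2 -> R),
  [/\ forall i, smooth_on U (k i),
      forall u q, U u ->
        F u q = cub (k ^~ u) q + quad (l2 ^~ u) q + lin (l1 ^~ u) q + l0 u,
      U `<=` closure [set x | exists i, k i x != 0]
    & forall x p, U x ->
        poisson (fun u => cub (k ^~ u)) (fun u => quad (hcoef g ^~ u)) x p = 0].
Proof.
move=> oU rg [Fp FH _].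
have [k [l2 [l1 [l0 [sk [sl2 [sl1 sl0]] FE kd]]]]] := polynomial3 Fp.
exists k, l2, l1, l0; split => // x p Ux.
apply: (poisson_top p Ux sk _ sl2 sl1 sl0); first by move=> i; exact: smooth_hcoef.
move=> q; rewrite -(FH x q Ux); apply: (poisson_eq_on _ oU Ux) => y r Uy.
- by rewrite FE.
- by rewrite hamiltonianE.
Qed.

Lemma homogeneous_top3 (a3 a2 a1 a0 b3 b2 b1 b0 : R) :
  (forall t, t ^+ 3 * a3 + t ^+ 2 * a2 + t * a1 + a0 =
             t ^+ 3 * b3 + t ^+ 2 * b2 + t * b1 + b0) -> a3 = b3.
Proof.
by move=> E; have := E 0; have := E 1; have := E (-1); have := E 2; lra.
Qed.

Lemma cub_inj (k k' : 'I_4 -> R) : (forall p, cub k p = cub k' p) -> forall i, k i = k' i.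
Proof.
move=> E.
have E1 := E (pt 1 0); have E2 := E (pt 0 1); have E3 := E (pt 1 1).
have E4 := E (pt 1 (-1)).
rewrite /cub !pt0 !pt1 in E1 E2 E3 E4.
by apply: ord4P; lra.
Qed.

End integral_cubic_part.

(** * Cubic forms in conformal coordinates *)

Section conformal.
Context {R : realType}.
Implicit Types (U V : set 'rV[R]_2) (f : 'rV[R]_2 -> R) (x y z p : 'rV[R]_2).
Implicit Types (g : 'rV[R]_2 -> 'M[R]_2).

Definition conformal_h (lam : 'rV[R]_2 -> R) (j : 'I_3) (u : 'rV[R]_2) : R :=
  if j == 1 then 0 else (2 * lam u)^-1.

Lemma hcoef_conformal g (lam : 'rV[R]_2 -> R) j x : g x = (lam x)%:M ->
  hcoef g j x = conformal_h lam j x.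
Proof.
move=> gx; rewrite /hcoef gx invmx_scalar /conformal_h; move: j.
by apply: ord3P; rewrite /= !mxE /= ?mulr1n ?mulr0n ?addr0 ?mulr0 ?invfM.
Qed.

Lemma pd_is_derive f x i (d : R) : is_derive x (delta_mx 0 i) f d -> pd i f x = d.
Proof. by move=> [_ <-]. Qed.

(** Coefficients of [Re (p0 + i p1)^3 + |p|^2 (b0 p0 + b1 p1) / lam]. Because of the division by
    [lam], the second term is twice the energy times [b0 p0 + b1 p1]. *)
Definition conformal_k (lam b0 b1 : 'rV[R]_2 -> R) (j : 'I_4) (u : 'rV[R]_2) : R :=
  if j == 0 then 1 + b0 u / lam u
  else if j == 1 then b1 u / lam u
  else if j == 2 then b0 u / lam u - 3 else b1 u / lam u.

Lemma conformal_bracket_identity (l b0 b1 L0 L1 c0 c1 d0 d1 : R) p : l != 0 ->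
  let k (j : 'I_4) := if j == 0 then 1 + b0 / l else if j == 1 then b1 / l
                      else if j == 2 then b0 / l - 3 else b1 / l in
  let h (j : 'I_3) := if j == 1 then 0 else (2 * l)^-1 in
  let dk a b L (j : 'I_4) := if (j == 0) || (j == 2) then (a - b0 / l * L) / l
                             else (b - b1 / l * L) / l in
  let dh L (j : 'I_3) := if j == 1 then 0 else - (2^-1 * l ^- 2 * L) in
  cub (dk c0 d0 L0) p * dquad 0 h p - dcub 0 k p * quad (dh L0) p
  + (cub (dk c1 d1 L1) p * dquad 1 h p - dcub 1 k p * quad (dh L1) p) =
  (p 0 0 ^+ 2 + p 0 1 ^+ 2) * l ^- 2 *
  ((c0 + 3 / 2 * L0 + (b0 * L0 + b1 * L1) / (2 * l)) * p 0 0 ^+ 2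
   + (c1 + d0 - 3 * L1) * p 0 0 * p 0 1
   + (d1 - 3 / 2 * L0 + (b0 * L0 + b1 * L1) / (2 * l)) * p 0 1 ^+ 2).
Proof.
move=> l0 /=; rewrite /cub /quad /dcub /dquad /=.
by move: (p 0 0) (p 0 1) => q r; field.
Qed.

Section conformal_bracket.
Variables (U : set 'rV[R]_2) (lam : 'rV[R]_2 -> R).
Hypotheses (oU : open U) (slam : smooth_on U lam) (lam0 : forall x, U x -> lam x != 0).

Lemma smooth_conformal_h j : smooth_on U (conformal_h lam j).
Proof.
rewrite /conformal_h; case: (j == 1); first exact: smooth_on_cst.
apply: smooth_onV => //.
  by move=> x Ux; rewrite mulf_neq0 ?lam0 ?pnatr_eq0.
by apply: smooth_onM => //; exact: smooth_on_cst.
Qed.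

Lemma pd_conformal_h i j x : U x -> pd i (conformal_h lam j) x =
  if j == 1 then 0 else - (2^-1 * lam x ^- 2 * pd i lam x).
Proof.
move=> Ux; rewrite /conformal_h; case: (j == 1); first exact: derive_cst.
have dl := smooth_is_derive i slam Ux; have l0 := lam0 Ux.
have l20 : 2 * lam x != 0 by rewrite mulf_neq0 ?pnatr_eq0.
have D : is_derive x (delta_mx 0 i) (fun u => 2 * lam u) (2 * pd i lam x).
  by isD_eq; rewrite mul0r add0r.
have dD : derivable (fun u => 2 * lam u) x (delta_mx 0 i) by case: D.
by rewrite (pdV l20 dD) (pd_is_derive D); field.
Qed.

Variables (b0 b1 : 'rV[R]_2 -> R).
Hypotheses (sb0 : smooth_on U b0) (sb1 : smooth_on U b1).

Lemma smooth_conformal_k j : smooth_on U (conformal_k lam b0 b1 j).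
Proof.
have sV : smooth_on U (fun u => (lam u)^-1) by exact: smooth_onV.
have s0 : smooth_on U (fun u => b0 u / lam u) by exact: smooth_onM.
have s1 : smooth_on U (fun u => b1 u / lam u) by exact: smooth_onM.
rewrite /conformal_k; case: (j == 0).
  by apply: smooth_onD => //; exact: smooth_on_cst.
case: (j == 1) => //; case: (j == 2) => //.
by apply: smooth_onB => //; exact: smooth_on_cst.
Qed.

Lemma pd_conformal_k i j x : U x -> pd i (conformal_k lam b0 b1 j) x =
  if (j == 0) || (j == 2) then (pd i b0 x - b0 x / lam x * pd i lam x) / lam x
  else (pd i b1 x - b1 x / lam x * pd i lam x) / lam x.
Proof.
move=> Ux.
have dl := smooth_is_derive i slam Ux; have l0 := lam0 Ux.
have dV : is_derive x (delta_mx 0 i) (fun u => (lam u)^-1) (- (lam x ^- 2 * pd i lam x)).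
  have sV : smooth_on U (fun u => (lam u)^-1) by exact: smooth_onV.
  have dd := smooth_on_derivable (i := i) slam Ux.
  by rewrite -(pdV l0 dd); exact: smooth_is_derive sV Ux.
have db0 := smooth_is_derive i sb0 Ux; have db1 := smooth_is_derive i sb1 Ux.
apply: pd_is_derive; rewrite /conformal_k; move: j.
apply: ord4P; rewrite /=; isD_eq.
all: by field.
Qed.

(* The trace-free part of the bracket of a cubic form with the kinetic energy
   vanishes because the trace-free part of the form is constant; what is left
   is a multiple of the energy. *)
Lemma conformal_poisson x p : U x ->
  poisson (fun u => cub (conformal_k lam b0 b1 ^~ u))
          (fun u => quad (conformal_h lam ^~ u)) x p =
  (p 0 0 ^+ 2 + p 0 1 ^+ 2) * lam x ^- 2 *
  ((pd 0 b0 x + 3 / 2 * pd 0 lam x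
    + (b0 x * pd 0 lam x + b1 x * pd 1 lam x) / (2 * lam x)) * p 0 0 ^+ 2
   + (pd 1 b0 x + pd 0 b1 x - 3 * pd 1 lam x) * p 0 0 * p 0 1
   + (pd 1 b1 x - 3 / 2 * pd 0 lam x
    + (b0 x * pd 0 lam x + b1 x * pd 1 lam x) / (2 * lam x)) * p 0 1 ^+ 2).
Proof.
move=> Ux; have l0 := lam0 Ux.
pose d i b := pd i b x - b x / lam x * pd i lam x.
rewrite (@poisson_cub_quadE _ _ _ _ x p
  (fun i j => if (j == 0) || (j == 2) then d i b0 / lam x else d i b1 / lam x)
  (fun i j => if j == 1 then 0 else - (2^-1 * lam x ^- 2 * pd i lam x))
  Ux smooth_conformal_k smooth_conformal_h).
- exact: (conformal_bracket_identity (b0 x) (b1 x) (pd 0 lam x) (pd 1 lam x)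
    (pd 0 b0 x) (pd 1 b0 x) (pd 0 b1 x) (pd 1 b1 x) p l0).
- by move=> i j; rewrite pd_conformal_k.
- by move=> i j; rewrite pd_conformal_h.
Qed.

(** The residual quadratic form in the bracket has three coefficients: the difference of the outer
    two, the middle one, and the sum of the outer two times [lam]. The first two equations form the
    inhomogeneous Cauchy-Riemann system [b_zbar = - 3 lam_z] for [b = b0 + i b1]; the last says that
    [lam * (b0, b1)] is divergence free. *)
Lemma conformal_poisson0P x : U x ->
  (forall p, poisson (fun u => cub (conformal_k lam b0 b1 ^~ u))
                     (fun u => quad (conformal_h lam ^~ u)) x p = 0) <->
  [/\ pd 0 b0 x - pd 1 b1 x = - 3 * pd 0 lam x,
      pd 1 b0 x + pd 0 b1 x = 3 * pd 1 lam x &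
      lam x * (pd 0 b0 x + pd 1 b1 x) + b0 x * pd 0 lam x + b1 x * pd 1 lam x = 0].
Proof.
move=> Ux; have l0 := lam0 Ux.
set c0 := pd 0 b0 x; set c1 := pd 1 b0 x; set d0 := pd 0 b1 x; set d1 := pd 1 b1 x.
set l := lam x in l0 *; set L0 := pd 0 lam x; set L1 := pd 1 lam x.
set w := (b0 x * L0 + b1 x * L1) / (2 * l).
have wE : b0 x * L0 + b1 x * L1 = 2 * l * w by rewrite /w; field.
have l2 : l ^- 2 != 0 by rewrite invr_eq0 expf_neq0.
split=> [H|[H1 H2 H3] p].
  have E a b : (a ^+ 2 + b ^+ 2 != 0) ->
      (c0 + 3 / 2 * L0 + w) * a ^+ 2 + (c1 + d0 - 3 * L1) * a * b +
      (d1 - 3 / 2 * L0 + w) * b ^+ 2 = 0.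
    move=> ab; have := H (pt a b); rewrite conformal_poisson// pt0 pt1.
    by move/eqP; rewrite !mulf_eq0 (negbTE ab) (negbTE l2) /= => /eqP.
  have := E 1 0; have := E 0 1; have := E 1 1.
  rewrite !expr1n !expr0n /= !addr0 !add0r oner_neq0 -[1 + 1]/(2%:R) pnatr_eq0 /=.
  move=> /(_ isT) E1 /(_ isT) E2 /(_ isT) E3.
  split; [lra|lra|].
  rewrite -addrA wE; have -> : d1 = - c0 - 2 * w by lra.
  by ring.
rewrite conformal_poisson// -/c0 -/c1 -/d0 -/d1 -/l -/L0 -/L1 -/w.
have {}H3 : c0 + d1 = - 2 * w.
  apply: (mulfI l0); move: H3; rewrite -addrA wE => H3; lra.
have -> : c0 + 3 / 2 * L0 + w = 0 by lra.
have -> : c1 + d0 - 3 * L1 = 0 by lra.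
have -> : d1 - 3 / 2 * L0 + w = 0 by lra.
by rewrite !mul0r !addr0 mulr0.
Qed.

End conformal_bracket.

End conformal.

Local Opaque pd.

(** * The potential of a normalised cubic integral *)

Section potential.
Context {R : realType}.
Implicit Types (U V : set 'rV[R]_2) (f : 'rV[R]_2 -> R) (x y z p : 'rV[R]_2).

Lemma pde_star_is_derive U f P Q S x : open U -> U x ->
  smooth_on U P -> smooth_on U Q -> smooth_on U S ->
  (forall u, U u -> [/\ pd 0 (pd 0 f) u = P u, pd 0 (pd 1 f) u = Q u
                      & pd 1 (pd 1 f) u = S u]) ->
  pde_star f x <->
  (pd 0 P x - pd 0 S x) * (P x + S x) + (P x - S x) * (pd 0 P x + pd 0 S x) =
  2 * (pd 1 Q x * (P x + S x) + Q x * (pd 1 P x + pd 1 S x)).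
Proof.
move=> oU Ux sP sQ sS fE; rewrite /pde_star /laplacian.
have dP i := smooth_is_derive i sP Ux; have dQ i := smooth_is_derive i sQ Ux.
have dS i := smooth_is_derive i sS Ux.
have -> : pd 0 (fun u => (pd 0 (pd 0 f) u - pd 1 (pd 1 f) u) *
    (pd 0 (pd 0 f) u + pd 1 (pd 1 f) u)) x =
    (pd 0 P x - pd 0 S x) * (P x + S x) + (P x - S x) * (pd 0 P x + pd 0 S x).
  transitivity (pd 0 (fun u => (P u - S u) * (P u + S u)) x).
    by apply: (pd_eq_on _ oU Ux) => u Uu; have [-> _ ->] := fE u Uu.
  by apply: pd_is_derive; isD.
have -> // : pd 1 (fun u => pd 0 (pd 1 f) u *
    (pd 0 (pd 0 f) u + pd 1 (pd 1 f) u)) x =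
    pd 1 Q x * (P x + S x) + Q x * (pd 1 P x + pd 1 S x).
  transitivity (pd 1 (fun u => Q u * (P u + S u)) x).
    by apply: (pd_eq_on _ oU Ux) => u Uu; have [-> -> ->] := fE u Uu.
  by apply: pd_is_derive; isD.
Qed.

Lemma conformal_potential z r r' (lam b0 b1 : 'rV[R]_2 -> R) : 0 < r < r' ->
  smooth_on (ball z r') lam -> smooth_on (ball z r') b0 -> smooth_on (ball z r') b1 ->
  (forall x, ball z r' x ->
    [/\ pd 0 b0 x - pd 1 b1 x = - 3 * pd 0 lam x,
      pd 1 b0 x + pd 0 b1 x = 3 * pd 1 lam x &
      lam x * (pd 0 b0 x + pd 1 b1 x) + b0 x * pd 0 lam x + b1 x * pd 1 lam x = 0]) ->
  exists f, [/\ smooth_on (ball z r) f,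
    forall u, ball z r u -> lam u = 4^-1 * laplacian f u
    & forall u, ball z r u -> pde_star f u].
Proof.
move=> rr' sl s0 s1 E.
have oB s : open (ball z s) by exact: ball_open.
(* The Hessian entries are solved from [P + S = 4 lam] and [b0 + i b1 = - 3 f_zz], that is
   [b0 = - 3/4 (P - S)] and [b1 = 3/2 Q]. The two compatibility conditions are then the first two
   equations. *)
pose P u := 2 * lam u - 2 / 3 * b0 u; pose S u := 2 * lam u + 2 / 3 * b0 u.
pose Q u := 2 / 3 * b1 u.
have sP : smooth_on (ball z r') P.
  by apply: smooth_onB => //; apply: smooth_onM => //; exact: smooth_on_cst.
have sS : smooth_on (ball z r') S.
  by apply: smooth_onD => //; apply: smooth_onM => //; exact: smooth_on_cst.
have sQ : smooth_on (ball z r') Q.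
  by apply: smooth_onM => //; exact: smooth_on_cst.
have D i x : ball z r' x -> [/\ pd i P x = 2 * pd i lam x - 2 / 3 * pd i b0 x,
    pd i Q x = 2 / 3 * pd i b1 x & pd i S x = 2 * pd i lam x + 2 / 3 * pd i b0 x].
  move=> Bx; have dl := smooth_is_derive i sl Bx.
  have d0 := smooth_is_derive i s0 Bx; have d1 := smooth_is_derive i s1 Bx.
  by split; apply: pd_is_derive; rewrite /P /Q /S; isD_eq; ring.
have [x Bx|x Bx|f [sf fE]] := hessian_potential rr' sP sQ sS.
- have [-> _ _] := D 1 x Bx; have [_ -> _] := D 0 x Bx; have [E1 E2 E3] := E x Bx; lra.
- have [_ -> _] := D 1 x Bx; have [_ _ ->] := D 0 x Bx; have [E1 E2 E3] := E x Bx; lra.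
have BB : ball z r `<=` ball z r' by case/andP: rr' => _ /ltW; exact: le_ball.
exists f; split => // u Bu.
  by have [f0 _ f1] := fE u Bu; rewrite /laplacian f0 f1 /P /S; field.
apply/(pde_star_is_derive (oB r) Bu (smooth_on_subset BB sP) (smooth_on_subset BB sQ)
  (smooth_on_subset BB sS) fE).
have [-> _ ->] := D 0 u (BB _ Bu); have [-> -> ->] := D 1 u (BB _ Bu).
have [E1 E2 E3] := E u (BB _ Bu); rewrite /P /S /Q.
move: E3; set a := pd 0 b0 u; set b := pd 1 b1 u; set L0 := pd 0 lam u.
set L1 := pd 1 lam u; set l := lam u => E3.
apply/eqP; rewrite -subr_eq0; apply/eqP.
(* After the first two equations are used, (star) is the divergence equation up to this constant. *)
rewrite [LHS](_ : _ = - (16 / 3) * (l * (a + b) + b0 u * L0 + b1 u * L1)).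
  by rewrite E3 mulr0.
by field.
Qed.

End potential.

(** * The cubic integral of a potential *)

Section conformal_integral.
Context {R : realType}.
Implicit Types (U V : set 'rV[R]_2) (f : 'rV[R]_2 -> R) (x y z p : 'rV[R]_2).

Lemma row_free_momenta (a b : 'rV[R]_2) (c d : 'rV[R]_2) :
  c 0 0 * d 0 1 - c 0 1 * d 0 0 != 0 ->
  row_free (col_mx (row_mx a c) (row_mx b d)).
Proof.
move=> cd; pose N : 'M[R]_2 := \matrix_(i, j) (if i == 0 then c 0 j else d 0 j).
have uN : N \in unitmx by rewrite unitmxE unitfE det_mx2 !mxE.
have cN : col_mx c d = N.
  have E0 : (0 : 'I_2) = lshift 1 (0 : 'I_1) by exact/val_inj.
  have E1 : (1 : 'I_2) = rshift 1 (0 : 'I_1) by exact/val_inj.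
  apply/matrixP; apply: ord2P => j; rewrite [RHS]mxE /=.
  - by rewrite {1}E0 col_mxEu.
  - by rewrite {1}E1 col_mxEd.
apply/row_freeP; exists (col_mx 0 (invmx N)).
rewrite mul_col_mx !mul_row_col !mulmx0 !add0r -mul_col_mx cN.
exact: mulmxV.
Qed.

(** On the line through [p] along [v] the function is a cubic polynomial with leading coefficient
    [G v]. It has at most three zeros, so one of four points arbitrarily close to [p] is not a
    zero. *)
Lemma cubic_dense_neq0 (G : 'rV[R]_2 -> R) x p v (B : set ('rV[R]_2 * 'rV[R]_2)) :
  (exists c0 c1 c2, forall t, G (p + t *: v) = c0 + c1 * t + c2 * t ^+ 2 + G v * t ^+ 3) ->
  G v != 0 -> nbhs (x, p) B -> exists2 q, G q != 0 & B (x, q).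
Proof.
move=> [c0 [c1 [c2 E]]] Gv nB.
have : \forall t \near (0 : R), B (x, p + t *: v).
  case: nB => -[B1 B2] /= [nB1 nB2] BB.
  have c : (fun t : R => p + t *: v) @ (0 : R) --> p.
    rewrite -[X in _ --> X](addr0 p) -[X in _ --> p + X](scale0r v).
    by apply: cvgD; [exact: cvg_cst|apply: cvgZr_tmp].
  have : \forall t \near (0 : R), B2 (p + t *: v) by exact: c.
  apply: filterS => t tB2; apply: BB; split => //=.
  exact: nbhs_singleton nB1.
move=> /nbhs_ballP[e /= e0 He].
have Ht t : `|t| < e -> B (x, p + t *: v).
  by move=> te; apply: He; rewrite /= /ball /= sub0r normrN.
pose s := e / 2; have s0 : 0 < s by rewrite divr_gt0.
have se : s < e by rewrite /s; lra.
have [H0|] := eqVneq (G (p + 0 *: v)) 0; last first.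
  by exists (p + 0 *: v) => //; apply: Ht; rewrite normr0.
have [H1|] := eqVneq (G (p + s *: v)) 0; last first.
  by exists (p + s *: v) => //; apply: Ht; rewrite gtr0_norm.
have [H2|] := eqVneq (G (p + (- s) *: v)) 0; last first.
  by exists (p + (- s) *: v) => //; apply: Ht; rewrite normrN gtr0_norm.
have [H3|] := eqVneq (G (p + (s / 2) *: v)) 0; last first.
  by exists (p + (s / 2) *: v) => //; apply: Ht; rewrite gtr0_norm; lra.
exfalso; move: H0 H1 H2 H3; rewrite !E => H0 H1 H2 H3.
have : G v * (s ^+ 3) = 0 by nra.
by move/eqP; rewrite mulf_eq0 (negbTE Gv) expf_eq0 gt_eqF.
Qed.

Lemma conformal_integral U (lam b0 b1 : 'rV[R]_2 -> R) : open U ->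
  smooth_on U lam -> (forall x, U x -> lam x != 0) ->
  smooth_on U b0 -> smooth_on U b1 ->
  (forall x, U x ->
    [/\ pd 0 b0 x - pd 1 b1 x = - 3 * pd 0 lam x,
      pd 1 b0 x + pd 0 b1 x = 3 * pd 1 lam x &
      lam x * (pd 0 b0 x + pd 1 b1 x) + b0 x * pd 0 lam x + b1 x * pd 1 lam x = 0]) ->
  integral_on U (fun x => (lam x)%:M) 3 (fun u => cub (conformal_k lam b0 b1 ^~ u)).
Proof.
move=> oU sl l0 s0 s1 E.
have sk := smooth_conformal_k oU sl l0 s0 s1.
split.
- pose a (i j : nat) : 'rV[R]_2 -> R :=
    if (i + j == 3)%N then conformal_k lam b0 b1 (inord j) else fun=> 0.
  exists a; split.
  + by move=> i j; rewrite /a; case: ifP => _; [exact: sk|exact: smooth_on_cst].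
  + move=> x p Ux.
    under eq_bigr do rewrite big_mkcond !big_ord_recr big_ord0 /=.
    rewrite !big_ord_recr big_ord0 /= /a /=.
    have i0 : inord 0 = 0 :> 'I_4 by apply/val_inj; rewrite /= inordK.
    have i1 : inord 1 = 1 :> 'I_4 by apply/val_inj; rewrite /= inordK.
    have i2 : inord 2 = 2 :> 'I_4 by apply/val_inj; rewrite /= inordK.
    have i3 : inord 3 = 3 :> 'I_4 by apply/val_inj; rewrite /= inordK.
    by rewrite i0 i1 i2 i3 /cub; ring.
  + move=> x Ux; apply: subset_closure => /=.
    (* [1 + b0 / lam] and [b0 / lam - 3] differ by 4, so at every point one of the coefficients of
       index 0 and 2 is nonzero. *)
    have [k0|k0] := eqVneq (conformal_k lam b0 b1 0 x) 0; last first.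
      by exists 3%N => //; rewrite /a /= (_ : inord 0 = 0)//; apply/val_inj; rewrite /= inordK.
    exists 1%N => //; rewrite /a /= (_ : inord 2 = 2); last first.
      by apply/val_inj; rewrite /= inordK.
    apply/eqP; move: k0; rewrite /conformal_k /= => H0 H2; lra.
- move=> x p Ux.
  rewrite -((conformal_poisson0P oU sl l0 s0 s1 Ux).2 (E x Ux) p).
  apply: (poisson_eq_on _ oU Ux) => // y q Uy; rewrite hamiltonianE; congr quad.
  by apply/funext => j; exact: hcoef_conformal.
- move=> [x p] [/= Ux _] B nB; rewrite /=.
  set K := conformal_k lam b0 b1 ^~ x.
  (* Up to the factor [1 / lam] this is the Jacobian of the cubic form and the energy in the
     momenta. It is minus the derivative of the cubic form under rotations of the momenta. *)
  pose G q := dcub 0 K q * q 0 1 - dcub 1 K q * q 0 0.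
  have GE q : G q = - (b1 x / lam x) * q 0 0 * (q 0 0 ^+ 2 + q 0 1 ^+ 2)
     + (b0 x / lam x) * q 0 1 * (q 0 0 ^+ 2 + q 0 1 ^+ 2)
     + 9 * q 0 0 ^+ 2 * q 0 1 - 3 * q 0 1 ^+ 3.
    by rewrite /G /K /dcub /conformal_k /=; ring.
  (* Vanishing at [(1, 0)] and [(0, 1)] forces [b1 = 0] and [b0 = 3 lam], and then the value at
     [(1, 1)] is 12. *)
  have [v Gv] : exists v, G v != 0.
    have [G1|] := eqVneq (G (pt 1 0)) 0; last by exists (pt 1 0).
    have [G2|] := eqVneq (G (pt 0 1)) 0; last by exists (pt 0 1).
    exists (pt 1 1); apply/eqP; move: G1 G2; rewrite !GE !pt0 !pt1 => G1 G2; lra.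
  have Gcubic : exists c0 c1 c2, forall t,
      G (p + t *: v) = c0 + c1 * t + c2 * t ^+ 2 + G v * t ^+ 3.
    exists (G p), ((G (p + v) - G (p - v)) / 2 - G v), ((G (p + v) + G (p - v)) / 2 - G p).
    by move=> t; rewrite !GE !mxE; field; exact: l0.
  have [q Gq Bq] := cubic_dense_neq0 Gcubic Gv nB.
  exists (x, q); split => //=; apply: row_free_momenta.
  rewrite !mxE /pd_mom !(pd_is_derive (is_derive_cub_mom _ _ _)).
  have HE : hamiltonian (fun x => (lam x)%:M) x = quad (conformal_h lam ^~ x).
    apply/funext => r; rewrite hamiltonianE; congr quad.
    by apply/funext => j; exact: hcoef_conformal.
  rewrite HE !(pd_is_derive (is_derive_quad_mom _ _ _)) -/K.
  have -> : dcub 0 K q * dquad 1 (conformal_h lam ^~ x) q -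
    dcub 1 K q * dquad 0 (conformal_h lam ^~ x) q = (lam x)^-1 * G q.
    by rewrite /G /dquad /conformal_h /=; field; exact: l0.
  by rewrite mulf_neq0// invr_eq0 l0.
Qed.

Lemma cubic_integral_of_potential U (lam f : 'rV[R]_2 -> R) : open U ->
  riemannian_on U (fun x => (lam x)%:M) -> smooth_on U f ->
  (forall x, U x -> lam x = 4^-1 * laplacian f x) ->
  (forall x, U x -> pde_star f x) ->
  exists F, integral_on U (fun x => (lam x)%:M) 3 F.
Proof.
move=> oU rg sf lf sf_star.
have sl : smooth_on U lam.
  have [/(_ 0 0) + _] := rg; apply: smooth_on_eq => // x _.
  by rewrite mxE eqxx mulr1n.
have l0 x : U x -> lam x != 0.
  move=> Ux; have [+ _ _ _] := riemannian_inverse rg Ux.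
  by rewrite det_scalar expf_eq0.
pose P := pd 0 (pd 0 f); pose Q := pd 0 (pd 1 f); pose S := pd 1 (pd 1 f).
have sP : smooth_on U P by do 2 apply: smooth_on_pd.
have sQ : smooth_on U Q by do 2 apply: smooth_on_pd.
have sS : smooth_on U S by do 2 apply: smooth_on_pd.
have fE u : U u -> [/\ pd 0 (pd 0 f) u = P u, pd 0 (pd 1 f) u = Q u
    & pd 1 (pd 1 f) u = S u] by [].
have PQ x : U x -> pd 1 P x = pd 0 Q x.
  move=> Ux; rewrite /P -(schwarz oU (smooth_on_pd 0 sf 2%N) Ux).
  by apply: (pd_eq_on _ oU Ux) => u Uu; rewrite -(schwarz oU (sf 2%N) Uu).
have QS x : U x -> pd 1 Q x = pd 0 S x.
  by move=> Ux; rewrite /Q -(schwarz oU (smooth_on_pd 1 sf 2%N) Ux).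
clearbody P Q S.
(* These are the real and imaginary parts of [- 3 f_zz]. The Cauchy-Riemann equations then express
   the symmetry of the third derivatives of [f], and the divergence equation is (star). *)
pose b0 u := - (3 / 4) * (P u - S u); pose b1 u := 3 / 2 * Q u.
exists (fun u => cub (conformal_k lam b0 b1 ^~ u)); apply: conformal_integral => //.
- by apply: smooth_onM; [|exact: smooth_on_cst|exact: smooth_onB].
- by apply: smooth_onM; [|exact: smooth_on_cst|].
move=> x Ux.
have dP i := smooth_is_derive i sP Ux; have dQ i := smooth_is_derive i sQ Ux.
have dS i := smooth_is_derive i sS Ux.
have db0 i : pd i b0 x = - (3 / 4) * (pd i P x - pd i S x).
  by apply: pd_is_derive; rewrite /b0; isD_eq; ring.
have db1 i : pd i b1 x = 3 / 2 * pd i Q x.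
  by apply: pd_is_derive; rewrite /b1; isD_eq; ring.
have lE u : U u -> lam u = 4^-1 * (P u + S u).
  by move=> Uu; rewrite lf// /laplacian; have [-> _ ->] := fE u Uu.
have dl i : pd i lam x = 4^-1 * (pd i P x + pd i S x).
  transitivity (pd i (fun u => 4^-1 * (P u + S u)) x); first exact: pd_eq_on lE.
  by apply: pd_is_derive; isD_eq; ring.
have := (pde_star_is_derive oU Ux sP sQ sS fE).1 (sf_star x Ux).
rewrite !db0 !db1 !dl (lE x Ux) /b0 /b1 (PQ x Ux) (QS x Ux).
move: (pd 0 P x) (pd 0 S x) (pd 0 Q x) (pd 1 S x) (P x) (Q x) (S x).
move=> P0 S0 Q0 S1 p q s E; split; [by field|by field|].
apply/eqP; rewrite -subr_eq0; apply/eqP.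
rewrite [LHS](_ : _ = - (3 / 16) * ((P0 - S0) * (p + s) + (p - s) * (P0 + S0)
  - 2 * (S0 * (p + s) + q * (Q0 + S1)))); last by field.
by rewrite E subrr mulr0.
Qed.

End conformal_integral.

(** * Commuting frames and coordinates *)

Section commuting_frames.
Context {R : realType}.
Implicit Types (U V : set 'rV[R]_2) (x y z p : 'rV[R]_2).
Implicit Types (X : 'I_2 -> 'I_2 -> 'rV[R]_2 -> R).

(** Here [X k i] is the component [i] of the vector field [k]. These are the components of the Lie
    bracket of [X 1] and [X 0], in the order for which the associated linear form is the Poisson
    bracket of the linear forms of [X 0] and [X 1]. *)
Definition frame_bracket X (x : 'rV[R]_2) (i : 'I_2) : R :=
  pd 0 (X 0 i) x * X 1 0 x - X 0 0 x * pd 0 (X 1 i) x +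
  (pd 1 (X 0 i) x * X 1 1 x - X 0 1 x * pd 1 (X 1 i) x).

Definition frame_det X (x : 'rV[R]_2) : R := X 0 0 x * X 1 1 x - X 0 1 x * X 1 0 x.

Lemma linD l (p q : 'rV[R]_2) (s t : R) :
  lin l (s *: p + t *: q) = s * lin l p + t * lin l q.
Proof. by rewrite /lin !mxE; ring. Qed.

Lemma quadD h (p q : 'rV[R]_2) (s t : R) : quad h (s *: p + t *: q) =
  s ^+ 2 * quad h p + s * t * (quad h (p + q) - quad h p - quad h q) + t ^+ 2 * quad h q.
Proof. by rewrite /quad !mxE; ring. Qed.

Section dual_momenta.
Variables (X : 'I_2 -> 'I_2 -> R).
Let D := X 0 0 * X 1 1 - X 0 1 * X 1 0.
Hypothesis D0 : D != 0.
(** [e] and [f] are [D] times the basis dual to the two forms; the scaling avoids denominators. *)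
Let e : 'rV[R]_2 := pt (X 1 1) (- X 1 0).
Let f : 'rV[R]_2 := pt (- X 0 1) (X 0 0).

Let le0 : lin (X 0) e = D. Proof. by rewrite /lin pt0 pt1 /D; ring. Qed.
Let le1 : lin (X 1) e = 0. Proof. by rewrite /lin pt0 pt1; ring. Qed.
Let lf0 : lin (X 0) f = 0. Proof. by rewrite /lin pt0 pt1; ring. Qed.
Let lf1 : lin (X 1) f = D. Proof. by rewrite /lin pt0 pt1 /D; ring. Qed.

Lemma lin_dual_eq0 (b : 'I_2 -> R) : lin b e = 0 -> lin b f = 0 -> forall i, b i = 0.
Proof.
rewrite /lin /e /f !pt0 !pt1 => E F.
have F0 : D * b 0 = 0.
  rewrite (_ : _ * _ = X 0 0 * (b 0 * X 1 1 + b 1 * - X 1 0)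
    + X 1 0 * (b 0 * - X 0 1 + b 1 * X 0 0)); last by rewrite /D; ring.
  by rewrite E F !mulr0 addr0.
have F1 : D * b 1 = 0.
  rewrite (_ : _ * _ = X 0 1 * (b 0 * X 1 1 + b 1 * - X 1 0)
    + X 1 1 * (b 0 * - X 0 1 + b 1 * X 0 0)); last by rewrite /D; ring.
  by rewrite E F !mulr0 addr0.
by apply: ord2P; apply: (mulfI D0); rewrite mulr0.
Qed.

(* [r^2] is coprime to the harmonic cubic [Im z^3], so it divides
   [lin b * Im z^3] only for [b = 0]. *)
Lemma harmonic_cubic_coprime (m : R) (b : 'I_2 -> R) (q : 'I_3 -> R) : m != 0 ->
  (forall p, m * lin b p * (3 * lin (X 0) p ^+ 2 * lin (X 1) p - lin (X 1) p ^+ 3)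
    + (lin (X 0) p ^+ 2 + lin (X 1) p ^+ 2) * quad q p = 0) ->
  forall i, b i = 0.
Proof.
move=> m0 H.
have E s t : D * (m * (s * lin b e + t * lin b f)) * (3 * s ^+ 2 * t - t ^+ 3) +
   (s ^+ 2 + t ^+ 2) * (s ^+ 2 * quad q e +
     s * t * (quad q (e + f) - quad q e - quad q f) + t ^+ 2 * quad q f) = 0.
  have D20 : D ^+ 2 != 0 by rewrite expf_neq0.
  apply: (mulfI D20); rewrite mulr0 -[RHS](H (s *: e + t *: f)) !linD quadD.
  by rewrite le0 le1 lf0 lf1; ring.
have E1 := E 1 0; have E2 := E 0 1; have E3 := E 1 1; have E4 := E 1 (-1).
have E5 := E 2 1.
move: E1 E2 E3 E4 E5; set u := lin b e; set v := lin b f.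
move: (quad q e) (quad q f) (quad q (e + f)) => q0 q2 q1 E1 E2 E3 E4 E5.
have H0 : D * (m * u) = 0 by lra.
have H1 : D * (m * v) = 0 by lra.
apply: lin_dual_eq0; apply/eqP.
  by move/eqP: H0; rewrite !mulf_eq0 (negbTE D0) (negbTE m0).
by move/eqP: H1; rewrite !mulf_eq0 (negbTE D0) (negbTE m0).
Qed.

(** The energy factor cancels at nonzero momenta. Where the second form vanishes only the term in
    [c] survives, so [c = 0]; then [lin b] vanishes at [f] and at [e + f], which are independent. *)
Lemma killing_coprime (m c : R) (b : 'I_2 -> R) : m != 0 ->
  (forall p, m / 2 * (lin (X 0) p ^+ 2 + lin (X 1) p ^+ 2) *
     (m * lin (X 1) p * lin b p - (lin (X 0) p ^+ 2 + lin (X 1) p ^+ 2) * c) = 0) ->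
  forall i, b i = 0.
Proof.
move=> m0 H.
have E s t : s ^+ 2 + t ^+ 2 != 0 ->
    m * t * (s * lin b e + t * lin b f) = D * (s ^+ 2 + t ^+ 2) * c.
  move=> st; have := H (s *: e + t *: f); rewrite !linD le0 le1 lf0 lf1 => /eqP.
  rewrite (_ : _ * _ = D ^+ 3 * m / 2 * (s ^+ 2 + t ^+ 2) *
    (m * t * (s * lin b e + t * lin b f) - D * (s ^+ 2 + t ^+ 2) * c)); last by field.
  rewrite !mulf_eq0 invr_eq0 pnatr_eq0 (negbTE st) (negbTE m0) (negbTE D0) /=.
  by rewrite subr_eq0 => /eqP.
have n2 : 1 ^+ 2 + 1 ^+ 2 != 0 :> R by rewrite expr1n -[1 + 1]/(2%:R) pnatr_eq0.
have n1 : 1 ^+ 2 + 0 ^+ 2 != 0 :> R by rewrite expr1n expr0n addr0 oner_neq0.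
have n1' : 0 ^+ 2 + 1 ^+ 2 != 0 :> R by rewrite expr1n expr0n add0r oner_neq0.
have E1 := E 1 0 n1; have E2 := E 0 1 n1'; have E3 := E 1 1 n2.
have Dc : D * c = 0 by lra.
have H1 : m * lin b f = 0 by lra.
have H0 : m * lin b e = 0 by lra.
apply: lin_dual_eq0; apply/eqP.
  by move/eqP: H0; rewrite !mulf_eq0 (negbTE m0).
by move/eqP: H1; rewrite !mulf_eq0 (negbTE m0).
Qed.

End dual_momenta.

(** Recognises a quadratic form from its values at three momenta, so that its coefficients need not
    be written out. *)
Lemma quad_interpolation (Q : 'rV[R]_2 -> R) :
  (forall a b, Q (pt a b) = a ^+ 2 * Q (pt 1 0) +
     a * b * (Q (pt 1 1) - Q (pt 1 0) - Q (pt 0 1)) + b ^+ 2 * Q (pt 0 1)) ->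
  exists q : 'I_3 -> R, forall p, Q p = quad q p.
Proof.
move=> H; exists (fun j => if j == 0 then Q (pt 1 0) else
  if j == 1 then Q (pt 1 1) - Q (pt 1 0) - Q (pt 0 1) else Q (pt 0 1)) => p.
by rewrite {1}(ptE p) H /quad /=; ring.
Qed.

(** The cofactor of [l0^2 + l1^2] in the bracket below. [ai] and [bi] stand for the position
    derivatives of [l0] and [l1] in direction [i], [mi] for those of [m], and [Bki] for those of
    [Bk]. Only its being quadratic in the momenta matters. *)
Definition bracket_quotient
  (m m0 m1 l0 l1 a0 a1 b0 b1 X00 X01 X10 X11 B0 B1 B00 B01 B10 B11 : R) : R :=
  let T0 := 3 * l0 ^+ 2 - 3 * l1 ^+ 2 in let T1 := - (6 * l0 * l1) in
  let B := B0 * l0 + B1 * l1 in let r2 := l0 ^+ 2 + l1 ^+ 2 in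
  - (T0 * X00 + T1 * X10) * m0 / 2 - (T0 * X01 + T1 * X11) * m1 / 2
    + (B00 * l0 + B10 * l1 + B0 * a0 + B1 * b0) * m * (l0 * X00 + l1 * X10)
    + (B01 * l0 + B11 * l1 + B0 * a1 + B1 * b1) * m * (l0 * X01 + l1 * X11)
    - (B0 * X00 + B1 * X10) * (m0 / 2 * r2 + m * (l0 * a0 + l1 * b0))
    - (B0 * X01 + B1 * X11) * (m1 / 2 * r2 + m * (l0 * a1 + l1 * b1))
    - B * (l0 * X00 + l1 * X10) * m0 - B * (l0 * X01 + l1 * X11) * m1.

(** The differential of the cubic form when [l0], [l1], [B0], [B1] vary by [a], [b], [c], [d]. One
    formula serves for positions and, with [c = d = 0], for momenta; likewise [energy_derivative],
    where [n] is the variation of [m]. *)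
Definition harmonic_derivative (l0 l1 B0 B1 a b c d : R) : R :=
  (3 * l0 ^+ 2 - 3 * l1 ^+ 2) * a - 6 * l0 * l1 * b
  + 2 * (l0 * a + l1 * b) * (B0 * l0 + B1 * l1)
  + (l0 ^+ 2 + l1 ^+ 2) * (c * l0 + d * l1 + B0 * a + B1 * b).

Definition energy_derivative (m l0 l1 n a b : R) : R :=
  n / 2 * (l0 ^+ 2 + l1 ^+ 2) + m * (l0 * a + l1 * b).

(** With [r2 = l0^2 + l1^2] one has [{l0, r2} = 2 l1 {l0, l1}] and [{l1, r2} = - 2 l0 {l0, l1}] at
    fixed [m]. Bracketing with [r2] thus acts on [Re (l0 + i l1)^3] as a rotation and produces
    [Im (l0 + i l1)^3]; all other terms contain [r2]. *)
Lemma bracket_identity_harmonic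
  (m m0 m1 l0 l1 a0 a1 b0 b1 X00 X01 X10 X11 B0 B1 B00 B01 B10 B11 : R) :
  let Fx := harmonic_derivative l0 l1 B0 B1 in
  let Hx := energy_derivative m l0 l1 in
  Fx a0 b0 B00 B10 * Hx 0 X00 X10 - Fx X00 X10 0 0 * Hx m0 a0 b0 +
  (Fx a1 b1 B01 B11 * Hx 0 X01 X11 - Fx X01 X11 0 0 * Hx m1 a1 b1) =
  3 * m * (a0 * X10 - X00 * b0 + (a1 * X11 - X01 * b1)) * (3 * l0 ^+ 2 * l1 - l1 ^+ 3)
  + (l0 ^+ 2 + l1 ^+ 2) * bracket_quotient
      m m0 m1 l0 l1 a0 a1 b0 b1 X00 X01 X10 X11 B0 B1 B00 B01 B10 B11.
Proof.
by rewrite /harmonic_derivative /energy_derivative /bracket_quotient /=; field.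
Qed.

(** [{E l0, E} = E {l0, E}], where [{l0, E}] is the sum of [m l1 {l0, l1}] and a multiple of
    [l0^2 + l1^2] coming from the derivative of [m]. *)
Lemma bracket_identity_killing
  (m m0 m1 l0 l1 a0 a1 b0 b1 X00 X01 X10 X11 : R) :
  let E := m / 2 * (l0 * l0 + l1 * l1) in
  let Hx := energy_derivative m l0 l1 in
  (Hx m0 a0 b0 * l0 + E * a0) * Hx 0 X00 X10 - (Hx 0 X00 X10 * l0 + E * X00) * Hx m0 a0 b0 +
  ((Hx m1 a1 b1 * l0 + E * a1) * Hx 0 X01 X11
   - (Hx 0 X01 X11 * l0 + E * X01) * Hx m1 a1 b1) =
  m / 2 * (l0 ^+ 2 + l1 ^+ 2) *
  (m * l1 * (a0 * X10 - X00 * b0 + (a1 * X11 - X01 * b1))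
   - (l0 ^+ 2 + l1 ^+ 2) * ((X00 * m0 + X01 * m1) / 2)).
Proof. by rewrite /energy_derivative /=; field. Qed.

Lemma bracket_quotient_quad (m m0 m1 B0 B1 B00 B01 B10 B11 : R)
    (X0 X1 a0 a1 b0 b1 : 'I_2 -> R) :
  exists q, forall p, bracket_quotient m m0 m1 (lin X0 p) (lin X1 p)
    (lin a0 p) (lin a1 p) (lin b0 p) (lin b1 p) (X0 0) (X0 1) (X1 0) (X1 1)
    B0 B1 B00 B01 B10 B11 = quad q p.
Proof.
apply: quad_interpolation => a b; rewrite /lin !pt0 !pt1 /bracket_quotient /=.
move: (X0 0) (X0 1) (X1 0) (X1 1) (a0 0) (a0 1) (a1 0) (a1 1) (b0 0) (b0 1) (b1 0) (b1 1).
by move=> *; field.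
Qed.

Section bracket.
Variables (U : set 'rV[R]_2) (X : 'I_2 -> 'I_2 -> 'rV[R]_2 -> R) (mu : 'rV[R]_2 -> R).
Variable x : 'rV[R]_2.
Hypotheses (Ux : U x) (sX : forall k i, smooth_on U (X k i)) (smu : smooth_on U mu).
Hypotheses (mu0 : mu x != 0) (D0 : frame_det X x != 0).

Definition frame_lin X (k : 'I_2) (u p : 'rV[R]_2) : R := lin (fun i => X k i u) p.

Definition frame_energy X (mu : 'rV[R]_2 -> R) (u p : 'rV[R]_2) : R :=
  mu u / 2 * (frame_lin X 0 u p * frame_lin X 0 u p + frame_lin X 1 u p * frame_lin X 1 u p).

Definition frame_harmonic X (B : 'I_2 -> 'rV[R]_2 -> R) (u p : 'rV[R]_2) : R :=
  let l0 := frame_lin X 0 u p in let l1 := frame_lin X 1 u p in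
  l0 * l0 * l0 - 3 * (l0 * l1 * l1) + (l0 * l0 + l1 * l1) * (B 0 u * l0 + B 1 u * l1).

Let dl k i p : is_derive x (delta_mx 0 i) (fun u => frame_lin X k u p)
  (lin (fun j => pd i (X k j) x) p).
Proof. exact: (is_derive_lin_pos i p Ux (sX k)). Qed.

Let dm k i p : is_derive p (delta_mx 0 i) (frame_lin X k x) (X k i x).
Proof. exact: (is_derive_lin_mom (fun j => X k j x) i p). Qed.

Let dmu i := smooth_is_derive i smu Ux.

Let dE0 i p : is_derive x (delta_mx 0 i) (frame_energy X mu ^~ p)
  (energy_derivative (mu x) (frame_lin X 0 x p) (frame_lin X 1 x p) (pd i mu x)
    (lin (fun j => pd i (X 0 j) x) p) (lin (fun j => pd i (X 1 j) x) p)).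
Proof.
have d0 := dl 0 i p; have d1 := dl 1 i p; have dn := dmu i.
by rewrite /frame_energy; isD_eq; rewrite /energy_derivative; field.
Qed.

Let dE1 i p : is_derive p (delta_mx 0 i) (frame_energy X mu x)
  (energy_derivative (mu x) (frame_lin X 0 x p) (frame_lin X 1 x p) 0 (X 0 i x) (X 1 i x)).
Proof.
have d0 := dm 0 i p; have d1 := dm 1 i p.
by rewrite /frame_energy; isD_eq; rewrite /energy_derivative; field.
Qed.

Lemma frame_bracket_lin p : lin (frame_bracket X x) p =
  lin (fun j => pd 0 (X 0 j) x) p * X 1 0 x - X 0 0 x * lin (fun j => pd 0 (X 1 j) x) p
  + (lin (fun j => pd 1 (X 0 j) x) p * X 1 1 x
     - X 0 1 x * lin (fun j => pd 1 (X 1 j) x) p).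
Proof.
rewrite /frame_bracket /lin.
move: (X 0 0 x) (X 0 1 x) (X 1 0 x) (X 1 1 x) (pd 0 (X 0 0) x) (pd 0 (X 0 1) x).
move: (pd 0 (X 1 0) x) (pd 0 (X 1 1) x) (pd 1 (X 0 0) x) (pd 1 (X 0 1) x).
by move: (pd 1 (X 1 0) x) (pd 1 (X 1 1) x) => *; ring.
Qed.

Lemma harmonic_frame_commutes (B : 'I_2 -> 'rV[R]_2 -> R) :
  (forall k, smooth_on U (B k)) ->
  (forall p, poisson (frame_harmonic X B) (frame_energy X mu) x p = 0) ->
  forall i, frame_bracket X x i = 0.
Proof.
move=> sB H; have dB k i := smooth_is_derive i (sB k) Ux.
have dF0 i p : is_derive x (delta_mx 0 i) (frame_harmonic X B ^~ p)
    (harmonic_derivative (frame_lin X 0 x p) (frame_lin X 1 x p) (B 0 x) (B 1 x)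
      (lin (fun j => pd i (X 0 j) x) p) (lin (fun j => pd i (X 1 j) x) p)
      (pd i (B 0) x) (pd i (B 1) x)).
  have d0 := dl 0 i p; have d1 := dl 1 i p; have c0 := dB 0 i; have c1 := dB 1 i.
  by rewrite /frame_harmonic /=; isD_eq; rewrite /harmonic_derivative; ring.
have dF1 i p : is_derive p (delta_mx 0 i) (frame_harmonic X B x)
    (harmonic_derivative (frame_lin X 0 x p) (frame_lin X 1 x p) (B 0 x) (B 1 x)
      (X 0 i x) (X 1 i x) 0 0).
  have d0 := dm 0 i p; have d1 := dm 1 i p.
  by rewrite /frame_harmonic /=; isD_eq; rewrite /harmonic_derivative; ring.
have [q qE] := bracket_quotient_quad (mu x) (pd 0 mu x) (pd 1 mu x) (B 0 x) (B 1 x)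
  (pd 0 (B 0) x) (pd 1 (B 0) x) (pd 0 (B 1) x) (pd 1 (B 1) x)
  (fun i => X 0 i x) (fun i => X 1 i x)
  (fun j => pd 0 (X 0 j) x) (fun j => pd 1 (X 0 j) x)
  (fun j => pd 0 (X 1 j) x) (fun j => pd 1 (X 1 j) x).
have m30 : 3 * mu x != 0 by rewrite mulf_neq0 ?pnatr_eq0.
apply: (@harmonic_cubic_coprime (fun k i => X k i x) D0 _ _ q m30) => p.
rewrite -(H p) (poisson_is_derive (dF0 0 p) (dF0 1 p) (dF1 0 p) (dF1 1 p)
  (dE0 0 p) (dE0 1 p) (dE1 0 p) (dE1 1 p)).
by rewrite bracket_identity_harmonic frame_bracket_lin -qE.
Qed.

Lemma killing_frame_commutes :
  (forall p, poisson (fun u q => frame_energy X mu u q * frame_lin X 0 u q)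
                     (frame_energy X mu) x p = 0) ->
  forall i, frame_bracket X x i = 0.
Proof.
move=> H.
have dF0 i p : is_derive x (delta_mx 0 i)
    (fun u => frame_energy X mu u p * frame_lin X 0 u p) _ :=
  is_derive_mulE (dE0 i p) (dl 0 i p).
have dF1 i p : is_derive p (delta_mx 0 i)
    (fun q => frame_energy X mu x q * frame_lin X 0 x q) _ :=
  is_derive_mulE (dE1 i p) (dm 0 i p).
pose c := (X 0 0 x * pd 0 mu x + X 0 1 x * pd 1 mu x) / 2.
apply: (@killing_coprime (fun k i => X k i x) D0 (mu x) c) => // p.
rewrite -(H p) (poisson_is_derive (dF0 0 p) (dF0 1 p) (dF1 0 p) (dF1 1 p)
  (dE0 0 p) (dE0 1 p) (dE1 0 p) (dE1 1 p)) frame_bracket_lin.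
exact/esym/bracket_identity_killing.
Qed.

End bracket.

End commuting_frames.

(** * Coordinates of a commuting frame *)

Section frame_coordinates.
Context {R : realType}.
Implicit Types (U V N : set 'rV[R]_2) (x y z p : 'rV[R]_2).
Implicit Types (X : 'I_2 -> 'I_2 -> 'rV[R]_2 -> R).

Lemma open_preimage_on {S T : topologicalType} (U : set S) (V : set T) (f : S -> T) :
  open U -> open V -> (forall x : S, U x -> {for x, continuous f}) ->
  open (U `&` f @^-1` V).
Proof.
move=> oU oV cf; rewrite openE => t [Ux Vx].
apply: filterI; first exact: open_nbhs_nbhs.
by apply: (cf _ Ux); exact: open_nbhs_nbhs.
Qed.

Lemma smooth_map_continuous U (psi : 'rV[R]_2 -> 'rV[R]_2) x :
  smooth_map_on U psi -> U x -> {for x, continuous psi}.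
Proof.
by move=> sp Ux; apply: (@continuous_map _ U) => j; exact: smooth_on_continuous (sp j) Ux.
Qed.

(** The inverse of the frame matrix: [i] indexes the differentials of the coordinates and [k] the
    dual forms. It is thus the Jacobian, in row convention, of the coordinates to be found. *)
Definition coframe X (i k : 'I_2) (u : 'rV[R]_2) : R :=
  (if i == 0 then if k == 0 then X 1 1 u else - X 0 1 u
   else if k == 0 then - X 1 0 u else X 0 0 u) / frame_det X u.

Lemma pd_quotient U (f g : 'rV[R]_2 -> R) i x : U x -> smooth_on U f -> smooth_on U g -> g x != 0 ->
  pd i (fun u => f u / g u) x = (pd i f x * g x - f x * pd i g x) / g x ^+ 2.
Proof.
move=> Ux sf sg g0.
have df := smooth_is_derive i sf Ux; have dg := smooth_is_derive i sg Ux.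
have dd := smooth_on_derivable (i := i) sg Ux.
have dV : is_derive x (delta_mx 0 i) (fun u => (g u)^-1) (- (g x ^- 2 * pd i g x)).
  by rewrite -(pdV g0 dd); apply: derivableP; exact: derivableV.
by apply: pd_is_derive; isD_eq; field.
Qed.

Section closed_coframe.
Variables (U : set 'rV[R]_2) (X : 'I_2 -> 'I_2 -> 'rV[R]_2 -> R).
Hypotheses (oU : open U) (sX : forall k i, smooth_on U (X k i)).
Hypotheses (D0 : forall u, U u -> frame_det X u != 0).

Lemma smooth_frame_det : smooth_on U (frame_det X).
Proof.
by apply: smooth_onB => //; apply: smooth_onM.
Qed.

Lemma smooth_coframe i k : smooth_on U (coframe X i k).
Proof.
have sV := smooth_onV oU D0 smooth_frame_det.
rewrite /coframe; case: (i == 0); case: (k == 0); apply: smooth_onM => //;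
  exact: smooth_onN.
Qed.

(** The exterior derivative of a dual form, evaluated on the two frame fields, is up to sign that
    form applied to their Lie bracket; the identities below are this formula in components. *)
Lemma coframe_closed k u : U u -> (forall i, frame_bracket X u i = 0) ->
  pd 1 (coframe X 0 k) u = pd 0 (coframe X 1 k) u.
Proof.
move=> Uu br; have Du := D0 Uu; have sD := smooth_frame_det.
have dX k' j i := smooth_is_derive i (sX k' j) Uu.
have dD i : pd i (frame_det X) u = pd i (X 0 0) u * X 1 1 u + X 0 0 u * pd i (X 1 1) u
    - (pd i (X 0 1) u * X 1 0 u + X 0 1 u * pd i (X 1 0) u).
  by apply: pd_is_derive; rewrite /frame_det; isD.
have sXN k' j : smooth_on U (fun u => - X k' j u) by exact: smooth_onN.
have dXN k' j i : pd i (fun u => - X k' j u) u = - pd i (X k' j) u.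
  by apply: pd_is_derive; isD.
have := br 0; have := br 1; rewrite /frame_bracket.
move: k; apply: ord2P; rewrite /coframe /=.
- rewrite (pd_quotient _ Uu (sX 1 1) sD Du) (pd_quotient _ Uu (sXN 1 0) sD Du) !dD !dXN.
  rewrite /frame_det in Du *; move: Du.
  move: (X 0 0 u) (X 0 1 u) (X 1 0 u) (X 1 1 u) (pd 0 (X 0 0) u) (pd 0 (X 0 1) u).
  move: (pd 0 (X 1 0) u) (pd 0 (X 1 1) u) (pd 1 (X 0 0) u) (pd 1 (X 0 1) u).
  move: (pd 1 (X 1 0) u) (pd 1 (X 1 1) u).
  move=> f10 f11 e10 e11 f00 f01 a b c d e00 e01 D B1 B0.
  apply/eqP; rewrite -subr_eq0; apply/eqP.
  transitivity ((c * (e01 * c - a * e11 + (f01 * d - b * f11))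
    - d * (e00 * c - a * e10 + (f00 * d - b * f10))) / (a * d - b * c) ^+ 2).
    by field.
  by rewrite B0 B1 !mulr0 subr0 mul0r.
- rewrite (pd_quotient _ Uu (sXN 0 1) sD Du) (pd_quotient _ Uu (sX 0 0) sD Du) !dD !dXN.
  rewrite /frame_det in Du *; move: Du.
  move: (X 0 0 u) (X 0 1 u) (X 1 0 u) (X 1 1 u) (pd 0 (X 0 0) u) (pd 0 (X 0 1) u).
  move: (pd 0 (X 1 0) u) (pd 0 (X 1 1) u) (pd 1 (X 0 0) u) (pd 1 (X 0 1) u).
  move: (pd 1 (X 1 0) u) (pd 1 (X 1 1) u).
  move=> f10 f11 e10 e11 f00 f01 a b c d e00 e01 D B1 B0.
  apply/eqP; rewrite -subr_eq0; apply/eqP.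
  transitivity ((b * (e00 * c - a * e10 + (f00 * d - b * f10))
    - a * (e01 * c - a * e11 + (f01 * d - b * f11))) / (a * d - b * c) ^+ 2).
    by field.
  by rewrite B0 B1 !mulr0 subr0 mul0r.
Qed.

Lemma coframe_dual k u p : U u ->
  frame_lin X k u (p *m (\matrix_(i, j) coframe X i j u)^T) = p 0 k.
Proof.
move=> Uu; have := D0 Uu.
rewrite /frame_lin /lin !mulmx_row2 !mxE /coframe /frame_det.
by move: k; apply: ord2P => /= D; field.
Qed.

End closed_coframe.

(* The exact coframe dual to a commuting frame integrates to coordinates in
   which the frame is the coordinate frame. *)
Lemma frame_coordinates U X x0 : open U -> (forall k i, smooth_on U (X k i)) ->
  (forall u, U u -> frame_det X u != 0) ->
  (forall u i, U u -> frame_bracket X u i = 0) -> U x0 ->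
  exists (N : set 'rV[R]_2) (psi phi : 'rV[R]_2 -> 'rV[R]_2) (rho : R),
  [/\ [/\ open N, N x0, N `<=` U & 0 < rho],
      psi @` N = ball (psi x0) rho, forall u, N u -> phi (psi u) = u,
      smooth_map_on N psi /\ smooth_map_on (ball (psi x0) rho) phi
    & forall u k p, N u -> frame_lin X k u (p *m ('J psi u)^T) = p 0 k].
Proof.
move=> oU sX D0 br Ux0.
have /nbhs_ballP[r' /= r'0 rU] := open_nbhs_nbhs (conj oU Ux0).
pose r := r' / 2; have rr' : 0 < r < r' by apply/andP; rewrite /r; split; lra.
have r0 : 0 < r by case/andP: rr'.
have sC i k := smooth_on_subset rU (smooth_coframe oU sX D0 i k).
have cl k u : ball x0 r' u -> pd 1 (coframe X 0 k) u = pd 0 (coframe X 1 k) u.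
  by move=> Bu; apply: (coframe_closed oU) => //; [exact: rU|move=> i; exact/br/rU].
have [f0 [sf0 df0]] := poincare rr' (sC 0 0) (sC 1 0) (cl 0).
have [f1 [sf1 df1]] := poincare rr' (sC 0 1) (sC 1 1) (cl 1).
pose psi u := pt (f0 u) (f1 u).
have psi0 : (fun u => psi u 0 0) = f0 by apply/funext => u; rewrite /psi pt0.
have psi1 : (fun u => psi u 0 1) = f1 by apply/funext => u; rewrite /psi pt1.
have oB : open (ball x0 r) by exact: ball_open.
have Bx0 : ball x0 r x0 by exact: ballxx.
have BU : ball x0 r `<=` U.
  by move=> u Bu; apply: rU; apply: le_ball Bu; case/andP: rr' => _ /ltW.
have sp : smooth_map_on (ball x0 r) psi.
  by apply: ord2P; rewrite ?psi0 ?psi1.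
have jE u : ball x0 r u -> jac psi u = \matrix_(i, j) coframe X i j u.
  move=> Bu; apply/matrixP => i j; rewrite !mxE; have [a0 a1] := df0 u Bu.
  have [c0 c1] := df1 u Bu.
  by move: i j; apply: ord2P; apply: ord2P; rewrite ?psi0 ?psi1.
have dual u k p : ball x0 r u -> frame_lin X k u (p *m (jac psi u)^T) = p 0 k.
  by move=> Bu; rewrite jE//; exact: (coframe_dual D0 k p (BU _ Bu)).
have d0 : \det (jac psi x0) != 0.
  rewrite jE// det_mx2 !mxE /coframe /=.
  have := D0 _ Ux0; rewrite /frame_det.
  move: (X 0 0 x0) (X 0 1 x0) (X 1 0 x0) (X 1 1 x0) => a b c d D.
  rewrite (_ : _ - _ = (a * d - b * c)^-1) ?invr_eq0//.
  by field.
have [N [phi [[oN oW] Nx NB phiK sphi]]] := inverse_function_theorem oB sp Bx0 d0.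
have Wx : (psi @` N) (psi x0) by exists x0.
have /nbhs_ballP[rho /= rho0 rhoW] := open_nbhs_nbhs (conj oW Wx).
(* The image is cut down to a ball so that the Poincare lemma is available again in the new
   coordinates. *)
exists (N `&` psi @^-1` ball (psi x0) rho), psi, phi, rho; split.
- split => //.
  + apply: open_preimage_on => //; first exact: ball_open.
    by move=> u Nu; apply: (smooth_map_continuous sp); exact: NB.
  + by split => //=; exact: ballxx.
  + by move=> u [/NB/BU].
- rewrite eqEsubset; split=> [_ [u [_ Bu] <-] //|v Bv].
  by have [u Nu uv] := rhoW _ Bv; exists u => //; split => //=; rewrite uv.
- by move=> u [/phiK].
- split=> j.
  + by apply: smooth_on_subset (sp j) => u [/NB].
  + exact: smooth_on_subset rhoW (sphi j).
- move=> u k p [Nu _]; rewrite (jacobian_smooth oB sp (NB _ Nu)).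
  exact: dual (NB _ Nu).
Qed.

End frame_coordinates.

Ltac smooth_on oU :=
  lazymatch goal with
  | |- smooth_on ?U (fun u => GRing.add (@?f u) (@?g u)) =>
      refine (@smooth_onD _ U f g oU _ _); smooth_on oU
  | |- smooth_on ?U (fun u => GRing.opp (@?f u)) =>
      refine (@smooth_onN _ U f oU _); smooth_on oU
  | |- smooth_on ?U (fun u => GRing.mul (@?f u) (@?g u)) =>
      refine (@smooth_onM _ U f g oU _ _); smooth_on oU
  | |- smooth_on ?U (fun u => GRing.exp (@?f u) ?n) =>
      refine (@smooth_onX _ U f n oU _); smooth_on oU
  | |- smooth_on ?U (fun _ => ?c) => exact (@smooth_on_cst _ U c)
  | |- _ => first [assumption | match goal with D : _ |- _ => exact (D _) end
                  | idtac]
  end.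

(** * Frames adapted to the cubic form *)

Section adapted_frame.
Context {R : realType}.
Implicit Types (U V N : set 'rV[R]_2) (x y z p : 'rV[R]_2).
Implicit Types (X : 'I_2 -> 'I_2 -> 'rV[R]_2 -> R).

Lemma complex_cube_root (a b : R) : exists u v : R,
  u ^+ 3 - 3 * u * v ^+ 2 = a /\ 3 * u ^+ 2 * v - v ^+ 3 = b.
Proof.
pose z : complex R := Complex a b.
have := rootCK (isT : (0 < 3)%N) z.
case: (3.-root z)%C => u v; rewrite !exprS expr0 mulr1.
move=> /eqP; rewrite eq_complex /= => /andP[/eqP <- /eqP <-].
by exists u, v; split; ring.
Qed.

Lemma smooth_on_coord U k : smooth_on U (fun u : 'rV[R]_2 => u 0 k).
Proof.
have D i x := is_derive_coord k i x.
apply: smooth_on_intro => [x _|i x _|i]; first exact: coord_continuous.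
  by case: (D i x).
have -> : pd i (fun u : 'rV[R]_2 => u 0 k) = fun=> (i == k)%:R.
  by apply/funext => x; exact: pd_is_derive.
exact: smooth_on_cst.
Qed.

Lemma smooth_map_pt U (a b : 'rV[R]_2 -> R) : smooth_on U a -> smooth_on U b ->
  smooth_map_on U (fun u => pt (a u) (b u)).
Proof.
move=> sa sb; apply: ord2P.
- by rewrite (_ : (fun _ => _) = a)//; apply/funext => u; rewrite pt0.
- by rewrite (_ : (fun _ => _) = b)//; apply/funext => u; rewrite pt1.
Qed.

(** The map [w |-> w^3] has Jacobian determinant [9 |w|^4], so the inverse function theorem provides
    a smooth branch of its inverse near any nonzero value. *)
Lemma smooth_cube_root U (a b : 'rV[R]_2 -> R) x0 : open U ->
  smooth_on U a -> smooth_on U b -> U x0 -> a x0 ^+ 2 + b x0 ^+ 2 != 0 ->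
  exists V (u v : 'rV[R]_2 -> R), [/\ open V, V x0, V `<=` U,
    smooth_on V u /\ smooth_on V v & forall x, V x ->
      [/\ u x ^+ 3 - 3 * u x * v x ^+ 2 = a x, 3 * u x ^+ 2 * v x - v x ^+ 3 = b x
        & u x ^+ 2 + v x ^+ 2 != 0]].
Proof.
move=> oU sa sb Ux0 ab0.
pose c0 (w : 'rV[R]_2) := w 0 0 ^+ 3 - 3 * w 0 0 * w 0 1 ^+ 2.
pose c1 (w : 'rV[R]_2) := 3 * w 0 0 ^+ 2 * w 0 1 - w 0 1 ^+ 3.
pose C w := pt (c0 w) (c1 w).
have oT : open ([set: 'rV[R]_2]) by exact: openT.
have sw k : smooth_on setT (fun w : 'rV[R]_2 => w 0 k) := smooth_on_coord setT k.
have sC : smooth_map_on setT C.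
  by apply: smooth_map_pt; rewrite /c0 /c1; smooth_on oT.
have [u0 [v0 [E0 E1]]] := complex_cube_root (a x0) (b x0).
have C0 : C (pt u0 v0) = pt (a x0) (b x0) by rewrite /C /c0 /c1 !pt0 !pt1 E0 E1.
have D0 k i w := is_derive_coord k i w : is_derive _ _ (fun w : 'rV[R]_2 => w 0 k) _.
have uv0 : u0 ^+ 2 + v0 ^+ 2 != 0.
  apply: contra_neq ab0 => uv; rewrite -E0 -E1.
  transitivity ((u0 ^+ 2 + v0 ^+ 2) ^+ 3); first by ring.
  by rewrite uv expr0n.
have dC : \det (jac C (pt u0 v0)) != 0.
  have P0 i w : pd i (fun u => C u 0 0) w =
      (3 * w 0 0 ^+ 2 - 3 * w 0 1 ^+ 2) * (i == 0)%:R - 6 * w 0 0 * w 0 1 * (i == 1)%:R.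
    rewrite (_ : (fun u => _) = fun w : 'rV[R]_2 =>
      w 0 0 * w 0 0 * w 0 0 - 3 * w 0 0 * (w 0 1 * w 0 1)).
      by apply: pd_is_derive; isD_eq; ring.
    by apply/funext => u; rewrite /C pt0 /c0; ring.
  have P1 i w : pd i (fun u => C u 0 1) w =
      6 * w 0 0 * w 0 1 * (i == 0)%:R + (3 * w 0 0 ^+ 2 - 3 * w 0 1 ^+ 2) * (i == 1)%:R.
    rewrite (_ : (fun u => _) = fun w : 'rV[R]_2 =>
      3 * (w 0 0 * w 0 0) * w 0 1 - w 0 1 * w 0 1 * w 0 1).
      by apply: pd_is_derive; isD_eq; ring.
    by apply/funext => u; rewrite /C pt1 /c1; ring.
  rewrite det_mx2 !mxE !P0 !P1 !pt0 !pt1 /=.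
  rewrite (_ : _ - _ = 9 * (u0 ^+ 2 + v0 ^+ 2) ^+ 2); last by ring.
  by rewrite mulf_neq0 ?expf_neq0 ?pnatr_eq0.
have [N [phi [[oN oW] Nw _ phiK sphi]]] :=
  inverse_function_theorem oT sC (I : setT (pt u0 v0)) dC.
pose psi x := pt (a x) (b x).
have spsi : smooth_map_on U psi by exact: smooth_map_pt.
pose n x := a x ^+ 2 + b x ^+ 2.
have sn : smooth_on U n by rewrite /n; smooth_on oU.
pose V := (U `&` psi @^-1` (C @` N)) `&` (U `&` n @^-1` [set r | r != 0]).
have oV : open V.
  apply: openI; apply: open_preimage_on => //.
  - by move=> x; exact: smooth_map_continuous.
  - by move=> x; exact: smooth_on_continuous.
have VU : V `<=` U by move=> x [[]].
have VW x : V x -> (C @` N) (psi x) by move=> [[]].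
exists V, (fun x => phi (psi x) 0 0), (fun x => phi (psi x) 0 1); split => //.
- by split; split => //=; exists (pt u0 v0).
- have spV : smooth_map_on V psi by move=> j; exact: smooth_on_subset VU (spsi j).
  split; [exact: (smooth_on_comp (f := fun y => phi y 0 0) oV oW VW (sphi 0) spV)|].
  exact: (smooth_on_comp (f := fun y => phi y 0 1) oV oW VW (sphi 1) spV).
- move=> x Vx; have [w Nw' wx] := VW x Vx.
  have Ew : phi (psi x) = w by rewrite -wx phiK.
  have F0 : c0 w = a x by rewrite -[LHS](pt0 (c0 w) (c1 w)) -/(C w) wx pt0.
  have F1 : c1 w = b x by rewrite -[LHS](pt1 (c0 w) (c1 w)) -/(C w) wx pt1.
  rewrite Ew; split => //.
  have [_ [_]] := Vx; rewrite /preimage /= /n -F0 -F1.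
  apply: contra_neq => uv; transitivity ((w 0 0 ^+ 2 + w 0 1 ^+ 2) ^+ 3).
    by rewrite /c0 /c1; ring.
  by rewrite uv expr0n.
Qed.

(* With [m = (al p0 + be p1, s p1)] the energy is [|m|^2 / (2 al)]; [ia], [si]
   stand for the inverses of [al], [s]. *)
Definition ortho_coef (k : 'I_4 -> R) (ia be si : R) (j : 'I_4) : R :=
  if j == 0 then k 0 * ia ^+ 3
  else if j == 1 then - 3 * k 0 * be * ia ^+ 3 * si + k 1 * ia ^+ 2 * si
  else if j == 2 then 3 * k 0 * be ^+ 2 * si ^+ 2 * ia ^+ 3
    - 2 * k 1 * be * ia ^+ 2 * si ^+ 2 + k 2 * ia * si ^+ 2
  else - k 0 * be ^+ 3 * si ^+ 3 * ia ^+ 3 + k 1 * be ^+ 2 * ia ^+ 2 * si ^+ 3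
    - k 2 * be * ia * si ^+ 3 + k 3 * si ^+ 3.

Lemma ortho_coefP (k : 'I_4 -> R) (al be s a b : R) : al != 0 -> s != 0 ->
  cub k (pt a b) = cub (ortho_coef k al^-1 be s^-1) (pt (al * a + be * b) (s * b)).
Proof.
move=> al0 s0; rewrite /cub /ortho_coef !pt0 !pt1 /=.
by move: (k 0) (k 1) (k 2) (k 3) => *; field; rewrite al0 s0.
Qed.

Lemma ortho_coef_neq0 (k : 'I_4 -> R) (al be s : R) : al != 0 -> s != 0 ->
  (exists i, k i != 0) -> exists i, ortho_coef k al^-1 be s^-1 i != 0.
Proof.
move=> al0 s0 [i ki]; apply: contrapT => H.
have c0 j : ortho_coef k al^-1 be s^-1 j = 0.
  by apply/eqP/negPn/negP => Hj; apply: H; exists j.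
have k0 : forall p, cub k p = cub (fun=> 0) p.
  move=> p; rewrite (ptE p) (ortho_coefP _ be _ _ al0 s0).
  by rewrite /cub !c0 !mul0r.
by move: ki; rewrite (cub_inj k0) eqxx.
Qed.

Lemma smooth_ortho_coef U (k : 'I_4 -> 'rV[R]_2 -> R) (ia be si : 'rV[R]_2 -> R) j :
  open U -> (forall i, smooth_on U (k i)) -> smooth_on U ia -> smooth_on U be ->
  smooth_on U si -> smooth_on U (fun u => ortho_coef (k ^~ u) (ia u) (be u) (si u) j).
Proof.
move=> oU sk sa sb ss; rewrite /ortho_coef.
by case: (j == 0); [|case: (j == 1); [|case: (j == 2)]]; smooth_on oU.
Qed.

(** The four-dimensional space of binary cubics is the sum of the harmonic ones, spanned by
    [Re (a + i b)^3] and [Im (a + i b)^3], and of the multiples of [a^2 + b^2]. *)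
Lemma cub_trace_decomposition (c : 'I_4 -> R) (a b : R) : cub c (pt a b) =
  (c 0 - c 2) / 4 * (a ^+ 3 - 3 * a * b ^+ 2) + (c 1 - c 3) / 4 * (3 * a ^+ 2 * b - b ^+ 3)
  + (a ^+ 2 + b ^+ 2) * ((3 * c 0 + c 2) / 4 * a + (c 1 + 3 * c 3) / 4 * b).
Proof. by rewrite /cub !pt0 !pt1; field. Qed.

(* [Re ((A1 - i A2) z^3) = Re ((w z)^3)] for [w = u + i v] with
   [w^3 = A1 - i A2]. *)
Lemma cube_root_substitution (A1 A2 B1 B2 u v a b : R) :
  u ^+ 3 - 3 * u * v ^+ 2 = A1 -> 3 * u ^+ 2 * v - v ^+ 3 = - A2 ->
  u ^+ 2 + v ^+ 2 != 0 ->
  let l0 := u * a - v * b in let l1 := v * a + u * b in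
  let n := u ^+ 2 + v ^+ 2 in
  A1 * (a ^+ 3 - 3 * a * b ^+ 2) + A2 * (3 * a ^+ 2 * b - b ^+ 3)
  + (a ^+ 2 + b ^+ 2) * (B1 * a + B2 * b) =
  l0 * l0 * l0 - 3 * (l0 * l1 * l1) + (l0 * l0 + l1 * l1) *
    ((B1 * u - B2 * v) / n ^+ 2 * l0 + (B1 * v + B2 * u) / n ^+ 2 * l1).
Proof.
move=> <- /esym/eqP; rewrite eqr_oppLR => /eqP -> n0 /=.
by field.
Qed.

End adapted_frame.

Section adapted_frame_existence.
Context {R : realType}.
Implicit Types (U V N O : set 'rV[R]_2) (x y z p : 'rV[R]_2).
Implicit Types (X : 'I_2 -> 'I_2 -> 'rV[R]_2 -> R).

Definition frame2 (a b c d : 'rV[R]_2 -> R) (k i : 'I_2) : 'rV[R]_2 -> R :=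
  if k == 0 then if i == 0 then a else b else if i == 0 then c else d.

Lemma smooth_frame2 U a b c d k i : smooth_on U a -> smooth_on U b ->
  smooth_on U c -> smooth_on U d -> smooth_on U (frame2 a b c d k i).
Proof. by rewrite /frame2; case: (k == 0); case: (i == 0). Qed.

(* Around some point near [x0] either the trace-free part of the cubic form
   does not vanish, and its cube root is a conformal frame, or it vanishes
   identically and the form is the product of the energy with a linear form. *)
Lemma adapted_frame U g (k : 'I_4 -> 'rV[R]_2 -> R) O x0 : open U ->
  riemannian_on U g -> (forall i, smooth_on U (k i)) ->
  U `<=` closure [set x | exists i, k i x != 0] -> open O -> O x0 -> U x0 ->
  exists x1 V X mu,
  [/\ [/\ open V, V x1, V `<=` U & V `<=` O],
      (forall k i, smooth_on V (X k i)) /\ smooth_on V mu,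
      forall u, V u -> frame_det X u != 0 /\ mu u != 0,
      forall u p, V u -> hamiltonian g u p = frame_energy X mu u p
    & (exists2 B : 'I_2 -> 'rV[R]_2 -> R, forall k, smooth_on V (B k) &
        forall u p, V u -> cub (k ^~ u) p = frame_harmonic X B u p) \/
      (forall u p, V u ->
        cub (k ^~ u) p = frame_energy X mu u p * frame_lin X 0 u p)].
Proof.
move=> oU rg sk kd oO Ox0 Ux0.
(* The square is completed in the energy; [de] is the determinant of the inverse metric, so its root
   [s] is positive and smooth. *)
pose al u := invmx (g u) 0 0; pose be u := invmx (g u) 0 1.
pose de u := al u * invmx (g u) 1 1 - be u ^+ 2; pose s u := Num.sqrt (de u).
have gE u p : U u -> hamiltonian g u p =
    ((al u * p 0 0 + be u * p 0 1) ^+ 2 + (s u * p 0 1) ^+ 2) / (2 * al u).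
  move=> Uu; have [_ G01 G0 dG] := riemannian_inverse rg Uu.
  rewrite hamiltonianE /quad /hcoef /= -G01 -/(al u) -/(be u).
  rewrite exprMn sqr_sqrtr ?ltW// /de -/(al u).
  by field; rewrite gt_eqF.
have al0 u : U u -> al u != 0.
  by move=> Uu; have [_ _ G0 _] := riemannian_inverse rg Uu; rewrite gt_eqF.
have de0 u : U u -> 0 < de u by move=> Uu; have [] := riemannian_inverse rg Uu.
have s0 u : U u -> s u != 0 by move=> Uu; rewrite gt_eqF// sqrtr_gt0 de0.
have sG : forall i j, smooth_on U (fun x => invmx (g x) i j).
  have [sg _] := rg.
  by apply: smooth_invmx => // x Ux; have [] := riemannian_inverse rg Ux.
have sal : smooth_on U al := sG 0 0.
have sbe : smooth_on U be := sG 0 1.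
have sde : smooth_on U de by rewrite /de; smooth_on oU.
have ss : smooth_on U s := smooth_on_sqrt oU de0 sde.
have sia : smooth_on U (fun u => (al u)^-1) := smooth_onV oU al0 sal.
have ssi : smooth_on U (fun u => (s u)^-1) := smooth_onV oU s0 ss.
pose c j u := ortho_coef (k ^~ u) (al u)^-1 (be u) (s u)^-1 j.
have sc j : smooth_on U (c j) := smooth_ortho_coef j oU sk sia sbe ssi.
pose m0 u (p : 'rV[R]_2) := al u * p 0 0 + be u * p 0 1.
pose m1 u (p : 'rV[R]_2) := s u * p 0 1.
pose A1 u := (c 0 u - c 2 u) / 4; pose A2 u := (c 1 u - c 3 u) / 4.
pose B1 u := (3 * c 0 u + c 2 u) / 4; pose B2 u := (c 1 u + 3 * c 3 u) / 4.
have sA1 : smooth_on U A1 by rewrite /A1; smooth_on oU.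
have sA2 : smooth_on U A2 by rewrite /A2; smooth_on oU.
have sB1 : smooth_on U B1 by rewrite /B1; smooth_on oU.
have sB2 : smooth_on U B2 by rewrite /B2; smooth_on oU.
have kE u p : U u -> cub (k ^~ u) p = A1 u * (m0 u p ^+ 3 - 3 * m0 u p * m1 u p ^+ 2)
    + A2 u * (3 * m0 u p ^+ 2 * m1 u p - m1 u p ^+ 3)
    + (m0 u p ^+ 2 + m1 u p ^+ 2) * (B1 u * m0 u p + B2 u * m1 u p).
  move=> Uu; rewrite {1}(ptE p) (ortho_coefP _ (be u) _ _ (al0 u Uu) (s0 u Uu)).
  exact: cub_trace_decomposition.
have c0 u : U u -> A1 u = 0 -> A2 u = 0 -> B1 u = 0 -> B2 u = 0 ->
    ~ exists i, k i u != 0.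
  move=> Uu a1 a2 b1 b2 ke.
  case: (ortho_coef_neq0 (be u) (al0 u Uu) (s0 u Uu) ke) => i.
  apply/negP; rewrite negbK; apply/eqP; rewrite -/(c i u).
  rewrite /A1 /A2 /B1 /B2 in a1 a2 b1 b2; clear ke.
  by move: i; apply: ord4P; lra.
clearbody A1 A2 B1 B2.
have oUO : open (U `&` O) by exact: openI.
have [[x1 [[Ux1 Ox1] A0]]|noA] :=
    pselect (exists x1, (U `&` O) x1 /\ A1 x1 ^+ 2 + A2 x1 ^+ 2 != 0).
- have UOU : U `&` O `<=` U by move=> x [].
  have sA2N : smooth_on U (fun u => - A2 u) by exact: smooth_onN.
  have A0' : A1 x1 ^+ 2 + (- A2 x1) ^+ 2 != 0 by rewrite sqrrN.
  have [V [u [v [oV Vx1 VUO [su sv] uvE]]]] := smooth_cube_root oUO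
    (smooth_on_subset UOU sA1) (smooth_on_subset UOU sA2N) (conj Ux1 Ox1) A0'.
  have VU : V `<=` U by move=> x /VUO[].
  pose n w := u w ^+ 2 + v w ^+ 2.
  have n0 w : V w -> n w != 0 by move=> /uvE[].
  have sn : smooth_on V n by rewrite /n; smooth_on oV.
  have sal' := smooth_on_subset VU sal; have sbe' := smooth_on_subset VU sbe.
  have ss' := smooth_on_subset VU ss; have sB1' := smooth_on_subset VU sB1.
  have sB2' := smooth_on_subset VU sB2; have sia' := smooth_on_subset VU sia.
  have sin : smooth_on V (fun w => (n w)^-1) := smooth_onV oV n0 sn.
  (* The two forms are the real and imaginary parts of [(u + i v) (m0 + i m1)]. This multiplies
     [m0^2 + m1^2] by [n], which gives [mu = 1 / (al n)]. *)
  exists x1, V, (frame2 (fun w => u w * al w) (fun w => u w * be w - v w * s w)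
      (fun w => v w * al w) (fun w => v w * be w + u w * s w)),
    (fun w => (al w)^-1 * (n w)^-1); split.
  + by split => // x /VUO[].
  + by split=> [j i|]; [apply: smooth_frame2|]; smooth_on oV.
  + move=> w Vw; rewrite /frame_det /frame2 /=; split; last first.
      by rewrite mulf_neq0 ?invr_eq0 ?al0 ?n0//; exact: VU.
    rewrite (_ : _ - _ = al w * s w * n w); last by rewrite /n; ring.
    by rewrite !mulf_neq0 ?n0 ?al0 ?s0//; exact: VU.
  + move=> w p Vw; rewrite gE; last exact: VU.
    have nw := n0 w Vw; have aw := al0 w (VU _ Vw); rewrite /n in nw *.
    rewrite /frame_energy /frame_lin /lin /frame2 /=.
    by move: (p 0 0) (p 0 1) => q r; field; rewrite aw nw.
  + left; exists (fun j w => if j == 0 then (B1 w * u w - B2 w * v w) * (n w)^-1 ^+ 2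
      else (B1 w * v w + B2 w * u w) * (n w)^-1 ^+ 2).
      by move=> j; case: (j == 0); smooth_on oV.
    move=> w p Vw; have [e0 e1 nw] := uvE w Vw.
    rewrite kE; last exact: VU.
    rewrite (cube_root_substitution _ _ _ _ e0 e1 nw) /frame_harmonic /=.
    have -> : frame_lin (frame2 (fun w => u w * al w) (fun w => u w * be w - v w * s w)
      (fun w => v w * al w) (fun w => v w * be w + u w * s w)) 0 w p =
      u w * m0 w p - v w * m1 w p.
      by rewrite /frame_lin /lin /frame2 /= /m0 /m1; ring.
    have -> : frame_lin (frame2 (fun w => u w * al w) (fun w => u w * be w - v w * s w)
      (fun w => v w * al w) (fun w => v w * be w + u w * s w)) 1 w p =
      v w * m0 w p + u w * m1 w p.
      by rewrite /frame_lin /lin /frame2 /= /m0 /m1; ring.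
    by rewrite exprVn.
have A00 u : (U `&` O) u -> A1 u = 0 /\ A2 u = 0.
  move=> UOu; have [/eqP|A] := eqVneq (A1 u ^+ 2 + A2 u ^+ 2) 0; last first.
    by exfalso; apply: noA; exists u.
  by rewrite paddr_eq0 ?sqr_ge0// !sqrf_eq0 => /andP[/eqP -> /eqP ->].
pose n u := B1 u ^+ 2 + B2 u ^+ 2.
have sn : smooth_on U n by rewrite /n; smooth_on oU.
(* Without trace-free part, the linear factor is nonzero wherever the cubic form is; density of such
   points provides [x1]. *)
have [x1 [kx1 [Ux1 Ox1]]] := kd x0 Ux0 (U `&` O) (open_nbhs_nbhs (conj oUO (conj Ux0 Ox0))).
have [a1 a2] := A00 x1 (conj Ux1 Ox1).
pose V := (U `&` O) `&` n @^-1` [set r | r != 0].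
have VU : V `<=` U by move=> x [[]].
have oV : open V.
  apply: open_preimage_on => // x [Ux _].
  exact: (smooth_on_continuous sn Ux).
have n0 w : V w -> n w != 0 by case.
have Vx1 : V x1.
  split; first by split.
  rewrite /preimage /=; apply/eqP => /eqP.
  rewrite /n paddr_eq0 ?sqr_ge0// !sqrf_eq0 => /andP[/eqP b1 /eqP b2].
  exact: (c0 x1 Ux1 a1 a2 b1 b2 kx1).
have sn' := smooth_on_subset VU sn.
have sal' := smooth_on_subset VU sal; have sbe' := smooth_on_subset VU sbe.
have ss' := smooth_on_subset VU ss; have sB1' := smooth_on_subset VU sB1.
have sB2' := smooth_on_subset VU sB2; have sia' := smooth_on_subset VU sia.
have sin : smooth_on V (fun w => (n w)^-1) := smooth_onV oV n0 sn'.
(* The first form is [2 al (B1 m0 + B2 m1)], whose product with the energy is the cubic form; the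
   second is its rotation by a right angle. The sum of their squares is [4 al^2 n (m0^2 + m1^2)],
   whence [mu]. *)
exists x1, V, (frame2 (fun w => 2 * al w * (B1 w * al w))
  (fun w => 2 * al w * (B1 w * be w + B2 w * s w))
  (fun w => - 2 * al w * (B2 w * al w))
  (fun w => 2 * al w * (B1 w * s w - B2 w * be w))),
  (fun w => 4^-1 * (al w)^-1 ^+ 3 * (n w)^-1); split.
- by split => // x [[]].
- by split=> [j i|]; [apply: smooth_frame2|]; smooth_on oV.
- move=> w Vw; rewrite /frame_det /frame2 /=; split; last first.
    rewrite !mulf_neq0 ?expf_neq0 ?invr_eq0 ?al0 ?n0 ?pnatr_eq0//; exact: VU.
  rewrite (_ : _ - _ = 4 * al w ^+ 3 * s w * n w); last by rewrite /n; ring.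
  by rewrite !mulf_neq0 ?expf_neq0 ?n0 ?al0 ?s0 ?pnatr_eq0//; exact: VU.
- move=> w p Vw; rewrite gE; last exact: VU.
  have nw := n0 w Vw; have aw := al0 w (VU _ Vw); rewrite /n in nw *.
  rewrite /frame_energy /frame_lin /lin /frame2 /=.
  by move: (p 0 0) (p 0 1) => q r; field; rewrite aw nw.
- right=> w p Vw; have [e1 e2] := A00 w (Vw.1).
  rewrite kE; last exact: VU.
  have nw := n0 w Vw; have aw := al0 w (VU _ Vw); rewrite /n in nw *.
  rewrite e1 e2 /frame_energy /frame_lin /lin /frame2 /= /m0 /m1.
  by move: (p 0 0) (p 0 1) => q r; field; rewrite aw nw.
Qed.

End adapted_frame_existence.

(** * Charts of the surface *)

Section chart_changes.
Context {R : realType} {M : topologicalType}.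
Implicit Types (c d : chart R M) (A : set (chart R M)).
Implicit Types (U V N : set 'rV[R]_2) (u w p : 'rV[R]_2).

Lemma chart_continuous c x : is_chart c -> cdom c x -> {for x, continuous (cmap c)}.
Proof.
move=> [oc _ _ cc _] cx; move: cc; rewrite continuous_open_subspace// => cc.
by apply: cc; rewrite inE.
Qed.

Lemma chart_inv_continuous c u : is_chart c -> cimg c u -> {for u, continuous (cinv c)}.
Proof.
move=> [_ oc _ _ cc] cu; move: cc; rewrite continuous_open_subspace// => cc.
by apply: cc; rewrite inE.
Qed.

Lemma chart_invK c u : is_chart c -> cimg c u -> cdom c (cinv c u) /\ cmap c (cinv c u) = u.
Proof. by move=> [_ _ K _ _] [x cx <-]; rewrite K. Qed.

Lemma open_chart_image c (O : set M) : is_chart c -> open O ->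
  open (cmap c @` (cdom c `&` O)).
Proof.
move=> hc oO; have [_ oc K _ _] := hc.
rewrite (_ : _ @` _ = cimg c `&` cinv c @^-1` O).
  by apply: open_preimage_on => // u cu; exact: chart_inv_continuous.
rewrite eqEsubset; split=> [_ [x [cx Ox] <-]|u [[x cx <-]]].
  by split; [exists x|rewrite /preimage /= K].
by rewrite /preimage /= K// => Ox; exists x.
Qed.

Lemma open_overlap c d : is_chart c -> is_chart d -> open (overlap c d).
Proof. by move=> hc [od _ _ _ _]; exact: open_chart_image. Qed.

Definition new_chart c N (psi phi : 'rV[R]_2 -> 'rV[R]_2) : chart R M :=
  Chart (cdom c `&` cmap c @^-1` N) (psi \o cmap c) (cinv c \o phi).

Section new_chart.
Variables (A : set (chart R M)) (c : chart R M) (N : set 'rV[R]_2).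
Variables (psi phi : 'rV[R]_2 -> 'rV[R]_2).
Hypotheses (hA : maximal_atlas A) (Ac : A c).
Hypotheses (oN : open N) (Nc : N `<=` cimg c) (oW : open (psi @` N)).
Hypotheses (phiK : forall u, N u -> phi (psi u) = u).
Hypotheses (spsi : smooth_map_on N psi) (sphi : smooth_map_on (psi @` N) phi).

Let c' := new_chart c N psi phi.

Let hc : is_chart c. Proof. by have [H _ _ _] := hA; exact: H. Qed.

Lemma new_chart_image : cimg c' = psi @` N.
Proof.
rewrite eqEsubset; split=> [_ [x [cx Nx] <-]|_ [u Nu <-]]; first by exists (cmap c x).
have [cx xu] := chart_invK hc (Nc Nu); by exists (cinv c u); rewrite /= ?xu.
Qed.

Lemma new_chart_is_chart : is_chart c'.
Proof.
have [oc _ K _ _] := hc.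
have oD : open (cdom c').
  by apply: open_preimage_on => // x cx; exact: chart_continuous.
have oI : open (cimg c') by rewrite new_chart_image.
split => //.
- by move=> x [cx Nx]; rewrite /= phiK// K.
- rewrite continuous_open_subspace// => x /set_mem [cx Nx].
  apply: continuous_comp; first exact: chart_continuous.
  exact: smooth_map_continuous spsi Nx.
- rewrite continuous_open_subspace// => w /set_mem.
  rewrite new_chart_image => -[u Nu uw].
  have Ww : (psi @` N) w by exists u.
  apply: continuous_comp; first exact: smooth_map_continuous sphi Ww.
  by apply: chart_inv_continuous => //; apply: Nc; rewrite -uw phiK.
Qed.

Lemma new_chart_compatible d : A d -> compatible c' d.
Proof.
move=> Ad; have [H _ comp _] := hA; have hd := H _ Ad; have hc' := new_chart_is_chart.
have [_ _ K _ _] := hc; have [s1 s2] := comp _ _ Ac Ad.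
have oc'd := open_overlap hc' hd; have odc' := open_overlap hd hc'.
have ocd := open_overlap hc hd; have odc := open_overlap hd hc.
split=> j.
- have := @smooth_on_comp R (overlap c' d) (overlap c d)
    (fun u => transition c d u 0 j) phi oc'd ocd.
  apply; last 2 first.
  + exact: s1.
  + move=> i; apply: smooth_on_subset (sphi i).
    by move=> _ [x [[cx Nx] dx] <-]; exists (cmap c x).
  + by move=> _ [x [[cx Nx] dx] <-]; rewrite /= phiK//; exists x.
- have := @smooth_on_comp R (overlap d c') N
    (fun u => psi u 0 j) (transition d c) odc' oN.
  apply; last 2 first.
  + exact: spsi.
  + move=> i; apply: smooth_on_subset (s2 i).
    by move=> _ [x [dx [cx Nx]] <-]; exists x.
  + have [_ _ Kd _ _] := hd.
    by move=> _ [x [dx [cx Nx]] <-]; rewrite /transition /= Kd.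
Qed.

(** Maximality of the atlas is what turns the coordinates constructed here into charts in which [g]
    and [F] are given. *)
Lemma new_chart_atlas : A c'.
Proof.
have [_ _ _ maxA] := hA; apply: maxA; first exact: new_chart_is_chart.
exact: new_chart_compatible.
Qed.

Lemma new_chart_transition u : N u ->
  [/\ overlap c c' u, transition c c' u = psi u & 'J (transition c c') u = 'J psi u].
Proof.
move=> Nu; have hc' := new_chart_is_chart.
have ov v : N v -> overlap c c' v.
  move=> Nv; have [cx xv] := chart_invK hc (Nc Nv).
  by exists (cinv c v) => //; split => //; split => //; rewrite /preimage /= xv.
have tE v : N v -> transition c c' v = psi v.
  by move=> Nv; have [cx xv] := chart_invK hc (Nc Nv); rewrite /transition /= xv.
split; [exact: ov|exact: tE|].
have st : smooth_map_on N (transition c c').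
  move=> j; apply: smooth_on_eq oN _ (spsi j) => v Nv.
  by rewrite tE.
rewrite (jacobian_smooth oN st Nu) (jacobian_smooth oN spsi Nu).
apply/matrixP => i j; rewrite !mxE.
by apply: (pd_eq_on _ oN Nu) => v Nv; rewrite tE.
Qed.

End new_chart.

Lemma hamiltonian_pullback (g g' J : 'M[R]_2) (p : 'rV[R]_2) : g \in unitmx ->
  g = J *m g' *m J^T ->
  (p *m J^T *m invmx g *m (p *m J^T)^T) 0 0 = (p *m invmx g' *m p^T) 0 0.
Proof.
move=> ug gE; move: (ug); rewrite gE !unitmx_mul => /andP[/andP[uJ ug'] uJT].
rewrite trmx_mul trmxK !mulmxA.
have E : invmx (J *m g' *m J^T) = invmx J^T *m invmx g' *m invmx J.
  have ug2 : J *m g' *m J^T \in unitmx by rewrite -gE.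
  apply: (can_inj (mulKmx ug2)).
  by rewrite (mulmxV ug2) !mulmxA (mulmxK uJT) (mulmxK ug') (mulmxV uJ).
by rewrite E !mulmxA (mulmxK uJT) (mulmxKV uJ).
Qed.

Lemma conformal_metric U g w m : riemannian_on U g -> U w ->
  (forall p, hamiltonian g w p = m / 2 * (p 0 0 * p 0 0 + p 0 1 * p 0 1)) ->
  g w = (m^-1)%:M.
Proof.
move=> rg Uw H; have [dg G01 _ _] := riemannian_inverse rg Uw.
have E1 := H (pt 1 0); have E2 := H (pt 0 1); have E3 := H (pt 1 1).
rewrite /hamiltonian !quadform_row !pt0 !pt1 in E1 E2 E3.
have G0 : invmx (g w) 0 0 = m by lra.
have G1 : invmx (g w) 1 1 = m by lra.
have G : invmx (g w) 0 1 = 0 by lra.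
rewrite -[LHS]invmxK -invmx_scalar; congr invmx.
apply/matrixP; apply: ord2P; apply: ord2P; rewrite [RHS]mxE /= ?mulr1n ?mulr0n //.
by rewrite -G01.
Qed.

End chart_changes.

(** * The potential in a conformal chart *)

Section conformal_chart_potential.
Context {R : realType}.
Implicit Types (U : set 'rV[R]_2) (g : 'rV[R]_2 -> 'M[R]_2) (w p : 'rV[R]_2).

(** The cubic form is the energy times [p0], so its bracket with the energy is minus the energy
    times the derivative of the energy in the first coordinate. At the momentum [(1, 0)] this is a
    nonzero multiple of that derivative of [lam]. *)
Lemma killing_conformal U (lam : 'rV[R]_2 -> R) w : open U -> smooth_on U lam ->
  (forall u, U u -> lam u != 0) -> U w ->
  (forall p, poisson
     (fun u => cub (fun j => if (j == 0) || (j == 2) then (2 * lam u)^-1 else 0))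
     (fun u => quad (conformal_h lam ^~ u)) w p = 0) ->
  pd 0 lam w = 0.
Proof.
move=> oU sl l0 Uw H; have lw := l0 w Uw.
have sh : smooth_on U (fun u => (2 * lam u)^-1) :=
  smooth_conformal_h oU sl l0 0.
have sk (j : 'I_4) :
    smooth_on U (fun u => if (j == 0) || (j == 2) then (2 * lam u)^-1 else 0).
  by case: (_ || _) => //; exact: smooth_on_cst.
have D i : pd i (fun u => (2 * lam u)^-1) w = - (2^-1 * lam w ^- 2 * pd i lam w).
  exact: (pd_conformal_h sl l0 i 0 Uw).
have := H (pt 1 0).
rewrite (@poisson_cub_quadE _ U (fun j u => if (j == 0) || (j == 2)
    then (2 * lam u)^-1 else 0) (conformal_h lam) w (pt 1 0)
  (fun i j => if (j == 0) || (j == 2) then - (2^-1 * lam w ^- 2 * pd i lam w) else 0)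
  (fun i j => if j == 1 then 0 else - (2^-1 * lam w ^- 2 * pd i lam w))
  Uw sk (smooth_conformal_h oU sl l0)); first last.
- by move=> i j; rewrite (pd_conformal_h sl l0).
- by move=> i j; case: (_ || _); [exact: D|exact: derive_cst].
rewrite /cub /quad /dcub /dquad /conformal_h /= !pt0 !pt1.
move: (pd 0 lam w) (pd 1 lam w) => a b.
rewrite [X in X = 0 -> _](_ : _ = a * (4^-1 * lam w ^- 3)); last by field.
by move/eqP; rewrite !mulf_eq0 !invr_eq0 !expf_eq0 (negbTE lw) pnatr_eq0 /= orbF => /eqP.
Qed.

(** The cubic part is prescribed only through the powers of [t] in [F w (t *: p)], so no
    transformation law for coefficients is needed: the coefficients, with their smoothness, come
    from [F] being an integral in this chart and are identified with [C] by degree. *)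
Lemma cubic_integral_potential z r rho g F (mu : 'rV[R]_2 -> R)
    (C Q L : 'rV[R]_2 -> 'rV[R]_2 -> R) (e : 'rV[R]_2 -> R) : 0 < r < rho ->
  riemannian_on (ball z rho) g -> integral_on (ball z rho) g 3 F ->
  (forall w p, ball z rho w ->
     hamiltonian g w p = mu w / 2 * (p 0 0 * p 0 0 + p 0 1 * p 0 1)) ->
  (forall w p t, ball z rho w ->
     F w (t *: p) = t ^+ 3 * C w p + t ^+ 2 * Q w p + t * L w p + e w) ->
  (exists B : 'I_2 -> 'rV[R]_2 -> R, forall w p, ball z rho w ->
     C w p = p 0 0 * p 0 0 * p 0 0 - 3 * (p 0 0 * p 0 1 * p 0 1)
       + (p 0 0 * p 0 0 + p 0 1 * p 0 1) * (B 0 w * p 0 0 + B 1 w * p 0 1)) \/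
  (forall w p, ball z rho w ->
     C w p = mu w / 2 * (p 0 0 * p 0 0 + p 0 1 * p 0 1) * p 0 0) ->
  exists f, [/\ smooth_on (ball z r) f,
    forall w, ball z r w -> g w 0 0 = 4^-1 * laplacian f w
    & forall w, ball z r w -> pde_star f w].
Proof.
move=> rr rg Fi HE FE CE; set U := ball z rho in rg Fi HE FE CE.
have oU : open U by exact: ball_open.
have gE w : U w -> g w = ((mu w)^-1)%:M.
  by move=> Uw; apply: (conformal_metric rg Uw) => p; exact: HE.
(* Read off from the metric, which is smooth by hypothesis; nothing is assumed about the smoothness
   of [mu]. *)
pose lam w := g w 0 0.
have lamE w : U w -> lam w = (mu w)^-1 by move=> Uw; rewrite /lam gE// mxE eqxx.
have glam w : U w -> g w = (lam w)%:M by move=> Uw; rewrite lamE// gE.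
have sl : smooth_on U lam by have [+ _] := rg; exact.
have l0 w : U w -> lam w != 0.
  move=> Uw; have [+ _ _ _] := riemannian_inverse rg Uw.
  by rewrite glam// det_scalar expf_eq0.
have mul w : U w -> mu w = (lam w)^-1 by move=> Uw; rewrite lamE// invrK.
have [k [l2 [l1 [e' [sk FE' _ kH]]]]] := integral_cubic_part oU rg Fi.
have kC w p : U w -> cub (k ^~ w) p = C w p.
  move=> Uw; apply: (@homogeneous_top3 R _ (quad (l2 ^~ w) p) (lin (l1 ^~ w) p) (e' w)
    _ (Q w p) (L w p) (e w)) => t.
  by rewrite -FE// FE'// cubZ quadZ linZ.
have hE w : U w -> quad (hcoef g ^~ w) = quad (conformal_h lam ^~ w).
  by move=> Uw; congr quad; apply/funext => j; apply: hcoef_conformal; exact: glam.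
suff [b0 [b1 [s0 s1 E]]] : exists b0 b1, [/\ smooth_on U b0, smooth_on U b1 &
    forall w, U w -> [/\ pd 0 b0 w - pd 1 b1 w = - 3 * pd 0 lam w,
      pd 1 b0 w + pd 0 b1 w = 3 * pd 1 lam w &
      lam w * (pd 0 b0 w + pd 1 b1 w) + b0 w * pd 0 lam w + b1 w * pd 1 lam w = 0]].
  exact: (conformal_potential rr sl s0 s1 E).
case: CE => [[B CE]|CE].
- have kE w j : U w -> k j w = (fun j => if j == 0 then 1 + B 0 w
      else if j == 1 then B 1 w else if j == 2 then B 0 w - 3 else B 1 w) j.
    move=> Uw; move: j; apply: cub_inj => p.
    by rewrite kC// CE// /cub /=; ring.
  (* Inverts the definition of [conformal_k]; smoothness is inherited from [k], not from [B]. *)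
  pose b0 w := lam w * (k 0 w - 1); pose b1 w := lam w * k 1 w.
  have s0 : smooth_on U b0 by rewrite /b0; smooth_on oU.
  have s1 : smooth_on U b1 by rewrite /b1; smooth_on oU.
  exists b0, b1; split => // w Uw.
  apply/(conformal_poisson0P oU sl l0 s0 s1 Uw) => p.
  rewrite -[RHS](kH w p Uw); apply: (poisson_eq_on _ oU Uw) => v q Uv; last by rewrite hE.
  congr cub; apply/funext => j; rewrite kE// /conformal_k /b0 /b1 (kE _ 0)// (kE _ 1)//=.
  have lv := l0 v Uv.
  by move: j; apply: ord4P => /=; field.
have kE w j : U w -> k j w = (fun j => if (j == 0) || (j == 2) then (2 * lam w)^-1
    else 0) j.
  move=> Uw; move: j; apply: cub_inj => p; have lw := l0 w Uw.
  by rewrite kC// CE// mul// /cub /=; field.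
have L0 w : U w -> pd 0 lam w = 0.
  move=> Uw; apply: (killing_conformal oU sl l0 Uw) => p.
  rewrite -[RHS](kH w p Uw); apply: (poisson_eq_on _ oU Uw) => v q Uv; last by rewrite hE.
  by congr (cub _ q); apply/funext => j; rewrite kE.
(* This choice prescribes the Hessian [P = Q = 0], [S = 4 lam], consistent because [lam] does not
   depend on the first coordinate. *)
exists (fun w => 3 * lam w), (fun=> 0); split.
- by smooth_on oU.
- exact: smooth_on_cst.
move=> w Uw.
have D i : pd i (fun w => 3 * lam w) w = 3 * pd i lam w.
  have dl := smooth_is_derive i sl Uw.
  by apply: pd_is_derive; isD_eq; ring.
have D0 i : pd i (fun=> 0 : R) w = 0 by exact: derive_cst.
by rewrite !D !D0 (L0 w Uw); split; ring.
Qed.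

End conformal_chart_potential.

(** * Conformal charts from a cubic integral *)

Section cubic_integral_charts.
Context {R : realType} {M : topologicalType}.
Variables (A : set (chart R M)) (g : chart R M -> 'rV[R]_2 -> 'M[R]_2).
Variable F : chart R M -> 'rV[R]_2 -> 'rV[R]_2 -> R.
Hypotheses (hA : maximal_atlas A) (hg : riemannian_metric A g).
Hypothesis hF : geodesic_integral A g 3 F.

Lemma new_chart_pullback c N psi phi u p : A c -> open N -> N `<=` cimg c ->
  open (psi @` N) -> (forall u, N u -> phi (psi u) = u) -> smooth_map_on N psi ->
  smooth_map_on (psi @` N) phi -> N u ->
  let c' := new_chart c N psi phi in
  hamiltonian (g c') (psi u) p = hamiltonian (g c) u (p *m ('J psi u)^T) /\
  F c' (psi u) p = F c u (p *m ('J psi u)^T).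
Proof.
move=> Ac oN Nc oW phiK sp sphi Nu c'.
have Ac' : A c' := new_chart_atlas hA Ac oN Nc oW phiK sp sphi.
have [ov tE JE] := new_chart_transition hA Ac oN Nc oW phiK sp sphi Nu.
have [rg rt] := hg; have [cF _] := hF.
split; last by rewrite -JE (cF c c' Ac Ac' u p ov) tE.
have [dg _ _ _] := riemannian_inverse (rg c Ac) (Nc _ Nu).
have ug : g c u \in unitmx by rewrite unitmxE unitfE.
have gJ := rt c c' Ac Ac' u ov; rewrite tE in gJ.
by rewrite /hamiltonian -JE (hamiltonian_pullback p ug gJ).
Qed.

Lemma cubic_integral_conformal_chart (O : set M) x : open O -> O x ->
  exists2 y, O y & exists c, [/\ A c, cdom c y & exists lam f : 'rV[R]_2 -> R,
    [/\ smooth_on (cimg c) f, forall u, cimg c u -> g c u = (lam u)%:M,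
        forall u, cimg c u -> lam u = 4^-1 * laplacian f u
      & forall u, cimg c u -> pde_star f u]].
Proof.
move=> oO Ox; have [isc cov _ _] := hA; have [c [Ac cx]] := cov x.
have hc := isc c Ac; have [_ oU _ _ _] := hc; have [rg _] := hg; have [_ iF] := hF.
have [k [l2 [l1 [l0 [sk FE kd kH]]]]] := integral_cubic_part oU (rg c Ac) (iF c Ac).
have oO' := open_chart_image hc oO.
have Ux : cimg c (cmap c x) by exists x.
have Ox' : (cmap c @` (cdom c `&` O)) (cmap c x) by exists x.
have [x1 [V [X [mu [[oV Vx1 VU VO] [sX smu] Dmu HE kE]]]]] :=
  adapted_frame oU (rg c Ac) sk kd oO' Ox' Ux.
have D0 u (Vu : V u) := (Dmu u Vu).1; have mu0 u (Vu : V u) := (Dmu u Vu).2.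
have br u i : V u -> frame_bracket X u i = 0.
  move=> Vu; case: kE => [[B sB kE]|kE].
  - apply: (harmonic_frame_commutes Vu sX smu (mu0 u Vu) (D0 u Vu) sB) => p.
    rewrite -[RHS](kH u p (VU _ Vu)); apply: (poisson_eq_on _ oV Vu) => v q Vv.
    + by rewrite kE.
    + by rewrite -hamiltonianE HE.
  - apply: (killing_frame_commutes Vu sX smu (mu0 u Vu) (D0 u Vu)) => p.
    rewrite -[RHS](kH u p (VU _ Vu)); apply: (poisson_eq_on _ oV Vu) => v q Vv.
    + by rewrite kE.
    + by rewrite -hamiltonianE HE.
have [N [psi [phi [rho [[oN Nx1 NV rho0] NW phiK [sp sphi] dual]]]]] :=
  frame_coordinates oV sX D0 br Vx1.
set z := psi x1 in NW sphi; pose r := rho / 2.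
have rr : 0 < r < rho by apply/andP; rewrite /r; split; lra.
have r0 : 0 < r by case/andP: rr.
(* Used for two radii: the chart with image of radius [rho] serves to construct [f], which lives on
   the ball of radius [r] only, and the chart restricted to that ball is the final one. *)
have chartP N' s : open N' -> N' `<=` N -> psi @` N' = ball z s ->
    let c' := new_chart c N' psi phi in
    [/\ A c', cimg c' = ball z s & forall w p, ball z s w ->
      hamiltonian (g c') w p = mu (phi w) / 2 * (p 0 0 * p 0 0 + p 0 1 * p 0 1) /\
      F c' w p = F c (phi w) (p *m ('J psi (phi w))^T)].
  move=> oN' N'N N'W c'.
  have N'c : N' `<=` cimg c by move=> u /N'N/NV/VU.
  have oW : open (psi @` N') by rewrite N'W; exact: ball_open.
  have phiK' u (N'u : N' u) := phiK u (N'N _ N'u).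
  have sp' : smooth_map_on N' psi by move=> j; exact: smooth_on_subset N'N (sp j).
  have sphi' : smooth_map_on (psi @` N') phi.
    move=> j; apply: smooth_on_subset (sphi j).
    by move=> _ [u /N'N Nu <-]; rewrite -NW; exists u.
  split.
  - exact: new_chart_atlas hA Ac oN' N'c oW phiK' sp' sphi'.
  - by rewrite (new_chart_image psi phi hA Ac N'c).
  - move=> w p; rewrite -N'W => -[u N'u <-].
    have [H1 H2] := new_chart_pullback p Ac oN' N'c oW phiK' sp' sphi' N'u.
    rewrite phiK'//; split => //; rewrite H1 HE; last exact/NV/N'N.
    by rewrite /frame_energy !dual//; exact: N'N.
have [Ac1 c1W c1E] := chartP N rho oN (@subset_refl _ N) NW.
set c1 := new_chart c N psi phi in Ac1 c1W c1E.
have rg1 := rg c1 Ac1; have iF1 := iF c1 Ac1; rewrite c1W in rg1 iF1.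
have phiN w : ball z rho w -> N (phi w).
  by rewrite -NW => -[u Nu <-]; rewrite phiK.
pose q (w p : 'rV[R]_2) : 'rV[R]_2 := p *m ('J psi (phi w))^T.
have [w p t Bw||f [sf lf sf_star]] := @cubic_integral_potential R z r rho (g c1) (F c1)
    (fun w => mu (phi w)) (fun w p => cub (k ^~ (phi w)) (q w p))
    (fun w p => quad (l2 ^~ (phi w)) (q w p)) (fun w p => lin (l1 ^~ (phi w)) (q w p))
    (fun w => l0 (phi w)) rr rg1 iF1 (fun w p Bw => (c1E w p Bw).1).
- rewrite (c1E w _ Bw).2 FE; last exact/VU/NV/phiN.
  by rewrite -scalemxAl -/(q w p) cubZ quadZ linZ.
- case: kE => [[B sB kE]|kE]; [left|right].
    exists (fun k w => B k (phi w)) => w p Bw.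
    by rewrite (kE _ _ (NV _ (phiN w Bw))) /frame_harmonic /= /q !(dual _ _ _ (phiN w Bw)).
  move=> w p Bw.
  by rewrite (kE _ _ (NV _ (phiN w Bw))) /frame_energy /= /q !(dual _ _ _ (phiN w Bw)).
pose N2 := N `&` psi @^-1` ball z r.
have BB : ball z r `<=` ball z rho by apply: le_ball; case/andP: rr => _ /ltW.
have oN2 : open N2.
  apply: open_preimage_on => //; first exact: ball_open.
  by move=> u Nu; exact: smooth_map_continuous sp Nu.
have N2W : psi @` N2 = ball z r.
  rewrite eqEsubset; split=> [_ [u [_ Bu] <-] //|w Bw].
  have := BB _ Bw; rewrite -NW => -[u Nu uw]; exists u => //.
  by split => //; rewrite /preimage /= uw.
have [Ac2 c2W c2E] := chartP N2 r oN2 (@subIsetl _ _ _) N2W.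
set c2 := new_chart c N2 psi phi in Ac2 c2W c2E.
have rg2 := rg c2 Ac2; rewrite c2W in rg2.
have [y [cy Oy] yx1] := VO _ Vx1.
(* Both charts have the same coordinates, and in both the metric is determined by [mu (phi w)], so
   the conformal factor found in the larger chart serves in the smaller one. *)
have gE2 w : ball z r w -> g c2 w = (g c1 w 0 0)%:M.
  move=> Bw; rewrite (conformal_metric rg2 Bw (fun p => (c2E w p Bw).1)).
  rewrite (conformal_metric rg1 (BB _ Bw) (fun p => (c1E w p (BB _ Bw)).1)).
  by rewrite [X in _ = X%:M]mxE eqxx.
exists y => //; exists c2; split => //.
  rewrite /= /preimage /= yx1; split => //; split => //; exact: ballxx.
exists (fun w => g c1 w 0 0), f; rewrite c2W; split => //.
Qed.

End cubic_integral_charts.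

Theorem theorem3p1 (R : realType) :
  (forall (U : set 'rV[R]_2) (lambda : 'rV[R]_2 -> R),
     open U ->
     riemannian_on U (fun x => (lambda x)%:M) ->
     (exists f : 'rV[R]_2 -> R,
        [/\ smooth_on U f,
            forall x, U x -> lambda x = 4^-1 * laplacian f x
          & forall x, U x -> pde_star f x]) ->
     exists F : 'rV[R]_2 -> 'rV[R]_2 -> R,
       integral_on U (fun x => (lambda x)%:M) 3 F)
  /\
  (forall (M : topologicalType) (A : set (chart R M))
          (g : chart R M -> 'rV[R]_2 -> 'M[R]_2)
          (F : chart R M -> 'rV[R]_2 -> 'rV[R]_2 -> R),
     smooth_surface A ->
     riemannian_metric A g ->
     geodesic_integral A g 3 F ->
     ~ reducible_integral A g 3 F ->
     dense [set x : M | exists c : chart R M,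
       [/\ A c, cdom c x
         & exists (lambda f : 'rV[R]_2 -> R),
           [/\ smooth_on (cimg c) f,
               forall u, cimg c u -> g c u = (lambda u)%:M,
               forall u, cimg c u -> lambda u = 4^-1 * laplacian f u
             & forall u, cimg c u -> pde_star f u]]]).
Proof.
split=> [U lam oU rg [f [sf lf sf_star]]|M A g F [_ _ hA] hg hF _ O [x Ox] oO].
  exact: cubic_integral_of_potential oU rg sf lf sf_star.
have [y Oy yP] := cubic_integral_conformal_chart hA hg hF oO Ox.
by exists y.
Qed.
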